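(* Let $d\ge 1$, let $\mathbb{F}=(\mathcal{F}_n)_{n\ge 0}$ be a filtration, and let $(\varepsilon_n)$ be a real martingale difference sequence adapted to $\mathbb{F}$ with $\mathbb{E}[\varepsilon_{n+1}^2\mid\mathcal{F}_n]=\sigma^2$ a.s. for all $n\ge 0$ (with $\sigma^2$ a deterministic constant). Suppose that for some integer $p\ge 1$ and some real number $a>2p$, $$\sup_{n\ge 0}\mathbb{E}\bigl[|\varepsilon_{n+1}|^{a}\mid\mathcal{F}_n\bigr]<\infty\quad\text{a.s.}$$ Let $(\Phi_n)_{n\ge 0}$ be a sequence of random vectors in $\mathbb{R}^d$ adapted to $\mathbb{F}$, and let $M_n$, $S_n$, $d_n$, $f_n$ be defined from $(\Phi_n)$ and $(\varepsilon_n)$ as in the context. Assume that $f_n\to 0$ a.s., and that there exist a positive random sequence $(\alpha_n)$ increasing to infinity and an invertible symmetric matrix $L$ such that $$\lim_{n\to\infty}\frac{1}{\alpha_n}S_n=L\quad\text{a.s.}$$ Then, almost surely, $$\lim_{n\to\infty}\frac{1}{\log d_n}\sum_{k=1}^n f_k\bigl(M_k^tS_{k-1}^{-1}M_k\bigr)^p=\ell(p):=d\,\sigma^{2p}\prod_{j=1}^{p-1}(d+2j)$$ and $$\lim_{n\to\infty}\frac{1}{\log d_n}\sum_{k=1}^n\Bigl[\bigl(M_k^tS_{k-1}^{-1}M_k\bigr)^p-\bigl(M_k^tS_k^{-1}M_k\bigr)^p\Bigr]=\lambda(p):=\frac{p}{d}\,\ell(p).$$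
   Context: The superscript $t$ denotes transpose. The vector martingale transform is $M_n=M_0+\sum_{k=1}^n\Phi_{k-1}\varepsilon_k$, where $M_0$ is an arbitrary ($\mathcal{F}_0$-measurable) vector in $\mathbb{R}^d$. Further, $S_n=\sum_{k=0}^n\Phi_k\Phi_k^t+S$, where $S$ is a fixed deterministic symmetric positive definite $d\times d$ matrix; $d_n=\det(S_n)$; and the explosion coefficient is $f_n=\Phi_n^tS_n^{-1}\Phi_n=(d_n-d_{n-1})/d_n$. An empty product equals $1$. *)

(* Defs.v *)
From HB Require Import structures.
From mathcomp Require Import all_boot all_order all_algebra.
From mathcomp Require Import all_classical all_reals all_analysis.
From mathcomp Require Import measurable_realfun.

Set Implicit Arguments.
Unset Strict Implicit.
Unset Printing Implicit Defensive.

Import Order.TTheory GRing.Theory Num.Theory.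
Import numFieldNormedType.Exports.

Local Open Scope classical_set_scope.
Local Open Scope ring_scope.

Section conditioning.
Context {disp : measure_display} {T : measurableType disp} {R : realType}.
Variable P : probability T R.

Definition sub_sigma_algebra_of (G : set (set T)) : Prop :=
  sigma_algebra setT G /\ G `<=` (@measurable disp T).

Definition filtration (F : nat -> set (set T)) : Prop :=
  (forall n, sub_sigma_algebra_of (F n)) /\
  (forall m n, (m <= n)%N -> F m `<=` F n).

Definition measurable_wrt (G : set (set T)) {disp' : measure_display}
    {U : measurableType disp'} (X : T -> U) : Prop :=
  measurable_fun [set: g_sigma_algebraType G] (X : g_sigma_algebraType G -> U).

(* The Borel sigma-algebra of R^d is the product one, so measurability of a
   random vector is measurability of its coordinates. *)
Definition vector_measurable_wrt (G : set (set T)) (d : nat)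
    (X : T -> 'cV[R]_d) : Prop :=
  forall i, measurable_wrt G (fun w => X w i 0).

(* [Y] is a version of E[X | G], for [G] a sub-sigma-algebra and [X] either
   integrable or nonnegative (then with values in [0, +oo]). Integrability,
   resp. a.s. nonnegativity, of [Y] follows from that of [X] by integrating over
   [Y < 0] and [Y >= 0]. *)
Definition is_cond_expectation (G : set (set T)) (X Y : T -> \bar R) : Prop :=
  measurable_wrt G Y /\
  forall A, G A -> (\int[P]_(w in A) Y w = \int[P]_(w in A) X w)%E.

(* A martingale difference sequence is indexed from 1: [eps 0] is a dummy. *)
Definition martingale_difference (F : nat -> set (set T))
    (eps : nat -> T -> R) : Prop :=
  forall n, [/\ measurable_wrt (F n.+1) (eps n.+1),
    P.-integrable setT (EFin \o eps n.+1) &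
    is_cond_expectation (F n) (EFin \o eps n.+1) (cst 0%E)].

End conditioning.

Definition quad_form {R : realType} {d : nat} (A : 'M[R]_d) (v : 'cV[R]_d) : R :=
  (v^T *m A *m v) 0 0.

Definition sym_posdef {R : realType} {d : nat} (A : 'M[R]_d) : Prop :=
  A^T = A /\ forall v, v != 0 -> 0 < quad_form A v.

Section transform.
Context {T : Type} {R : realType} {d : nat}.
Variables (S : 'M[R]_d) (M0 : T -> 'cV[R]_d).
Variables (Phi : nat -> T -> 'cV[R]_d) (eps : nat -> T -> R).

Definition mart_transform (n : nat) (w : T) : 'cV[R]_d :=
  M0 w + \sum_(1 <= k < n.+1) eps k w *: Phi k.-1 w.

Definition Smx (n : nat) (w : T) : 'M[R]_d :=
  \sum_(0 <= k < n.+1) (Phi k w *m (Phi k w)^T) + S.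

Definition detS (n : nat) (w : T) : R := \det (Smx n w).

Definition explosion (n : nat) (w : T) : R :=
  quad_form (invmx (Smx n w)) (Phi n w).

End transform.

Definition ell {R : realType} (d : nat) (sigma : R) (p : nat) : R :=
  d%:R * sigma ^+ (2 * p) * \prod_(1 <= j < p) (d + 2 * j)%:R.

Definition lambda {R : realType} (d : nat) (sigma : R) (p : nat) : R :=
  p%:R / d%:R * ell d sigma p.

(* Main.v *)
(** Let [V_k = M_k^t S_(k-1)^-1 M_k] and let [H_k = M_k^t S_k^-1 M_k <= V_k] be its
    value after the update of [S]. Then
      [V_(k+1) = H_k + 2 eps_(k+1) b_k + eps_(k+1)^2 f_k],
      [b_k = Phi_k^t S_k^-1 M_k], [b_k^2 = (1 - f_k) (V_k - H_k)].
    Expanding [V_(k+1)^q] and applying strong laws to the noise gives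
      [V_n^q + sum (V^q - H^q) - sigma^2 sum (q H^(q-1) f + 2 q (q-1) H^(q-2) b^2)
        = o(sum f)].
    The same computation applies to [W_k = M_k^t L^-1 M_k / s_k] with
    [s_k = 1 + sum_(j < k) Phi_j^t L^-1 Phi_j], whose decrement is
    [W_k - H_k = delta_k W_k], [delta_k = 1 - s_k / s_(k+1)]. As [s_k S_(k-1)^-1] tends
    to [d L^-1], one has [V ~ d W], [f ~ d delta] and [log d_n ~ d sum delta]. By
    induction on [q] the second law (through a Tauberian argument) gives the limit of
    the averages of [f V^q] and shows [V_n^q = o(log d_n)]; the first law then gives
    that of [V^q - H^q], hence of the averages of [V^(q-1) b^2], needed for [q + 1].

    Conditional expectations are only compared through integrals over events of the
    past. Strong laws come from Doob's maximal inequality for the nonnegative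
    supermartingale [(1 + (N_n)_+^s / r_n^s) / prod (1 + w_k)], where [N] is the sum of
    the noise terms, [r] a predictable normaliser, [1 < s <= 2] and [w_k] the
    conditional moment of order [s] of the increment divided by [r_(k+1)^s]. The
    normaliser contains the running maximum of [V^q], so no a priori bound on [V] is
    required. *)

Require Import Defs.
From HB Require Import structures.
From mathcomp Require Import all_boot all_order all_algebra.
From mathcomp Require Import all_classical all_reals all_analysis.
From mathcomp Require Import measurable_realfun.
From mathcomp Require Import ring lra.

Set Implicit Arguments.
Unset Strict Implicit.
Unset Printing Implicit Defensive.

Import Order.TTheory GRing.Theory Num.Theory.
Import numFieldNormedType.Exports.

Local Open Scope classical_set_scope.
Local Open Scope ring_scope.

(** * Inequalities for real powers *)

(** Neither normalisation closes the recursion alone. Up to [1 - f], the decrement [V - H] is the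
    square of the cross coefficient [b], which for [d > 1] also depends on a direction and not only
    on [f] and [V]. The decrement of [W] is the exact multiple [delta W], so its law determines the
    averages of [delta W^q]; but the right-hand side of that law contains squared cross terms, whose
    averages only the first law provides. Each law feeds the other. The sequence [alpha] is not
    assumed adapted and so cannot normalise a martingale argument, whereas [s] is predictable. The
    factor [d] is a trace: [s_n / alpha_n] tends to the trace of [L^-1 L]. If [m_q] is the limit of
    the averages of [delta W^q], the second law gives [(q+1) m_(q+1) = sigma^2 ((q+1) m_q + 2 (q+1)
    q m_q / d)]. Hence [m_q] is the moment of order [q] of [sigma^2 / d] times a chi-square variable
    with [d] degrees of freedom, and [ell(p) = d^p m_p]. The condition [a > 2p] leaves room for an
    order [s > 1] with [2 p s <= a]: the top power [eps^(2p)] then has a conditional moment of order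
    [s], as the strong laws require. *)

Section powR_inequalities.
Context {R : realType}.
Implicit Types x y h q s g : R.

(** Concavity of the logarithm at [m], the mean of [y] and 1 with weights [q] and [1 - q]: the
    bounds [ln z <= z - 1] at [z = y / m] and [z = 1 / m], taken with these weights, have right-hand
    sides adding up to 0. *)
Lemma powR_le_affine q y : 0 <= q <= 1 -> 0 < y -> y `^ q <= 1 + q * (y - 1).
Proof.
move=> /andP[q0 q1] y0; set m := 1 + q * (y - 1).
have m0 : 0 < m.
  have [q00|qn0] := eqVneq q 0; first by rewrite /m q00; lra.
  have qp : 0 < q by rewrite lt_neqAle eq_sym qn0.
  have := mulr_gt0 qp y0; rewrite /m; lra.
rewrite -ler_ln ?posrE ?powR_gt0 // ln_powR -subr_le0.
have lnle (z : R) : 0 < z -> ln z <= z - 1.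
  by move=> z0; rewrite -{2}(lnK z0) lerBrDr addrC expR_ge1Dx.
have H1 := lnle (y / m) (divr_gt0 y0 m0).
have im0 : 0 < m^-1 by rewrite invr_gt0.
have H2 := lnle _ im0.
rewrite lnM ?posrE // lnV ?posrE // in H1; rewrite lnV ?posrE // in H2.
have E : q * (y / m - 1) + (1 - q) * (m^-1 - 1) = 0.
  by rewrite /m; field; rewrite -/m gt_eqF.
have H3 : q * (ln y - ln m) <= q * (y / m - 1) by rewrite ler_wpM2l.
have H4 : (1 - q) * (- ln m) <= (1 - q) * (m^-1 - 1).
  by rewrite ler_wpM2l // subr_ge0.
lra.
Qed.

Lemma powR_subadditive q x y : 0 <= q <= 1 -> 0 <= x -> 0 <= y ->
  (x + y) `^ q <= x `^ q + y `^ q.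
Proof.
move=> /andP[q0 q1] x0 y0.
have [->|xn0] := eqVneq x 0; first by rewrite add0r lerDr powR_ge0.
have [->|yn0] := eqVneq y 0; first by rewrite addr0 lerDl powR_ge0.
have xp : 0 < x by rewrite lt_neqAle eq_sym xn0.
have yp : 0 < y by rewrite lt_neqAle eq_sym yn0.
have sp : 0 < x + y by rewrite addr_gt0.
have frac z : 0 < z -> z <= x + y -> z / (x + y) * (x + y) `^ q <= z `^ q.
  move=> z0 zs; rewrite -[in leRHS](divfK (lt0r_neq0 sp) z).
  have zs0 : 0 <= z / (x + y) by rewrite divr_ge0 ?ltW.
  rewrite [in leRHS]powRM //; last exact: ltW.
  apply: ler_wpM2r; first exact: powR_ge0.
  by apply: ger1_powR; rewrite // divr_gt0 //= ler_pdivrMr // mul1r.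
have := lerD (frac x xp _) (frac y yp _); rewrite lerDl lerDr => /(_ y0 x0).
by rewrite -mulrDl -mulrDl divff ?gt_eqF // mul1r.
Qed.

(** The derivative [s x_+^(s-1)] is Holder continuous of exponent [s - 1 <= 1], so [|h|^s] can
    replace a second-order term. In conditional mean the linear term will drop out, and only a
    moment of order [s], possibly below 2, is spent. *)
Lemma powR_pos_part_expansion s x h : 1 < s <= 2 ->
  Num.max (x + h) 0 `^ s <=
  Num.max x 0 `^ s + s * Num.max x 0 `^ (s - 1) * h + `|h| `^ s.
Proof.
move=> /andP[s1 s2]; have s0 : 0 < s by lra.
have q01 : 0 <= s - 1 <= 1 by apply/andP; split; lra.
have q0 : 0 < s - 1 by lra.
have [x0|x0] := leP x 0.
  rewrite !powR0 ?gt_eqF // mulr0 mul0r !add0r.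
  apply: (ge0_ler_powR (ltW s0)); rewrite ?nnegrE //.
    by rewrite le_max lexx orbT.
  rewrite ge_max normr_ge0 andbT; apply: le_trans (ler_norm h); lra.
have x0' : 0 <= x by exact: ltW.
(* Splitting off one factor leaves the exponent [s - 1] in [0, 1]: the affine bound treats
   [x (x + h)^(s-1)], subadditivity treats [h (x + h)^(s-1)]. *)
have powRS (z : R) : 0 <= z -> z `^ s = z * z `^ (s - 1).
  by move=> z0; rewrite mulr_powRB1.
have [h0|h0] := leP 0 h.
  have xh0 : 0 < x + h by lra.
  have xh0' := ltW xh0.
  rewrite max_l // ger0_norm // powRS // mulrDl.
  have A1 : x * (x + h) `^ (s - 1) <= x `^ s + (s - 1) * x `^ (s - 1) * h.
    have -> : x + h = x * (1 + h / x) by field; rewrite gt_eqF.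
    have hx : 0 <= h / x by rewrite divr_ge0.
    rewrite powRM //; last by lra.
    have := @powR_le_affine (s - 1) (1 + h / x) q01 ltac:(lra).
    move=> /(ler_wpM2l (mulr_ge0 (ltW x0) (powR_ge0 x (s - 1)))) A1.
    rewrite mulrA; apply: (le_trans A1); rewrite powRS //.
    have -> : x * x `^ (s - 1) * (1 + (s - 1) * (1 + h / x - 1)) =
      x * x `^ (s - 1) + (s - 1) * x `^ (s - 1) * h by field; rewrite gt_eqF.
    by [].
  have A2 : h * (x + h) `^ (s - 1) <= h * x `^ (s - 1) + h `^ s.
    rewrite [h `^ s]powRS // -mulrDr ler_wpM2l //.
    by apply: powR_subadditive => //; exact: ltW.
  nra.
have [xh0|xh0] := leP 0 (x + h).
  rewrite ltr0_norm // powRS //.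
  have A1 : x * (x + h) `^ (s - 1) <= x `^ s + (s - 1) * x `^ (s - 1) * h.
    have [->|xhn0] := eqVneq (x + h) 0.
      rewrite powR0 ?gt_eqF // mulr0 powRS //.
      have -> : x * x `^ (s - 1) + (s - 1) * x `^ (s - 1) * h =
        x `^ (s - 1) * (x + (s - 1) * h) by ring.
      apply: mulr_ge0; [exact: powR_ge0|nra].
    have xhp : 0 < x + h by rewrite lt_neqAle eq_sym xhn0.
    have E : x + h = x * (1 + h / x) by field; rewrite gt_eqF.
    have hx : 0 < 1 + h / x by rewrite E pmulr_rgt0 // in xhp.
    have hx' := ltW hx.
    rewrite E powRM //.
    have := powR_le_affine q01 hx.
    move=> /(ler_wpM2l (mulr_ge0 (ltW x0) (powR_ge0 x (s - 1)))) A1.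
    rewrite mulrA; apply: (le_trans A1); rewrite powRS //.
    have -> : x * x `^ (s - 1) * (1 + (s - 1) * (1 + h / x - 1)) =
      x * x `^ (s - 1) + (s - 1) * x `^ (s - 1) * h by field; rewrite gt_eqF.
    by [].
  have A2 : (- h) * x `^ (s - 1) <= (- h) * (x + h) `^ (s - 1) + (- h) `^ s.
    have h0' : 0 <= - h by lra.
    rewrite [(- h) `^ s]powRS // -mulrDr ler_wpM2l //.
    by have := @powR_subadditive (s - 1) (x + h) (- h) q01 xh0 h0'; rewrite addrK.
  nra.
rewrite powR0 ?gt_eqF // ltr0_norm //.
(* The left side is now 0. Young's inequality with exponents [s] and [s / (s - 1)] bounds
   [s x^(s-1) |h|] by [|h|^s + (s - 1) x^s], and [s - 1 <= 1]. *)
have h0' : 0 <= - h by lra.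
have := @conjugate_powR R (- h) (x `^ (s - 1)) s (s / (s - 1)) h0' (powR_ge0 _ _) s0.
rewrite divr_gt0 // => /(_ isT); rewrite -powRrM.
have -> : (s - 1) * (s / (s - 1)) = s by field; rewrite gt_eqF.
have -> : s^-1 + (s / (s - 1))^-1 = 1 by field; rewrite !gt_eqF.
move=> /(_ erefl) /(ler_wpM2l (ltW s0)).
have -> : s * ((- h) `^ s / s + x `^ s / (s / (s - 1))) =
  (- h) `^ s + (s - 1) * x `^ s by field; rewrite !gt_eqF.
have := powR_ge0 x s; nra.
Qed.

(** Comparison with the integral of [t^(-1-g)] over [x, y]. Without denominators it reads
    [g (1 - x / y) <= (y / x)^g - 1], which follows from [1 - x / y <= ln (y / x)] and
    [1 + u <= expR u]. *)
Lemma powR_telescope_step g x y : 0 < g -> 0 < x -> x <= y ->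
  (y - x) / y `^ (1 + g) <= (x `^ (- g) - y `^ (- g)) / g.
Proof.
move=> g0 x0 xy; have y0 : 0 < y by exact: lt_le_trans xy.
have yg : 0 < y `^ g by exact: powR_gt0.
have x0' := ltW x0; have y0' := ltW y0.
have -> : y `^ (1 + g) = y * y `^ g.
  by rewrite powRD ?(gt_eqF y0) ?implybT // powRr1.
rewrite !powRN; have xg : 0 < x `^ g by exact: powR_gt0.
rewrite ler_pdivlMr // -(ler_pM2r yg) [leRHS]mulrBl mulVf ?gt_eqF //.
have -> : (y - x) / (y * y `^ g) * g * y `^ g = g * (1 - x / y).
  by field; rewrite !gt_eqF.
have -> : (x `^ g)^-1 * y `^ g = expR (g * ln (y / x)).
  rewrite -ln_powR lnK ?posrE ?powR_gt0 ?divr_gt0 //.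
  rewrite powRM ?invr_ge0 // -(powR_inv1 x0') powRAC mulrC powR_inv1 //.
  exact: powR_ge0.
apply: (@le_trans _ _ (g * ln (y / x))); last first.
  by rewrite lerBrDl expR_ge1Dx.
apply: ler_wpM2l; first exact: ltW.
have xy0 : 0 < x / y by rewrite divr_gt0.
have := expR_ge1Dx (ln (x / y)); rewrite lnK ?posrE // => H.
have -> : y / x = (x / y)^-1 by rewrite invf_div.
by rewrite lnV ?posrE //; lra.
Qed.

Lemma telescope_series_bounded g (r : nat -> R) n : 0 < g -> 1 <= r 0%N ->
  (forall n, r n <= r n.+1) ->
  \sum_(0 <= k < n) (r k.+1 - r k) / r k.+1 `^ (1 + g) <= g^-1.
Proof.
move=> g0 r1 rnd.
have r0 k : 1 <= r k by elim: k => // k IH; exact: le_trans (rnd k).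
have rp k : 0 < r k by exact: lt_le_trans (r0 k).
apply: (@le_trans _ _ (\sum_(0 <= k < n) (r k `^ (- g) - r k.+1 `^ (- g)) / g)).
  by apply: ler_sum => k _; apply: powR_telescope_step.
rewrite -mulr_suml -[leRHS]mul1r; apply: ler_wpM2r.
  by rewrite invr_ge0 ltW.
have -> : \sum_(0 <= k < n) (r k `^ (- g) - r k.+1 `^ (- g)) =
    r 0%N `^ (- g) - r n `^ (- g).
  elim: n => [|n IH]; first by rewrite big_geq // subrr.
  by rewrite big_nat_recr //= IH; ring.
rewrite powRN; have := powR_ge0 (r n) (- g).
suff : (r 0%N `^ g)^-1 <= 1 by lra.
rewrite invf_le1 ?powR_gt0 // -[leLHS](powRr0 (r 0%N)).
by apply: ler_powR => //; exact: ltW.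
Qed.

End powR_inequalities.

(** * Remainder of the binomial expansion *)

Section binomial_remainder.
Context {R : realType}.
Implicit Types h g b e y eta : R.

(** All terms are homogeneous of degree [i + j + 2], so only the ratio [y / h] matters: below a
    threshold [t <= eta] the first term on the right suffices, above it the second does with
    [K = t^(-i)]. *)
Lemma monomial_interpolation (eta : R) i j : 0 < eta -> exists2 K, 0 <= K &
  forall h y, 0 <= h -> 0 <= y ->
  h ^+ i * y ^+ j.+2 <= eta * (h ^+ (i + j).+1 * y) + K * y ^+ (i + j).+2.
Proof.
move=> eta0; pose t := Num.min eta 1.
have t0 : 0 < t by rewrite lt_min eta0 ltr01.
have t1 : t <= 1 by rewrite ge_min lexx orbT.
have te : t <= eta by rewrite ge_min lexx.
exists (t ^- i); first by rewrite invr_ge0 exprn_ge0 // ltW.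
move=> h y h0 y0; have [yh|yh] := leP y (t * h).
  apply: (@le_trans _ _ (eta * (h ^+ (i + j).+1 * y))); last first.
    by rewrite lerDl mulr_ge0 ?invr_ge0 ?exprn_ge0 // ltW.
  have th0 : 0 <= t * h by rewrite mulr_ge0 // ltW.
  have H : y ^+ j.+1 <= (t * h) ^+ j.+1 by rewrite lerXn2r.
  have tj : t ^+ j.+1 <= eta.
    apply: le_trans te; rewrite exprS -[leRHS]mulr1.
    by apply: ler_wpM2l; [exact: ltW|rewrite exprn_ile1 // ltW].
  rewrite exprS mulrCA mulrC.
  have -> : eta * (h ^+ (i + j).+1 * y) = (h ^+ i * (eta * h ^+ j.+1)) * y.
    by rewrite -addnS exprD; ring.
  apply: ler_wpM2r => //; apply: ler_wpM2l; first exact: exprn_ge0.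
  apply: le_trans H _; rewrite exprMn.
  by apply: ler_wpM2r => //; exact: exprn_ge0.
apply: (@le_trans _ _ (t ^- i * y ^+ (i + j).+2)); last first.
  by rewrite lerDr mulr_ge0 ?mulr_ge0 ?exprn_ge0 // ltW.
have H : h ^+ i <= (y / t) ^+ i.
  rewrite lerXn2r ?nnegrE ?divr_ge0 //; first exact: ltW.
  by rewrite ler_pdivlMr // mulrC ltW.
have -> : t ^- i * y ^+ (i + j).+2 = (y / t) ^+ i * y ^+ j.+2.
  by rewrite -!addnS exprD exprMn exprVn; ring.
by apply: ler_wpM2r => //; exact: exprn_ge0.
Qed.

(** These are the terms of order at least 3 in [e]; the coefficient [2 p (p - 1)] is
    [4 binom(p, 2)]. At [p = 1] the truncated exponent [p.-2] is harmless, since its term carries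
    the factor [p.-1%:R = 0]. *)
Definition power_remainder p h g b e :=
  (h + 2 * e * b + e ^+ 2 * g) ^+ p - h ^+ p
  - (2 * p%:R * h ^+ p.-1 * b) * e
  - (p%:R * h ^+ p.-1 * g + 2 * p%:R * p.-1%:R * h ^+ p.-2 * b ^+ 2) * e ^+ 2.

Lemma power_remainder1 h g b e : power_remainder 1 h g b e = 0.
Proof. by rewrite /power_remainder /= !expr0 !expr1; ring. Qed.

(** With [y = e^2 g], the square of the right side is at least [4 h y], which dominates [(2 e b)^2]
    because [b^2 <= g h]. *)
Lemma cross_term_bound (th : R) h g b e : 0 < th -> 0 <= h -> 0 <= g ->
  b ^+ 2 <= g * h -> `|2 * e * b| <= th * h + (e ^+ 2 * g) / th.
Proof.
move=> th0 h0 g0 bg; have y0 : 0 <= e ^+ 2 * g by rewrite mulr_ge0 ?sqr_ge0.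
have R0 : 0 <= th * h + (e ^+ 2 * g) / th.
  by have th0' := ltW th0; apply: addr_ge0; [exact: mulr_ge0|exact: divr_ge0].
rewrite -(@ler_pXn2r _ 2) ?nnegrE // real_normK ?num_real //.
have H : e ^+ 2 * b ^+ 2 <= e ^+ 2 * (g * h) by apply: ler_wpM2l => //; exact: sqr_ge0.
have E : (th * h + (e ^+ 2 * g) / th) ^+ 2 =
  4 * (e ^+ 2 * (g * h)) + (th * h - (e ^+ 2 * g) / th) ^+ 2.
  by field; rewrite gt_eqF.
rewrite E; have := sqr_ge0 (th * h - (e ^+ 2 * g) / th); nra.
Qed.

(** The shape is dictated by the strong law: the sum of [h^(m+1) e^2 g] is of the size of the
    normaliser, so its coefficient must be arbitrarily small, while [(e^2 g)^(m+2)] becomes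
    negligible when [g] tends to 0 and may carry any constant. The induction multiplies by one more
    factor [h + 2 e b + e^2 g]. *)
Lemma power_remainder_bound m (eta : R) : 0 < eta -> exists2 K, 0 <= K &
  forall h g b e, 0 <= h -> 0 <= g -> b ^+ 2 <= g * h ->
  `|power_remainder m.+2 h g b e| <=
    eta * (h ^+ m.+1 * (e ^+ 2 * g)) + K * (e ^+ 2 * g) ^+ m.+2.
Proof.
elim: m eta => [|m IH] eta eta0.
  pose th := eta / 2; have th0 : 0 < th by rewrite divr_gt0.
  exists (1 + 2 / th); first by rewrite addr_ge0 // divr_ge0 // ltW.
  move=> h g b e h0 g0 bg; set y := e ^+ 2 * g.
  have y0 : 0 <= y by rewrite mulr_ge0 ?sqr_ge0.
  have B := cross_term_bound e th0 h0 g0 bg; rewrite -/y in B.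
  have -> : power_remainder 2 h g b e = y ^+ 2 + 2 * (2 * e * b) * y.
    by rewrite /power_remainder /y /= expr1 expr0; ring.
  apply: le_trans (ler_normD _ _) _; rewrite ger0_norm ?sqr_ge0 //.
  have -> : `|2 * (2 * e * b) * y| = 2 * `|2 * e * b| * y.
    by rewrite [LHS]normrM (ger0_norm y0) [X in X * y]normrM ger0_norm.
  rewrite expr1.
  have := ler_wpM2r y0 B.
  have -> : (th * h + y / th) * y = (eta / 2) * (h * y) + y ^+ 2 / th.
    by rewrite /th; field; rewrite gt_eqF.
  have -> : (1 + 2 / th) * y ^+ 2 = y ^+ 2 + 2 * (y ^+ 2 / th) by ring.
  lra.
pose p : R := m.+2%:R; pose c : R := p * (p - 1) / 2.
have p2 : 2 <= p by rewrite /p ler_nat.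
have c0 : 0 <= c by rewrite /c; nra.
(* The coefficient [eta] is spent in four quarters: the cross terms through [th], the induction
   hypothesis at [eta / 8], the terms in [H1 h y^2] with total coefficient [M], and the term in
   [h y^(m+2)]. *)
pose N := p + 4 * c; have N0 : 0 < N by rewrite /N; nra.
pose th := eta / (8 * N); have th0 : 0 < th by rewrite divr_gt0 // mulr_gt0.
have Nth : 2 * N * th = eta / 4 by rewrite /th; field; rewrite gt_eqF.
have e8 : 0 < eta / 8 by rewrite divr_gt0.
have [K1 K10 HK1] := IH (eta / 8) e8.
pose M := N + 2 * N / th + 2 * (eta / 8).
have M0 : 0 < M.
  rewrite /M; apply: addr_gt0; last by rewrite mulr_gt0.
  by apply: addr_gt0 => //; rewrite divr_gt0 // mulr_gt0.
have eM : 0 < eta / (4 * M) by rewrite divr_gt0 // mulr_gt0.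
have eK : 0 < eta / (4 * (2 * K1 + 1)).
  by rewrite divr_gt0 // mulr_gt0 // ltr_wpDl // mulr_ge0.
have [K2 K20 HK2] := @monomial_interpolation _ m.+1 0 eM.
have [K3 K30 HK3] := @monomial_interpolation _ 1 m eK.
exists (M * K2 + 2 * K1 * K3 + 2 * K1).
  by rewrite !addr_ge0 ?mulr_ge0 // ltW.
move=> h g b e h0 g0 bg.
have B := cross_term_bound e th0 h0 g0 bg.
have B1 := cross_term_bound e ltr01 h0 g0 bg.
have {}HK1 := HK1 h g b e h0 g0 bg.
set y := e ^+ 2 * g in B B1 HK1 *; set be := 2 * e * b in B B1.
have y0 : 0 <= y by rewrite mulr_ge0 ?sqr_ge0.
have be2 : be ^+ 2 <= 4 * (y * h).
  rewrite /be /y !exprMn.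
  have := ler_wpM2l (sqr_ge0 e) bg; lra.
have {}HK2 := HK2 h y h0 y0; have {}HK3 := HK3 h y h0 y0.
rewrite addn0 add1n expr1 in HK2 HK3.
pose H1 := h ^+ m; have H10 : 0 <= H1 by exact: exprn_ge0.
(* The expansion of exponent [p = m + 2] is multiplied by [h + be + y], with [c = binom(p, 2)]:
   besides the multiple of the old remainder, the new one collects the products that reach order 3
   in [e]. *)
have RE : power_remainder m.+3 h g b e =
  be * (p * (H1 * h) * y + c * H1 * be ^+ 2) + y * (p * (H1 * h) * be)
  + y * (p * (H1 * h) * y + c * H1 * be ^+ 2)
  + (h + be + y) * power_remainder m.+2 h g b e.
  rewrite /power_remainder /be /y /c /H1 /=.
  rewrite [(_ + _) ^+ m.+3]exprS [h ^+ m.+3]exprS ![h ^+ m.+2]exprS ![h ^+ m.+1]exprS.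
  rewrite -[m.+3%:R]natr1 -/p (_ : m.+1%:R = p - 1); last first.
    by rewrite /p -[m.+2%:R]natr1 addrK.
  by field.
rewrite RE {RE}; set w := `|be| in B B1; have w0 : 0 <= w by exact: normr_ge0.
rewrite mul1r divr1 in B1.
have wE : be ^+ 2 = w ^+ 2 by rewrite /w real_normK ?num_real.
have p0 : 0 <= p by lra.
have Hh0 : 0 <= H1 * h by exact: mulr_ge0.
have Hhy0 : 0 <= H1 * h * y by exact: mulr_ge0.
pose A2 := p * (H1 * h) * y + c * H1 * be ^+ 2.
have A20 : 0 <= A2.
  apply: addr_ge0; apply: mulr_ge0 => //; try exact: mulr_ge0.
  exact: sqr_ge0.
have A2N : A2 <= N * (H1 * h * y).
  have := ler_wpM2l (mulr_ge0 c0 H10) be2; rewrite /A2 /N; lra.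
rewrite -/A2.
have T1 : `|be * A2| <= N * (w * (H1 * h * y)).
  rewrite normrM (ger0_norm A20) -/w.
  have := ler_wpM2l w0 A2N; lra.
have T2 : `|y * (p * (H1 * h) * be)| <= N * (w * (H1 * h * y)).
  rewrite normrM (ger0_norm y0) normrM (ger0_norm (mulr_ge0 p0 Hh0)) -/w.
  have pN : p <= N by rewrite /N; lra.
  have := ler_wpM2r (mulr_ge0 w0 Hhy0) pN; lra.
pose Y2 := y ^+ m.+2; pose G := H1 * h * h * y; pose Q := H1 * h * y * y.
have T3 : `|y * A2| <= N * Q.
  rewrite (ger0_norm (mulr_ge0 y0 A20)) /Q.
  have := ler_wpM2l y0 A2N; lra.
have T4 : `|(h + be + y) * power_remainder m.+2 h g b e| <=
    (2 * h + 2 * y) * (eta / 8 * (H1 * h * y) + K1 * Y2).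
  rewrite normrM; apply: ler_pM => //.
    apply: le_trans (ler_normD _ _) _.
    have := ler_normD h be; rewrite (ger0_norm h0) (ger0_norm y0) -/w; lra.
  by move: HK1; rewrite exprS /H1 [h * _]mulrC mulrA.
have W : w * (H1 * h * y) <= th * G + Q / th.
  have := ler_wpM2r Hhy0 B.
  have -> : (th * h + y / th) * (H1 * h * y) =
    th * G + Q / th by rewrite /G /Q; field; rewrite gt_eqF.
  by [].
have hE : h ^+ m.+2 = H1 * h * h by rewrite !exprS /H1; ring.
have hE1 : h ^+ m.+1 = H1 * h by rewrite exprS mulrC.
rewrite hE1 hE in HK2 *; rewrite hE in HK3.
have yE : y ^+ m.+3 = y * Y2 by rewrite exprS.
rewrite yE in HK2 HK3 *; rewrite -/Y2 in HK3.
have {}HK2 : Q <= eta / (4 * M) * G + K2 * (y * Y2).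
  by have -> : Q = H1 * h * y ^+ 2 by rewrite /Q; ring.
have {}HK3 : h * Y2 <= eta / (4 * (2 * K1 + 1)) * G + K3 * (y * Y2).
  exact: HK3.
have G0 : 0 <= G by exact: (mulr_ge0 (mulr_ge0 Hh0 h0) y0).
have MQ : M * Q <= eta / 4 * G + M * K2 * (y * Y2).
  have := ler_wpM2l (ltW M0) HK2.
  have -> : M * (eta / (4 * M) * G + K2 * (y * Y2)) =
    eta / 4 * G + M * K2 * (y * Y2) by field; rewrite gt_eqF.
  by [].
have KY : 2 * K1 * (h * Y2) <= eta / 4 * G + 2 * K1 * K3 * (y * Y2).
  have K1p : 0 < 2 * K1 + 1 by rewrite ltr_wpDl // mulr_ge0.
  apply: (@le_trans _ _ (2 * K1 * (eta / (4 * (2 * K1 + 1)) * G + K3 * (y * Y2)))).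
    by apply: ler_wpM2l => //; rewrite mulr_ge0.
  have key : 2 * K1 * (eta / (4 * (2 * K1 + 1))) <= eta / 4.
    rewrite mulrA ler_pdivrMr ?mulr_gt0 //.
    have -> : eta / 4 * (4 * (2 * K1 + 1)) = 2 * K1 * eta + eta by field.
    by rewrite lerDl ltW.
  have := ler_wpM2r G0 key; lra.
have WN := ler_wpM2l (ltW N0) W.
have NW : 2 * (N * (th * G + Q / th)) = eta / 4 * G + 2 * N / th * Q.
  by rewrite -Nth; field; rewrite gt_eqF.
have E4 : (2 * h + 2 * y) * (eta / 8 * (H1 * h * y) + K1 * Y2) =
   eta / 4 * G + 2 * (eta / 8) * Q + 2 * K1 * (h * Y2) + 2 * K1 * (y * Y2).
  by rewrite /G /Q; field.
rewrite E4 in T4.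
have ME : M * Q = N * Q + 2 * N / th * Q + 2 * (eta / 8) * Q by rewrite /M; ring.
rewrite -[H1 * h * h * y]/G.
apply: le_trans (ler_normD _ _) _.
have := ler_normD (be * A2 + y * (p * (H1 * h) * be)) (y * A2).
have := ler_normD (be * A2) (y * (p * (H1 * h) * be)).
clear -T1 T2 T3 T4 WN NW MQ ME KY; lra.
Qed.

(** At [p = 1] the term [(g e^2)^p] would be as large as the clock; the factor [p.-1%:R] removes it,
    in accordance with a remainder that is then 0. *)
Lemma power_remainder_le p (eta : R) : (0 < p)%N -> 0 < eta -> exists2 K, 0 <= K &
  forall h g b e, 0 <= h -> 0 <= g -> b ^+ 2 <= g * h ->
  `|power_remainder p h g b e| <=
    eta * (h ^+ p.-1 * (g * e ^+ 2)) + K * (p.-1%:R * (g * e ^+ 2) ^+ p).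
Proof.
case: p => [//|[_|m _]] eta0.
  exists 0 => // h g b e h0 g0 _; rewrite power_remainder1 normr0 mul0r addr0.
  have ge0 : 0 <= g * e ^+ 2 by rewrite mulr_ge0 ?sqr_ge0.
  by apply: mulr_ge0; [exact: ltW|rewrite expr0 mul1r].
have [K K0 H] := power_remainder_bound m eta0.
exists K => // h g b e h0 g0 bg; apply: le_trans (H h g b e h0 g0 bg) _.
rewrite [e ^+ 2 * g]mulrC lerD2l; apply: ler_wpM2l => //.
have ge0 : 0 <= g * e ^+ 2 by rewrite mulr_ge0 ?sqr_ge0.
by apply: ler_peMl; [exact: exprn_ge0|rewrite ler1n].
Qed.

End binomial_remainder.

(** * Conditional inequalities and supermartingales *)

Lemma measurable_powR_realfun {d} {U : measurableType d} {R : realType}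
    (f : U -> R) q :
  measurable_fun setT f -> measurable_fun setT (fun w => f w `^ q).
Proof. by move=> mf; apply: (measurableT_comp (measurable_powR _)). Qed.

Lemma measurable_inv_realfun {d} {U : measurableType d} {R : realType}
    (f : U -> R) :
  measurable_fun setT f -> measurable_fun setT (fun w => (f w)^-1).
Proof.
move=> mf.
(* A real power of the nonnegative [f^2] is measurable; where [f] vanishes both sides of the
   identity are 0. *)
have -> : (fun w => (f w)^-1) = (fun w => f w * (f w ^+ 2) `^ (-1)).
  apply/funext => w; rewrite powR_inv1 ?sqr_ge0 //.
  by have [->|f0] := eqVneq (f w) 0; rewrite ?invr0 ?mul0r //; field.
apply: measurable_funM => //.
by apply: (measurableT_comp (measurable_powR _)); exact: measurable_funX.
Qed.

Section conditional_comparison.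
Context {disp : measure_display} {T : measurableType disp} {R : realType}.
Variable P : probability T R.
Variable G : set (set T).
Hypothesis Gsub : sub_sigma_algebra_of G.

(** This is [E[X | G] <= E[Y | G]] in integrated form. It is applied to nonnegative functions, whose
    integrals make sense in [0, +oo] without integrability; signed noise is therefore always written
    as a difference of two nonnegative functions. *)
Definition cond_le (X Y : T -> R) :=
  forall A, G A ->
    (\int[P]_(w in A) (X w)%:E <= \int[P]_(w in A) (Y w)%:E)%E.

Lemma sub_sigma_measurable A : G A -> measurable A.
Proof. by move=> GA; case: Gsub => _; exact. Qed.

Lemma measurable_sub_sigma A :
  measurable (A : set (g_sigma_algebraType G)) <-> G A.
Proof.
case: Gsub => sG _; split; last exact: sub_sigma_algebra.
by rewrite /measurable /= sigma_algebra_id.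
Qed.

Lemma measurable_wrt_measurable d' (U : measurableType d') (X : T -> U) :
  measurable_wrt G X -> measurable_fun setT X.
Proof.
move=> mX _ B mB; rewrite setTI; apply: sub_sigma_measurable.
by apply/measurable_sub_sigma; rewrite -[X in measurable X]setTI; exact: mX.
Qed.

Import HBNNSimple.

(** The weight is an increasing limit of simple functions measurable for [G]. Their level sets meet
    [A] in events of [G], on which the hypothesis applies, and monotone convergence needs no
    integrability of [X] or [Y]. *)
Lemma cond_leM (X Y k : T -> R) :
  measurable_fun setT X -> measurable_fun setT Y ->
  (forall w, 0 <= X w) -> (forall w, 0 <= Y w) ->
  measurable_wrt G k -> (forall w, 0 <= k w) ->
  cond_le X Y -> cond_le (fun w => k w * X w) (fun w => k w * Y w).
Proof.
move=> mX mY X0 Y0 mk k0 XY A GA.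
have mA := sub_sigma_measurable GA.
have mk' : measurable_fun [set: g_sigma_algebraType G] (EFin \o k).
  exact/measurable_EFinP.
pose h := nnsfun_approx (@measurableT _ (g_sigma_algebraType G)) mk'.
have mh n : measurable_fun [set: T] (h n).
  by apply: measurable_wrt_measurable; exact: measurable_funP.
have h0 n w : 0 <= h n w by exact: fun_ge0.
have kE w : (k w)%:E = (limn (fun n => (h n w)%:E)).
  apply/esym/cvg_lim => //.
  by apply: (@cvg_nnsfun_approx _ _ _ _ measurableT _ mk' (fun w _ => k0 w)).
have hnd w : {homo h ^~ w : n m / (n <= m)%N >-> n <= m}.
  by move=> n m nm; exact/lefP/nd_nnsfun_approx.
have hcvg w : (h n w)%:E @[n --> \oo] --> (k w)%:E.
  by apply: (@cvg_nnsfun_approx _ _ _ _ measurableT _ mk' (fun w _ => k0 w)).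
have lim_int (Z : T -> R) : measurable_fun setT Z -> (forall w, 0 <= Z w) ->
    (\int[P]_(w in A) (h n w * Z w)%:E)%E @[n --> \oo] -->
    (\int[P]_(w in A) (k w * Z w)%:E)%E.
  move=> mZ Z0.
  have -> : (\int[P]_(w in A) (k w * Z w)%:E)%E =
      (\int[P]_(w in A) limn (fun n => (h n w * Z w)%:E))%E.
    apply: eq_integral => w _; apply/esym/cvg_lim => //.
    under eq_fun do rewrite EFinM.
    by rewrite EFinM; apply: cvgeZr => //; exact: hcvg.
  apply: cvg_monotone_convergence => //.
  - move=> n; apply/measurable_EFinP; apply: measurable_funTS.
    exact: measurable_funM.
  - by move=> n w _; rewrite lee_fin mulr_ge0.
  - by move=> w _ n m nm; rewrite lee_fin ler_wpM2r // hnd.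
have int_sum (Z : T -> R) n : measurable_fun setT Z -> (forall w, 0 <= Z w) ->
    (\int[P]_(w in A) (h n w * Z w)%:E = \sum_(y \in range (h n))
       (y%:E * \int[P]_(w in A `&` (h n @^-1` [set y])) (Z w)%:E))%E.
  move=> mZ Z0.
  have mhy y : measurable (h n @^-1` [set y] : set T).
    by rewrite -[X in measurable X]setTI; apply: mh.
  have y0 y w : 0 <= y * \1_(h n @^-1` [set y]) w.
    have [/= hy|/= hy] := pselect ((h n @^-1` [set y]) w).
      by rewrite indicE mem_set // mulr1 -hy.
    by rewrite indicE memNset // mulr0.
  transitivity (\int[P]_(w in A) (\sum_(y \in range (h n))
     (y * \1_(h n @^-1` [set y]) w * Z w)%:E))%E.
    apply: eq_integral => w _; rewrite EFinM fimfunE -fsumEFin //.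
    rewrite ge0_mule_fsuml; last by move=> y; rewrite lee_fin.
    by apply: eq_fsbigr => y _; rewrite -EFinM.
  rewrite ge0_integral_fsum //; last 2 first.
  - move=> y; apply/measurable_EFinP; apply: measurable_funTS.
    by apply: measurable_funM => //; apply: measurable_funM.
  - by move=> y w _; rewrite lee_fin mulr_ge0.
  apply: eq_fsbigr => y; rewrite inE => -[w0 _ hy].
  rewrite integral_mkcondr -ge0_integralZl_EFin //; last 3 first.
  - by move=> w _; apply: erestrict_ge0 => w' _; rewrite lee_fin.
  - apply: measurable_funTS; apply/(measurable_restrictT _ _).1 => //.
    by apply: measurable_funTS; exact/measurable_EFinP.
  - by rewrite -hy.
  apply: eq_integral => w _; rewrite patchE indicE.
  by case: ifPn => _ /=; rewrite ?mulr1 -?EFinM // !(mulr0, mul0r).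
rewrite -(cvg_lim _ (lim_int X mX X0)) // -(cvg_lim _ (lim_int Y mY Y0)) //.
apply: lee_lim; [by apply: cvgP; exact: lim_int..|].
apply: nearW => n; rewrite !int_sum //.
apply: lee_fsum => [|y [w _ <-]]; first exact: fimfunP.
apply: lee_wpmul2l; first by rewrite lee_fin.
apply: XY; case: Gsub => sG _.
have mG : measurable ((A : set (g_sigma_algebraType G)) `&` (h n @^-1` [set h n w])).
  by apply: measurableI; [exact/measurable_sub_sigma|exact: measurable_sfunP].
exact/measurable_sub_sigma.
Qed.

Lemma cond_le_refl (X Y : T -> R) :
  measurable_fun setT X -> measurable_fun setT Y ->
  (forall w, 0 <= X w) -> (forall w, X w <= Y w) -> cond_le X Y.
Proof.
move=> mX mY X0 XY A GA; apply: ge0_le_integral => //.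
- exact: sub_sigma_measurable.
- by move=> w _; rewrite lee_fin.
- by apply/measurable_EFinP; exact: measurable_funTS.
- by apply/measurable_EFinP; exact: measurable_funTS.
- by move=> w _; rewrite lee_fin.
Qed.

Lemma cond_le_trans (X Y Z : T -> R) :
  cond_le X Y -> cond_le Y Z -> cond_le X Z.
Proof. by move=> XY YZ A GA; apply: le_trans (XY _ GA) (YZ _ GA). Qed.

Lemma ge0_integral_realD (A : set T) (X Y : T -> R) : measurable A ->
  measurable_fun setT X -> measurable_fun setT Y ->
  (forall w, 0 <= X w) -> (forall w, 0 <= Y w) ->
  (\int[P]_(w in A) (X w + Y w)%:E =
   \int[P]_(w in A) (X w)%:E + \int[P]_(w in A) (Y w)%:E)%E.
Proof.
move=> mA mX mY X0 Y0; under eq_integral do rewrite EFinD.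
apply: ge0_integralD => //.
- by move=> w _; rewrite lee_fin.
- by apply/measurable_EFinP; exact: measurable_funTS.
- by move=> w _; rewrite lee_fin.
- by apply/measurable_EFinP; exact: measurable_funTS.
Qed.

Lemma cond_leD (X1 X2 Y1 Y2 : T -> R) :
  measurable_fun setT X1 -> measurable_fun setT X2 ->
  measurable_fun setT Y1 -> measurable_fun setT Y2 ->
  (forall w, 0 <= X1 w) -> (forall w, 0 <= X2 w) ->
  (forall w, 0 <= Y1 w) -> (forall w, 0 <= Y2 w) ->
  cond_le X1 Y1 -> cond_le X2 Y2 ->
  cond_le (fun w => X1 w + X2 w) (fun w => Y1 w + Y2 w).
Proof.
move=> mX1 mX2 mY1 mY2 X10 X20 Y10 Y20 XY1 XY2 A GA.
have mA := sub_sigma_measurable GA.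
by rewrite !ge0_integral_realD //; apply: leeD; [exact: XY1|exact: XY2].
Qed.

(* The weight [k = (1 + b u)^-1] makes the common term [k b D2] integrable, so
   that it can be cancelled; it is removed afterwards by [cond_leM]. *)
Lemma cond_le_step (Y' Y D1 D2 E v u al b c : T -> R) :
  measurable_fun setT Y' -> measurable_wrt G Y ->
  measurable_fun setT D1 -> measurable_fun setT D2 ->
  measurable_fun setT E -> measurable_wrt G v -> measurable_wrt G u ->
  measurable_wrt G al -> measurable_wrt G b -> measurable_wrt G c ->
  (forall w, 0 <= Y' w) -> (forall w, 0 <= D1 w) -> (forall w, 0 <= D2 w) ->
  (forall w, 0 <= E w) -> (forall w, 0 <= v w) -> (forall w, 0 <= u w) ->
  (forall w, 0 <= al w) -> (forall w, 0 <= b w) -> (forall w, 0 <= c w) ->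
  cond_le D1 D2 -> cond_le D2 u -> cond_le E v ->
  (forall w, Y' w + b w * D2 w <= al w + b w * D1 w + c w * E w) ->
  (forall w, al w + c w * v w <= Y w) ->
  cond_le Y' Y.
Proof.
move=> mY' GY mD1 mD2 mE Gv Gu Gal Gb Gc Y'0 D10 D20 E0 v0 u0 al0 b0 c0.
move=> D12 D2u Ev step1 step2.
have Y0 w : 0 <= Y w by apply: le_trans (step2 w); rewrite addr_ge0 ?mulr_ge0.
pose m w := 1 + b w * u w.
have m1 w : 1 <= m w by rewrite lerDl mulr_ge0.
have m0 w : 0 < m w by apply: lt_le_trans (m1 w).
pose k w := (m w)^-1.
have k0 w : 0 <= k w by rewrite invr_ge0 ltW.
have Gm : measurable_wrt G m.
  by apply: measurable_funD; [exact: measurable_cst|exact: measurable_funM].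
have Gk : measurable_wrt G k by exact: measurable_inv_realfun.
have gm (f : T -> R) : measurable_wrt G f -> measurable_fun setT f.
  exact: measurable_wrt_measurable.
have Gkb : measurable_wrt G (fun w => k w * b w) by exact: measurable_funM.
have Gkc : measurable_wrt G (fun w => k w * c w) by exact: measurable_funM.
suff kY : cond_le (fun w => k w * Y' w) (fun w => k w * Y w).
  have mk (f : T -> R) : (fun w => m w * (k w * f w)) = f.
    by apply/funext => w; rewrite mulrA divff ?mul1r // gt_eqF.
  rewrite -(mk Y') -(mk Y); apply: cond_leM => //.
  - by apply: measurable_funM => //; exact: gm.
  - by apply: measurable_funM => //; exact: gm.
  - by move=> w; rewrite mulr_ge0.
  - by move=> w; rewrite mulr_ge0.
  - by move=> w; exact: ltW.
move=> A GA; have mA := sub_sigma_measurable GA.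
have mkb := gm _ Gkb; have mkc := gm _ Gkc; have mk := gm _ Gk.
have mkD2 : measurable_fun setT (fun w => k w * b w * D2 w).
  exact: measurable_funM.
have kb0 w : 0 <= k w * b w by rewrite mulr_ge0.
have kc0 w : 0 <= k w * c w by rewrite mulr_ge0.
have kD2fin : (\int[P]_(w in A) (k w * b w * D2 w)%:E < +oo)%E.
  apply: (@le_lt_trans _ _ (\int[P]_(w in A) (k w * b w * u w)%:E)%E).
    by apply: (cond_leM mD2 (gm _ Gu)).
  apply: (@le_lt_trans _ _ (\int[P]_(w in A) 1%:E)%E).
    apply: ge0_le_integral => //.
    - by move=> w _; rewrite lee_fin mulr_ge0.
    - apply/measurable_EFinP; apply: measurable_funTS.
      by apply: measurable_funM => //; exact: gm.
    - move=> w _; rewrite lee_fin -mulrA mulrC ler_pdivrMr // mul1r /m.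
      by rewrite lerDr.
  rewrite integral_cst // mul1e; apply: le_lt_trans (ltry 1).
  exact: probability_le1.
have kD2f : (\int[P]_(w in A) (k w * b w * D2 w)%:E)%E \is a fin_num.
  rewrite ge0_fin_numE //; apply: integral_ge0 => w _.
  by rewrite lee_fin mulr_ge0.
rewrite -(leeD2rE _ _ kD2f).
have mkY' : measurable_fun setT (fun w => k w * Y' w).
  exact: measurable_funM.
have mkY : measurable_fun setT (fun w => k w * Y w).
  by apply: measurable_funM => //; exact: gm.
have kY'0 w : 0 <= k w * Y' w by rewrite mulr_ge0.
have kY0 w : 0 <= k w * Y w by rewrite mulr_ge0.
have kD20 w : 0 <= k w * b w * D2 w by rewrite mulr_ge0.
rewrite -!ge0_integral_realD //.
pose X2 w := k w * al w + k w * c w * E w.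
pose X3 w := k w * al w + k w * c w * v w.
have mX2 : measurable_fun setT X2.
  by apply: measurable_funD; apply: measurable_funM => //; exact: gm.
have mX3 : measurable_fun setT X3.
  by apply: measurable_funD; apply: measurable_funM => //; exact: gm.
have X20 w : 0 <= X2 w by rewrite addr_ge0 // mulr_ge0.
have X30 w : 0 <= X3 w by rewrite addr_ge0 // mulr_ge0.
have mkD1 : measurable_fun setT (fun w => k w * b w * D1 w).
  exact: measurable_funM.
have mkal : measurable_fun setT (fun w => k w * al w).
  by apply: measurable_funM => //; exact: gm.
apply: (@cond_le_trans _ (fun w => X2 w + k w * b w * D1 w)) => //.
  apply: cond_le_refl => //.
  - by apply: measurable_funD => //; apply: measurable_funM.
  - by apply: measurable_funD.
  - by move=> w; rewrite addr_ge0 // mulr_ge0.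
  - move=> w; rewrite /X2 -!mulrA -!mulrDr ler_wpM2l //.
    by rewrite addrAC; exact: step1.
apply: (@cond_le_trans _ (fun w => X3 w + k w * b w * D2 w)).
  have kcE : measurable_fun setT (fun w => k w * c w * E w).
    exact: measurable_funM.
  have kcv : measurable_fun setT (fun w => k w * c w * v w).
    by apply: measurable_funM => //; exact: gm.
  have kal0 w : 0 <= k w * al w by rewrite mulr_ge0.
  have kcE0 w : 0 <= k w * c w * E w by rewrite mulr_ge0.
  have kcv0 w : 0 <= k w * c w * v w by rewrite mulr_ge0.
  have kbD10 w : 0 <= k w * b w * D1 w by rewrite mulr_ge0.
  apply: cond_leD => //; last by apply: cond_leM.
  apply: cond_leD => //.
  by apply: cond_leM => //; exact: gm.
apply: cond_le_refl => //.
- exact: measurable_funD.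
- exact: measurable_funD.
- by move=> w; rewrite addr_ge0.
- by move=> w; rewrite lerD2r /X3 -mulrA -mulrDr ler_wpM2l.
Qed.

End conditional_comparison.

(** * Doob's maximal inequality for nonnegative supermartingales *)

Section supermartingale.
Context {disp : measure_display} {T : measurableType disp} {R : realType}.
Variable P : probability T R.
Variable F : nat -> set (set T).
Hypothesis F_filt : filtration F.

Lemma filtration_sub n : sub_sigma_algebra_of (F n).
Proof. by case: F_filt. Qed.

Lemma measurable_wrt_le d' (U : measurableType d') (X : T -> U) m n :
  (m <= n)%N -> measurable_wrt (F m) X -> measurable_wrt (F n) X.
Proof.
move=> mn mX _ B mB; rewrite setTI.
apply/(measurable_sub_sigma (filtration_sub n)); case: F_filt => _ /(_ _ _ mn).
apply; apply/(measurable_sub_sigma (filtration_sub m)).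
by rewrite -[X in measurable X]setTI; exact: mX.
Qed.

Lemma measurable_wrt_T d' (U : measurableType d') (X : T -> U) n :
  measurable_wrt (F n) X -> measurable_fun setT X.
Proof. exact: (measurable_wrt_measurable (filtration_sub n)). Qed.

Lemma measurable_wrt_ge n (X : T -> R) l :
  measurable_wrt (F n) X -> F n [set w | l <= X w].
Proof.
move=> mX; apply/(measurable_sub_sigma (filtration_sub n)).
have := mX measurableT `[l, +oo[%classic (measurable_itv _).
rewrite setTI; congr measurable; apply/seteqP; split => w /=;
  by rewrite in_itv /= andbT.
Qed.

Variable Y : nat -> T -> R.
Hypothesis mY : forall n, measurable_wrt (F n) (Y n).
Hypothesis Y0 : forall n w, 0 <= Y n w.
Hypothesis Y01 : forall w, Y 0%N w <= 1.
Hypothesis superY : forall n, cond_le P (F n) (Y n.+1) (Y n).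

Let U l n := [set w | exists2 k, (k <= n)%N & l <= Y k w].

Let US l n : U l n.+1 = U l n `|` (~` U l n `&` [set w | l <= Y n.+1 w]).
Proof.
apply/seteqP; split => w /=.
  move=> Uw; have [Unw|Unw] := pselect (U l n w); [by left|right; split => //].
  case: Uw => k; rewrite leq_eqVlt => /orP[/eqP -> //|kn] lY.
  by case: Unw; exists k.
by move=> [[k kn lY]|[_ lY]]; [exists k => //; exact: leqW|exists n.+1].
Qed.

Let FU l n : F n (U l n).
Proof.
elim: n => [|n IH].
  rewrite (_ : U l 0 = [set w | l <= Y 0%N w]); first exact: measurable_wrt_ge.
  apply/seteqP; split => w /=; last by exists 0%N.
  by move=> [k]; rewrite leqn0 => /eqP ->.
have FUn : F n.+1 (U l n) by case: F_filt => _ /(_ n n.+1 (leqnSn n)); apply.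
rewrite US; apply/(measurable_sub_sigma (filtration_sub _)).
apply: measurableU; first exact/(measurable_sub_sigma (filtration_sub _)).
apply: measurableI.
  apply: measurableC; exact/(measurable_sub_sigma (filtration_sub _)).
apply/(measurable_sub_sigma (filtration_sub _)); exact: measurable_wrt_ge.
Qed.

Let mU l n : measurable (U l n).
Proof. exact: (sub_sigma_measurable (filtration_sub n) (FU l n)). Qed.

Let FUC l n : F n (~` U l n).
Proof.
apply/(measurable_sub_sigma (filtration_sub _)); apply: measurableC.
exact/(measurable_sub_sigma (filtration_sub _)).
Qed.

Let mYE n A : measurable_fun A (fun w => (Y n w)%:E).
Proof.
by apply/measurable_EFinP; apply: measurable_funTS; exact: measurable_wrt_T.
Qed.

(** The integral over the paths that have not crossed yet carries the induction. The supermartingale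
    inequality is applied on that event of the past; the part [A] that crosses at time [n.+1] has
    [Y n.+1 >= l] there and pays [l P(A)]. At time 0 nothing has crossed, as [Y 0 <= 1 < l]. *)
Lemma supermartingale_crossing l n : 1 < l ->
  (l%:E * P (U l n) + \int[P]_(w in ~` U l n) (Y n w)%:E <= 1)%E.
Proof.
move=> l1; have l0 : 0 <= l by rewrite ltW // (lt_trans _ l1).
elim: n => [|n IH].
  have -> : U l 0 = set0.
    apply/seteqP; split => // w [k]; rewrite leqn0 => /eqP -> lY.
    by have := le_lt_trans (le_trans lY (Y01 w)) l1; rewrite ltxx.
  rewrite measure0 mule0 add0e setC0.
  apply: (@le_trans _ _ (\int[P]_(w in setT) 1%:E)%E).
    by apply: ge0_le_integral => // w _; rewrite lee_fin.
  by rewrite integral_cst // mul1e probability_le1.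
set A := ~` U l n `&` [set w | l <= Y n.+1 w].
have mA : measurable A.
  apply: measurableI; first exact: measurableC.
  by apply: (sub_sigma_measurable (filtration_sub n.+1)); exact: measurable_wrt_ge.
have CU : ~` U l n = A `|` ~` U l n.+1.
  rewrite US setCU -/A /A setCI setCK.
  apply/seteqP; split => w /=; last by case=> [[]|[]].
  by move=> nU; have [lY|lY] := pselect (l <= Y n.+1 w); [left|right; split => //; right].
apply: le_trans IH; rewrite [X in P X]US measureU //; last first.
  by apply/seteqP; split => // w [Uw [nU _]]; exact: nU.
rewrite ge0_muleDr // -addeA leeD2l //.
apply: le_trans (superY (FUC l n)).
rewrite [X in (_ <= \int[_]_(w in X) _)%E]CU ge0_integral_setU //.
- rewrite leeD2r // -integral_cst //.
  by apply: ge0_le_integral => // w [_ lY]; rewrite lee_fin.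
- exact: measurableC.
- by move=> w _; rewrite lee_fin.
- apply/disj_setPS => w [Aw]; apply; rewrite US; right; exact: Aw.
Qed.

Lemma supermartingale_bounded :
  {ae P, forall w, exists K, forall n, Y n w <= K}.
Proof.
(* The levels start at 2 because the crossing inequality requires a level above 1. An unbounded path
   lies in every [V k], whose probability is at most [1 / (k + 2)]. *)
pose V k := \bigcup_n U (k.+2)%:R n.
have mV k : measurable (V k) by apply: bigcup_measurable => n _.
have PV k : ((k.+2)%:R%:E * P (V k) <= 1 :> \bar R)%E.
  have cU : P (U k.+2%:R n) @[n --> \oo] --> P (V k).
    apply: nondecreasing_cvg_mu; [by []|exact: mV|].
    by move=> m n mn; apply/subsetPset => w [j jm lY]; exists j => //; exact: leq_trans mn.
  apply: (cvge_le _ (cvgeZl (y := (k.+2)%:R%:E) isT cU)).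
  apply: nearW => n; apply: le_trans (supermartingale_crossing (l := k.+2%:R) n _).
    by rewrite leeDl // integral_ge0 // => w _; rewrite lee_fin.
  by rewrite ltr1n.
exists (\bigcap_k V k); split.
- exact: bigcap_measurable.
- apply/eqP; rewrite eq_le measure_ge0 andbT; apply/lee_addgt0Pr => e e0.
  rewrite add0e; pose k := Num.truncn e^-1.
  have ke : e^-1 < k.+2%:R.
    by apply: lt_le_trans (truncnS_gt _) _; rewrite ler_nat.
  apply: (@le_trans _ _ (P (V k))).
    by apply: le_measure; rewrite ?inE //; [exact: bigcap_measurable|move=> w; exact].
  have k0 : (0 < k.+2%:R :> R) by rewrite ltr0n.
  rewrite -(lee_pmul2l (x := k.+2%:R%:E)) //.
  apply: le_trans (PV k) _; rewrite -EFinM lee_fin.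
  by rewrite -ler_pdivrMr // mul1r ltW.
- move=> w /= nb k _; apply: contrapT => nV; apply: nb.
  exists k.+2%:R => n; rewrite leNgt; apply/negP => lY; apply: nV.
  by exists n => //; exists n => //; exact: ltW.
Qed.

End supermartingale.

(** * Sums of increments [D1 - D2] with nonpositive conditional mean *)

Section almost_supermartingale.
Context {disp : measure_display} {T : measurableType disp} {R : realType}.
Variable P : probability T R.
Variable F : nat -> set (set T).
Hypothesis F_filt : filtration F.
Variables (s : R) (D1 D2 E u v r : nat -> T -> R).
Hypothesis s12 : 1 < s <= 2.
Hypothesis mD1 : forall n, measurable_wrt (F n.+1) (D1 n).
Hypothesis mD2 : forall n, measurable_wrt (F n.+1) (D2 n).
Hypothesis mE : forall n, measurable_wrt (F n.+1) (E n).
Hypothesis mu : forall n, measurable_wrt (F n) (u n).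
Hypothesis mv : forall n, measurable_wrt (F n) (v n).
Hypothesis D10 : forall n w, 0 <= D1 n w.
Hypothesis D20 : forall n w, 0 <= D2 n w.
Hypothesis u0 : forall n w, 0 <= u n w.
Hypothesis v0 : forall n w, 0 <= v n w.
Hypothesis D12 : forall n, cond_le P (F n) (D1 n) (D2 n).
Hypothesis D2u : forall n, cond_le P (F n) (D2 n) (u n).
Hypothesis DE : forall n w, `|D1 n w - D2 n w| `^ s <= E n w.
Hypothesis Ev : forall n, cond_le P (F n) (E n) (v n).

Let E0 n w : 0 <= E n w.
Proof. exact: le_trans (powR_ge0 _ _) (DE n w). Qed.

Let N n w := \sum_(0 <= k < n) (D1 k w - D2 k w).

Let mN n : measurable_wrt (F n) (N n).
Proof.
rewrite /N; elim: n => [|n IH].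
  have -> : (fun w => \sum_(0 <= k < 0) (D1 k w - D2 k w)) = cst 0.
    by apply/funext => w; rewrite big_geq.
  exact: measurable_cst.
have -> : (fun w => \sum_(0 <= k < n.+1) (D1 k w - D2 k w)) =
  (fun w => \sum_(0 <= k < n) (D1 k w - D2 k w) + (D1 n w - D2 n w)).
  by apply/funext => w; rewrite big_nat_recr.
apply: measurable_funD; last by apply: measurable_funB; [exact: mD1|exact: mD2].
by apply: (measurable_wrt_le F_filt (leqnSn n)).
Qed.

Section fixed_normalisation.
Hypothesis r_pred : forall n, measurable_wrt (F n) (r n.+1).
Hypothesis r0_meas : measurable_wrt (F 0%N) (r 0%N).
Hypothesis r_pos : forall n w, 0 < r n w.
Hypothesis r_nd : forall n w, r n w <= r n.+1 w.

Let mr n : measurable_wrt (F n) (r n).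
Proof. by case: n => // n; apply: (measurable_wrt_le F_filt (leqnSn n)). Qed.

Let rho n w := r n w `^ s.
Let rho0 n w : 0 < rho n w. Proof. exact: powR_gt0. Qed.
Let wt n w := v n w / rho n.+1 w.
Let pr n w := \prod_(0 <= k < n) (1 + wt k w).
Let X n w := Num.max (N n w) 0.
Let Tn n w := X n w `^ s / rho n w.
Let Y n w := (1 + Tn n w) / pr n w.

Let s0 : 0 < s. Proof. by case/andP: s12 => s1 _; apply: lt_trans s1. Qed.

Let wt0 n w : 0 <= wt n w.
Proof. by apply: divr_ge0 => //; exact: ltW. Qed.

Let pr0 n w : 0 < pr n w.
Proof.
apply: prodr_gt0 => k _; apply: (@lt_le_trans _ _ 1) => //.
by rewrite lerDl.
Qed.

Let X0 n w : 0 <= X n w.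
Proof. by rewrite /X le_max lexx orbT. Qed.

Let Tn0 n w : 0 <= Tn n w.
Proof. by apply: divr_ge0; [exact: powR_ge0|exact: ltW]. Qed.

Let mrho n : measurable_wrt (F n) (rho n.+1).
Proof. by apply: measurable_powR_realfun; exact: (@r_pred n). Qed.

Let mirho n : measurable_wrt (F n) (fun w => (rho n.+1 w)^-1).
Proof. by apply: measurable_inv_realfun; exact: mrho. Qed.

Let mwt n : measurable_wrt (F n) (wt n).
Proof. by apply: measurable_funM; [exact: mv|exact: mirho]. Qed.

Let mprS n : measurable_wrt (F n) (pr n.+1).
Proof.
rewrite /pr; elim: n => [|n IH].
  have -> : (fun w => \prod_(0 <= k < 1) (1 + wt k w)) = (fun w => 1 + wt 0%N w).
    by apply/funext => w; rewrite big_nat1.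
  by apply: measurable_funD; [exact: measurable_cst|exact: mwt].
have -> : (fun w => \prod_(0 <= k < n.+2) (1 + wt k w)) =
   (fun w => \prod_(0 <= k < n.+1) (1 + wt k w) * (1 + wt n.+1 w)).
  by apply/funext => w; rewrite big_nat_recr.
apply: measurable_funM.
  exact: (measurable_wrt_le F_filt (leqnSn n)).
by apply: measurable_funD; [exact: measurable_cst|exact: mwt].
Qed.

Let mpr n : measurable_wrt (F n) (pr n).
Proof.
case: n => [|n]; last exact: (measurable_wrt_le F_filt (leqnSn n)).
rewrite /pr; have -> : (fun w => \prod_(0 <= k < 0) (1 + wt k w)) = cst 1.
  by apply/funext => w; rewrite big_geq.
exact: measurable_cst.
Qed.

Let mX n : measurable_wrt (F n) (X n).
Proof. by apply: measurable_maxr; [exact: mN|exact: measurable_cst]. Qed.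

Let mY n : measurable_wrt (F n) (Y n).
Proof.
apply: measurable_funM; last by apply: measurable_inv_realfun; exact: mpr.
apply: measurable_funD; first exact: measurable_cst.
apply: measurable_funM; first by apply: measurable_powR_realfun; exact: mX.
by apply: measurable_inv_realfun; apply: measurable_powR_realfun; exact: mr.
Qed.

Let Y0 n w : 0 <= Y n w.
Proof. by apply: divr_ge0; [rewrite addr_ge0|exact: ltW]. Qed.

(** The product [pr] absorbs what the conditional moment adds: [1 + T + wt <= (1 + T) (1 + wt)] for
    [T >= 0]. Passing from [rho n] to [rho n.+1] only lowers [T], and is allowed at time [n] because
    [r] is predictable. *)
Let superY n : cond_le P (F n) (Y n.+1) (Y n).
Proof.
have gm := measurable_wrt_T F_filt.
pose c w := (rho n.+1 w * pr n.+1 w)^-1.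
have c0 w : 0 <= c w by rewrite invr_ge0 mulr_ge0 // ltW.
have mc : measurable_wrt (F n) c.
  by apply: measurable_inv_realfun; apply: measurable_funM; [exact: mrho|exact: mprS].
(* With these weights [Y n.+1 <= al + b (D1 - D2) + c E]: [al] is the old sum under the new
   normaliser, [b] the linear coefficient of the expansion, [c] that of its remainder. *)
pose b w := s * X n w `^ (s - 1) * c w.
pose al w := (1 + X n w `^ s / rho n.+1 w) / pr n.+1 w.
apply: (@cond_le_step _ _ _ _ _ (filtration_sub F_filt n) (Y n.+1) (Y n)
  (D1 n) (D2 n) (E n) (v n) (u n) al b c) => //.
- exact: (gm _ _ _ _ (@mY n.+1)).
- exact: (gm _ _ _ _ (@mD1 n)).
- exact: (gm _ _ _ _ (@mD2 n)).
- exact: (gm _ _ _ _ (@mE n)).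
- apply: measurable_funM; last by apply: measurable_inv_realfun; exact: mprS.
  apply: measurable_funD; first exact: measurable_cst.
  by apply: measurable_funM; [apply: measurable_powR_realfun; exact: mX|exact: mirho].
- apply: measurable_funM; last exact: mc.
  by apply: measurable_funM; [exact: measurable_cst|apply: measurable_powR_realfun; exact: mX].
- move=> w; apply: divr_ge0; last exact: ltW.
  by rewrite addr_ge0 // divr_ge0 ?powR_ge0 // ltW.
- move=> w; rewrite /b; apply: mulr_ge0 => //; apply: mulr_ge0; first exact: ltW.
  exact: powR_ge0.
- move=> w; have H := powR_pos_part_expansion (N n w) (D1 n w - D2 n w) s12.
  have NS : N n.+1 w = N n w + (D1 n w - D2 n w) by rewrite /N big_nat_recr.
  have XS : X n.+1 w `^ s <= X n w `^ s + s * X n w `^ (s - 1) * (D1 n w - D2 n w) + E n w.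
    by rewrite {1}/X NS; apply: le_trans H _; rewrite lerD2l; exact: DE.
  have r1 := rho0 n.+1 w; have p1 := pr0 n.+1 w.
  rewrite /Y /Tn /b /al /c.
  have -> : (1 + X n.+1 w `^ s / rho n.+1 w) / pr n.+1 w =
      (X n.+1 w `^ s) / (rho n.+1 w * pr n.+1 w) + (pr n.+1 w)^-1.
    by field; rewrite !gt_eqF.
  have -> : (1 + X n w `^ s / rho n.+1 w) / pr n.+1 w =
      (X n w `^ s) / (rho n.+1 w * pr n.+1 w) + (pr n.+1 w)^-1.
    by field; rewrite !gt_eqF.
  have := ler_wpM2r (c0 w) XS; rewrite /c; lra.
- move=> w; rewrite /Y /Tn /al /c.
  have r1 := rho0 n.+1 w; have p1 := pr0 n.+1 w; have p2 := pr0 n w.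
  have prS : pr n.+1 w = pr n w * (1 + wt n w) by rewrite /pr big_nat_recr.
  have -> : (1 + X n w `^ s / rho n.+1 w) / pr n.+1 w
     + (rho n.+1 w * pr n.+1 w)^-1 * v n w =
     (1 + X n w `^ s / rho n.+1 w + wt n w) / pr n.+1 w.
    by rewrite /wt; field; rewrite !gt_eqF.
  rewrite ler_pdivrMr // prS mulrA divfK ?gt_eqF //.
  have rle : X n w `^ s / rho n.+1 w <= X n w `^ s / rho n w.
    rewrite ler_wpM2l ?powR_ge0 // lef_pV2 ?posrE //.
    apply: (ge0_ler_powR (ltW s0)); rewrite ?nnegrE //; exact: ltW.
  have w0 := wt0 n w; have t0 := Tn0 n w; rewrite /Tn in t0.
  have := mulr_ge0 t0 w0; nra.
Qed.

(** A bounded series of [wt] bounds the product [pr], by [1 + x <= expR x]; bounded values of [Y]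
    then bound the ratio of the positive part of the sum to [r]. *)
Lemma almost_supermartingale_bounded : {ae P, forall w,
  (exists K, forall n, \sum_(0 <= k < n) v k w / r k.+1 w `^ s <= K) ->
  exists K, forall n, \sum_(0 <= k < n) (D1 k w - D2 k w) <= K * r n w}.
Proof.
have Y01 w : Y 0%N w <= 1.
  rewrite /Y /Tn /X /N /pr !big_geq // divr1 maxxx powR0 ?gt_eqF //.
  by rewrite mul0r addr0.
apply: filterS (supermartingale_bounded F_filt mY Y0 Y01 superY).
move=> w [K YK] [K' vK'].
have prK n : pr n w <= expR K'.
  apply: (@le_trans _ _ (expR (\sum_(0 <= k < n) wt k w))).
    rewrite /pr; elim: n => [|n IH]; first by rewrite !big_geq // expR0.
    rewrite !big_nat_recr //= expRD; apply: ler_pM => //.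
    - exact: ltW (pr0 n w).
    - by rewrite addr_ge0.
    - exact: expR_ge1Dx.
  by rewrite ler_expR; exact: vK'.
(* Since [K1 >= 1], one has [K1 <= K1^s], so the bound on the power [s] of the ratio also bounds the
   ratio. *)
pose K1 := Num.max 1 (K * expR K'); exists K1 => n.
have K0 : 0 <= K by exact: le_trans (Y0 0%N w) (YK 0%N).
have TK : Tn n w <= K1.
  rewrite /K1 le_max; apply/orP; right.
  have := YK n; rewrite /Y ler_pdivrMr // => H.
  have : K * pr n w <= K * expR K' by exact: ler_wpM2l.
  lra.
apply: (@le_trans _ _ (X n w)); first by rewrite /X le_max lexx.
rewrite leNgt; apply/negP => Xgt.
have K11 : 1 <= K1 by rewrite /K1 le_max lexx.
have K1p : 0 < K1 by exact: lt_le_trans K11.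
have : (K1 * r n w) `^ s < X n w `^ s.
  apply: gt0_ltr_powR => //; rewrite ?nnegrE //.
  by rewrite mulr_ge0 // ltW.
have K1' := ltW K1p; have rn0 := ltW (r_pos n w); rewrite powRM //.
rewrite -(ltr_pdivlMr _ _ (rho0 n w)) => /lt_le_trans /(_ TK).
rewrite ltNge le1r_powR //.
by case/andP: s12 => /ltW.
Qed.

End fixed_normalisation.

End almost_supermartingale.

Section strong_law.
Context {disp : measure_display} {T : measurableType disp} {R : realType}.
Variable P : probability T R.
Variable F : nat -> set (set T).
Hypothesis F_filt : filtration F.
Variables (s eta : R) (D1 D2 E u v r : nat -> T -> R).
Hypothesis s12 : 1 < s <= 2.
Hypothesis eta_s : 0 <= eta < s - 1.
Hypothesis mD1 : forall n, measurable_wrt (F n.+1) (D1 n).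
Hypothesis mD2 : forall n, measurable_wrt (F n.+1) (D2 n).
Hypothesis mE : forall n, measurable_wrt (F n.+1) (E n).
Hypothesis mu : forall n, measurable_wrt (F n) (u n).
Hypothesis mv : forall n, measurable_wrt (F n) (v n).
Hypothesis D10 : forall n w, 0 <= D1 n w.
Hypothesis D20 : forall n w, 0 <= D2 n w.
Hypothesis u0 : forall n w, 0 <= u n w.
Hypothesis v0 : forall n w, 0 <= v n w.
Hypothesis D12 : forall n, cond_le P (F n) (D1 n) (D2 n).
Hypothesis D2u : forall n, cond_le P (F n) (D2 n) (u n).
Hypothesis DE : forall n w, `|D1 n w - D2 n w| `^ s <= E n w.
Hypothesis Ev : forall n, cond_le P (F n) (E n) (v n).
Hypothesis r_pred : forall n, measurable_wrt (F n) (r n.+1).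
Hypothesis r0_meas : measurable_wrt (F 0%N) (r 0%N).
Hypothesis r_ge1 : forall n w, 1 <= r n w.
Hypothesis r_nd : forall n w, r n w <= r n.+1 w.

(* Normalising by [r ^ th] with [(1 + eta) / s < th < 1] makes the variance
   series summable, so that the sums are even [O(r ^ th)]. *)
Lemma one_sided_strong_law : {ae P, forall w,
  (exists K, forall n, v n w <= K * r n.+1 w `^ eta * (r n.+1 w - r n w)) ->
  r n w @[n --> \oo] --> +oo ->
  forall e, 0 < e -> \forall n \near \oo,
    \sum_(0 <= k < n) (D1 k w - D2 k w) <= e * r n w}.
Proof.
have /andP[s1 s2] := s12; have /andP[eta0 etas] := eta_s.
have s0 : 0 < s by lra.
have r0 n w : 0 < r n w by exact: lt_le_trans (r_ge1 n w).
pose th := (1 + eta + s) / (2 * s).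
have ths : th * s = (1 + eta + s) / 2 by rewrite /th; field; rewrite gt_eqF.
have th0 : 0 < th by rewrite divr_gt0 //; lra.
have th1 : th < 1 by rewrite ltr_pdivrMr ?mulr_gt0 //; lra.
have rp n : measurable_wrt (F n) (fun w => r n.+1 w `^ th).
  by apply: measurable_powR_realfun; exact: r_pred.
have rp0 : measurable_wrt (F 0%N) (fun w => r 0%N w `^ th).
  by apply: measurable_powR_realfun; exact: r0_meas.
have rpos n w : 0 < r n w `^ th by exact: powR_gt0.
have rpnd n w : r n w `^ th <= r n.+1 w `^ th.
  by apply: (ge0_ler_powR (ltW th0)); rewrite ?nnegrE //; exact: ltW.
apply: filterS (@almost_supermartingale_bounded _ _ _ P F F_filt s D1 D2 E u v
  (fun n w => r n w `^ th) s12 mD1 mD2 mE mu mv D10 D20 u0 v0 D12 D2u DE Ev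
  rp rp0 rpos rpnd).
move=> w H [K vK] roo e e0.
(* The surplus exponent: after division by [r^(th s)] the hypothesis on [v] becomes a multiple of
   [(r k.+1 - r k) / r k.+1^(1 + g)], a series bounded by [1 / g]. *)
pose g := th * s - 1 - eta; have g0 : 0 < g by rewrite /g ths; lra.
have K0 : 0 <= Num.max K 0 by rewrite le_max lexx orbT.
have [|K' HK'] := H.
  exists (Num.max K 0 * g^-1) => n.
  apply: (@le_trans _ _ (\sum_(0 <= k < n)
      Num.max K 0 * ((r k.+1 w - r k w) / r k.+1 w `^ (1 + g)))).
    apply: ler_sum => k _; rewrite -powRrM.
    have rk := r0 k.+1 w.
    have E1 : r k.+1 w `^ (th * s) = r k.+1 w `^ (1 + g) * r k.+1 w `^ eta.
      rewrite -powRD; last by rewrite (gt_eqF rk) implybT.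
      by congr (_ `^ _); rewrite /g; ring.
    have p1 : 0 < r k.+1 w `^ (1 + g) by exact: powR_gt0.
    have p2 : 0 < r k.+1 w `^ eta by exact: powR_gt0.
    rewrite E1 ler_pdivrMr ?mulr_gt0 //.
    have -> : Num.max K 0 * ((r k.+1 w - r k w) / r k.+1 w `^ (1 + g)) *
        (r k.+1 w `^ (1 + g) * r k.+1 w `^ eta) =
      Num.max K 0 * r k.+1 w `^ eta * (r k.+1 w - r k w).
      by field; rewrite gt_eqF.
    apply: le_trans (vK k) _; apply: ler_wpM2r; first by rewrite subr_ge0.
    by apply: ler_wpM2r; [exact: ltW|rewrite le_max lexx].
  rewrite -mulr_sumr; apply: ler_wpM2l => //.
  by apply: (@telescope_series_bounded _ g (fun n => r n w)).
pose K1 := Num.max K' 1.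
have K11 : 1 <= K1 by rewrite /K1 le_max lexx orbT.
have K1p : 0 < K1 by exact: lt_le_trans K11.
have q0 : 0 < 1 - th by lra.
near=> n.
have rn := r0 n w.
apply: le_trans (HK' n) _.
apply: (@le_trans _ _ (K1 * r n w `^ th)).
  by apply: ler_wpM2r; [exact: powR_ge0|rewrite /K1 le_max lexx].
have {2}-> : r n w = r n w `^ (1 - th) * r n w `^ th.
  rewrite -powRD; last by rewrite (gt_eqF rn) implybT.
  by rewrite subrK powRr1 // ltW.
rewrite mulrA; apply: ler_wpM2r; first exact: powR_ge0.
rewrite -ler_pdivrMl // mulrC.
have A0 : 0 <= K1 / e by rewrite divr_ge0 // ltW.
have A1 : (K1 / e) = ((K1 / e) `^ ((1 - th)^-1)) `^ (1 - th).
  by rewrite -powRrM mulVf ?gt_eqF // powRr1.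
rewrite A1; apply: (ge0_ler_powR (ltW q0)); rewrite ?nnegrE ?powR_ge0 //.
  exact: ltW.
by near: n; move/cvgryPge : roo; exact.
Unshelve. all: by end_near. Qed.

End strong_law.

(** * Strong laws for the noise *)

Section noise.
Context {disp : measure_display} {T : measurableType disp} {R : realType}.
Variable P : probability T R.
Variable F : nat -> set (set T).
Hypothesis F_filt : filtration F.
Variables (eps : nat -> T -> R) (sigma a : R) (C : nat -> T -> \bar R).
Hypothesis eps_md : martingale_difference P F eps.
Hypothesis eps_var : forall n, is_cond_expectation P (F n)
  (fun w => (eps n.+1 w ^+ 2)%:E) (cst (sigma ^+ 2)%:E).
Hypothesis C_cond : forall n, is_cond_expectation P (F n)
  (fun w => (`|eps n.+1 w| `^ a)%:E) (C n).
Hypothesis C_bounded : {ae P, forall w,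
  (ereal_sup (range (fun n => C n w)) < +oo)%E}.

(** The version [C n] has extended real values and is nonnegative and finite only almost surely; the
    comparison lemmas need a real, nonnegative function at every point. *)
Definition cond_moment n w := fine (maxe (C n w) 0%E).

Lemma cond_moment_ge0 n w : 0 <= cond_moment n w.
Proof. by rewrite fine_ge0 // le_max lexx orbT. Qed.

Lemma measurable_cond_moment n : measurable_wrt (F n) (cond_moment n).
Proof.
apply: (measurableT_comp (fine_measurable measurableT)).
apply: measurable_maxe; last exact: measurable_cst.
by case: (C_cond n).
Qed.

Lemma cond_moment_bounded :
  {ae P, forall w, exists K, forall n, cond_moment n w <= K}.
Proof.
apply: filterS C_bounded => w supC.
exists (fine (maxe (ereal_sup (range (fun n => C n w))) 0%E)) => n.
have Cle : (C n w <= ereal_sup (range (fun n => C n w)))%E.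
  by apply: ereal_sup_ubound; exists n.
rewrite /cond_moment fine_le //.
- rewrite ge0_fin_numE ?le_max ?lexx ?orbT // gt_max ltry andbT.
  exact: le_lt_trans supC.
- by rewrite ge0_fin_numE ?le_max ?lexx ?orbT // gt_max ltry andbT.
- by rewrite ge_max !le_max Cle lexx orbT.
Qed.

Lemma measurable_eps n : measurable_wrt (F n.+1) (eps n.+1).
Proof. by case: (eps_md n). Qed.

Let meps n : measurable_fun setT (eps n.+1).
Proof. exact: (measurable_wrt_T F_filt (@measurable_eps n)). Qed.

(** Passing from [C n] to its positive part can only increase the integral, and this positive part
    agrees with [cond_moment] wherever the supremum of [C] is finite. *)
Lemma cond_le_moment n :
  cond_le P (F n) (fun w => `|eps n.+1 w| `^ a) (cond_moment n).
Proof.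
move=> A GA; have mA := sub_sigma_measurable (filtration_sub F_filt n) GA.
have [GC CE] := C_cond n; rewrite -(CE A GA).
have mC := measurable_wrt_T F_filt GC.
apply: (@le_trans _ _ (\int[P]_(w in A) (C n)^\+ w)%E).
  rewrite integralE; apply: geeDl; rewrite oppe_le0.
  by apply: integral_ge0 => w _; exact: funeneg_ge0.
rewrite le_eqVlt; apply/orP; left; apply/eqP.
apply: ge0_ae_eq_integral => //.
- by apply: measurable_funTS; exact: measurable_funepos.
- apply/measurable_EFinP; apply: measurable_funTS.
  exact: (measurable_wrt_T F_filt (@measurable_cond_moment n)).
- by move=> w _; rewrite lee_fin cond_moment_ge0.
apply: filterS C_bounded => w supC _.
rewrite /cond_moment funeposE fineK // ge0_fin_numE ?le_max ?lexx ?orbT //.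
rewrite gt_max ltry andbT; apply: le_lt_trans supC.
by apply: ereal_sup_ubound; exists n.
Qed.

Let epos n w := Num.max (eps n.+1 w) 0.
Let eneg n w := Num.max (- eps n.+1 w) 0.

Let epos_eneg n w : eps n.+1 w = epos n w - eneg n w.
Proof.
by rewrite /epos /eneg; case: (leP (eps n.+1 w) 0) => h; case: (leP (- eps n.+1 w) 0) => h'; lra.
Qed.

(** Integrability makes the integrals of both parts of the noise finite, so a zero integral of the
    noise over an event of the past says that they are equal. *)
Lemma cond_eps n : cond_le P (F n) (epos n) (eneg n) /\
  cond_le P (F n) (eneg n) (epos n).
Proof.
have [_ ieps [_ eps0]] := eps_md n.
have E A : F n A ->
    (\int[P]_(w in A) (epos n w)%:E = \int[P]_(w in A) (eneg n w)%:E)%E.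
  move=> GA; have mA := sub_sigma_measurable (filtration_sub F_filt n) GA.
  have iA : P.-integrable A (EFin \o eps n.+1).
    exact: (integrableS measurableT).
  have := eps0 A GA; rewrite integral0 integralE.
  have fn := integral_funeneg_lt_pinfty mA iA.
  have fp := integral_funepos_lt_pinfty mA iA.
  have Ep : (\int[P]_(w in A) (EFin \o eps n.+1)^\+ w = \int[P]_(w in A) (epos n w)%:E)%E.
    by apply: eq_integral => w _; rewrite funeposE /epos EFin_max.
  have En : (\int[P]_(w in A) (EFin \o eps n.+1)^\- w = \int[P]_(w in A) (eneg n w)%:E)%E.
    by apply: eq_integral => w _; rewrite funenegE /eneg EFin_max.
  rewrite Ep in fp; rewrite En in fn; rewrite Ep En.
  have int_ge0 (f : T -> R) : (forall w, 0 <= f w) ->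
      (0 <= \int[P]_(w in A) (f w)%:E)%E.
    by move=> f0; apply: integral_ge0 => w _; rewrite lee_fin.
  have fpos : (\int[P]_(w in A) (epos n w)%:E)%E \is a fin_num.
    by rewrite ge0_fin_numE // int_ge0 // => w; rewrite le_max lexx orbT.
  have fneg : (\int[P]_(w in A) (eneg n w)%:E)%E \is a fin_num.
    by rewrite ge0_fin_numE // int_ge0 // => w; rewrite le_max lexx orbT.
  rewrite -(fineK fpos) -(fineK fneg) -EFinB => -[D0].
  by congr EFin; lra.
by split => A GA; rewrite E.
Qed.

Lemma cond_eps2 n :
  cond_le P (F n) (fun w => eps n.+1 w ^+ 2) (cst (sigma ^+ 2)) /\
  cond_le P (F n) (cst (sigma ^+ 2)) (fun w => eps n.+1 w ^+ 2).
Proof. by have [_ E] := eps_var n; split => A GA; rewrite E. Qed.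

Section laws.
Variable r : nat -> T -> R.
Hypothesis r_pred : forall n, measurable_wrt (F n) (r n.+1).
Hypothesis r0_meas : measurable_wrt (F 0%N) (r 0%N).
Hypothesis r_ge1 : forall n w, 1 <= r n w.
Hypothesis r_nd : forall n w, r n w <= r n.+1 w.

Let sub n := filtration_sub F_filt n.
Let up n (X : T -> R) (mX : measurable_wrt (F n) X) : measurable_wrt (F n.+1) X :=
  measurable_wrt_le F_filt (leqnSn n) mX.
Let top n (X : T -> R) (mX : measurable_wrt (F n) X) : measurable_fun setT X :=
  measurable_wrt_T F_filt mX.

Let eps2_0 n w : 0 <= eps n.+1 w ^+ 2. Proof. exact: sqr_ge0. Qed.

Let meps2 n : measurable_fun setT (fun w => eps n.+1 w ^+ 2).
Proof. exact: measurable_funX. Qed.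

Let m1eps2 n : measurable_fun setT (fun w => 1 + eps n.+1 w ^+ 2).
Proof. by apply: measurable_funD; [exact: measurable_cst|exact: meps2]. Qed.

Let cond_1eps2 n : cond_le P (F n) (fun w => 1 + eps n.+1 w ^+ 2)
  (fun w => 1 + sigma ^+ 2).
Proof.
have s2 : 0 <= sigma ^+ 2 by exact: sqr_ge0.
have [H _] := cond_eps2 n.
apply: (cond_leD (sub n) (X1 := cst 1) (Y1 := cst 1) (Y2 := cst (sigma ^+ 2))) => //.
Qed.

(** Both [q] and the noise are signed, whence the four products distributed over [D1] and [D2]. The
    order is [s = 2], with conditional second moment [sigma^2 q^2]; the dominating [u] comes from
    [eps_+, eps_- <= 1 + eps^2]. *)
Lemma strong_law_eps_one_sided (q : nat -> T -> R) (eta : R) :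
  (forall n, measurable_wrt (F n) (q n)) -> 0 <= eta < 1 ->
  {ae P, forall w,
    (exists K, forall n,
      q n w ^+ 2 <= K * r n.+1 w `^ eta * (r n.+1 w - r n w)) ->
    r n w @[n --> \oo] --> +oo ->
    forall e, 0 < e -> \forall n \near \oo,
      \sum_(0 <= k < n) q k w * eps k.+1 w <= e * r n w}.
Proof.
move=> mq eta1.
have s2 : 0 <= sigma ^+ 2 by exact: sqr_ge0.
pose qp n w := Num.max (q n w) 0; pose qn n w := Num.max (- q n w) 0.
have mqp n : measurable_wrt (F n) (qp n).
  by apply: measurable_maxr; [exact: mq|exact: measurable_cst].
have mqn n : measurable_wrt (F n) (qn n).
  apply: measurable_maxr; last exact: measurable_cst.
  by apply: measurable_funN; exact: mq.
have qp0 n w : 0 <= qp n w by rewrite le_max lexx orbT.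
have qn0 n w : 0 <= qn n w by rewrite le_max lexx orbT.
have ep0 n w : 0 <= epos n w by rewrite le_max lexx orbT.
have en0 n w : 0 <= eneg n w by rewrite le_max lexx orbT.
have mep n : measurable_wrt (F n.+1) (epos n).
  by apply: measurable_maxr; [exact: measurable_eps|exact: measurable_cst].
have men n : measurable_wrt (F n.+1) (eneg n).
  apply: measurable_maxr; last exact: measurable_cst.
  by apply: measurable_funN; exact: measurable_eps.
have qE n w : q n w = qp n w - qn n w.
  by rewrite /qp /qn; case: (leP (q n w) 0) => h; case: (leP (- q n w) 0) => h'; lra.
have epos_le n w : epos n w <= 1 + eps n.+1 w ^+ 2.
  rewrite /epos ge_max; apply/andP; split; nra.
have eneg_le n w : eneg n w <= 1 + eps n.+1 w ^+ 2.
  rewrite /eneg ge_max; apply/andP; split; nra.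
pose D1 n w := qp n w * epos n w + qn n w * eneg n w.
pose D2 n w := qp n w * eneg n w + qn n w * epos n w.
pose E n w := q n w ^+ 2 * eps n.+1 w ^+ 2.
pose u n w := (qp n w + qn n w) * (1 + sigma ^+ 2).
pose v n w := q n w ^+ 2 * sigma ^+ 2.
have DqE n w : D1 n w - D2 n w = q n w * eps n.+1 w.
  by rewrite /D1 /D2 qE (epos_eneg n w); ring.
have mD (f g : nat -> T -> R) n : measurable_wrt (F n) (f n) ->
    measurable_wrt (F n.+1) (g n) -> measurable_wrt (F n.+1) (fun w => f n w * g n w).
  by move=> mf mg; apply: measurable_funM; [exact: (up mf)|exact: mg].
have mq2 n : measurable_wrt (F n) (fun w => q n w ^+ 2).
  by apply: measurable_funX; exact: mq.
have mD1 n : measurable_wrt (F n.+1) (D1 n).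
  by apply: measurable_funD; [exact: (mD qp epos n (mqp n))|exact: (mD qn eneg n (mqn n))].
have mD2 n : measurable_wrt (F n.+1) (D2 n).
  by apply: measurable_funD; [exact: (mD qp eneg n (mqp n))|exact: (mD qn epos n (mqn n))].
have mE n : measurable_wrt (F n.+1) (E n).
  apply: measurable_funM; first exact: (up (mq2 n)).
  by apply: measurable_funX; exact: measurable_eps.
have mu n : measurable_wrt (F n) (u n).
  apply: measurable_funM; last exact: measurable_cst.
  by apply: measurable_funD; [exact: mqp|exact: mqn].
have mv n : measurable_wrt (F n) (v n).
  by apply: measurable_funM; [exact: mq2|exact: measurable_cst].
have tp n := top (mep n); have tn n := top (men n).
have D10 n w : 0 <= D1 n w by rewrite addr_ge0 // mulr_ge0.
have D20 n w : 0 <= D2 n w by rewrite addr_ge0 // mulr_ge0.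
have u0 n w : 0 <= u n w by rewrite mulr_ge0 // addr_ge0.
have v0 n w : 0 <= v n w by rewrite mulr_ge0 // sqr_ge0.
have D12 n : cond_le P (F n) (D1 n) (D2 n).
  have [H1 H2] := cond_eps n.
  apply: (cond_leD (sub n)).
  - by apply: measurable_funM; [exact: (top (mqp n))|].
  - by apply: measurable_funM; [exact: (top (mqn n))|].
  - by apply: measurable_funM; [exact: (top (mqp n))|].
  - by apply: measurable_funM; [exact: (top (mqn n))|].
  - by move=> w; rewrite mulr_ge0.
  - by move=> w; rewrite mulr_ge0.
  - by move=> w; rewrite mulr_ge0.
  - by move=> w; rewrite mulr_ge0.
  - by apply: (cond_leM (sub n)) => //; exact: mqp.
  - by apply: (cond_leM (sub n)) => //; exact: mqn.
have D2u n : cond_le P (F n) (D2 n) (u n).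
  have mqq : measurable_wrt (F n) (fun w => qp n w + qn n w).
    by apply: measurable_funD; [exact: mqp|exact: mqn].
  apply: (cond_le_trans (Y := fun w => (qp n w + qn n w) * (1 + eps n.+1 w ^+ 2))).
    apply: (cond_le_refl _ (sub n)) => //.
    - exact: (top (mD2 n)).
    - apply: measurable_funM; first exact: (top mqq).
      exact: m1eps2.
    - by move=> w; rewrite mulrDl; apply: lerD; apply: ler_wpM2l.
  apply: (cond_leM (sub n)) => //.
  - by move=> w; rewrite addr_ge0.
  - by move=> w; rewrite addr_ge0.
  - by move=> w; rewrite addr_ge0.
have DE n w : `|D1 n w - D2 n w| `^ 2 <= E n w.
  by rewrite DqE powR_mulrn // real_normK ?num_real // exprMn.
have Ev n : cond_le P (F n) (E n) (v n).
  have [H _] := cond_eps2 n.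
  apply: (cond_leM (sub n)) => // w; exact: sqr_ge0.
have s12 : 1 < (2 : R) <= 2 by rewrite lexx andbT; lra.
have es : 0 <= eta < (2 : R) - 1.
  by case/andP: eta1 => e0 e1; rewrite e0 /=; lra.
apply: filterS (one_sided_strong_law F_filt s12 es mD1 mD2 mE mu mv
  D10 D20 u0 v0 D12 D2u DE Ev r_pred r0_meas r_ge1 r_nd).
move=> w H [K qK] roo e e0; near=> n.
under eq_bigr do rewrite -DqE.
near: n; apply: H => //; exists (K * sigma ^+ 2) => n.
by rewrite /v; have := ler_wpM2r s2 (qK n); lra.
Unshelve. all: by end_near. Qed.

Lemma strong_law_eps (q : nat -> T -> R) (eta : R) :
  (forall n, measurable_wrt (F n) (q n)) -> 0 <= eta < 1 ->
  {ae P, forall w,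
    (exists K, forall n,
      q n w ^+ 2 <= K * r n.+1 w `^ eta * (r n.+1 w - r n w)) ->
    r n w @[n --> \oo] --> +oo ->
    forall e, 0 < e -> \forall n \near \oo,
      `|\sum_(0 <= k < n) q k w * eps k.+1 w| <= e * r n w}.
Proof.
move=> mq eta1; have mqN n : measurable_wrt (F n) (fun w => - q n w).
  by apply: measurable_funN; exact: mq.
have HN := strong_law_eps_one_sided mqN eta1.
apply: filterS2 (strong_law_eps_one_sided mq eta1) HN.
move=> w H1 H2 qK roo e e0; near=> n; rewrite ler_norml; apply/andP; split.
- rewrite lerNl -sumrN; under eq_bigr do rewrite -mulNr.
  near: n; apply: H2 => //; case: qK => K qK; exists K => n.
  by rewrite sqrrN.
- by near: n; exact: H1.
Unshelve. all: by end_near. Qed.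

Let mnepsa n : measurable_wrt (F n.+1) (fun w => `|eps n.+1 w| `^ a).
Proof.
apply: measurable_powR_realfun; apply: measurableT_comp => //.
exact: measurable_eps.
Qed.

Section weighted_law.
Variables (s eta : R) (q X1 X2 u k : nat -> T -> R).
Hypothesis s12 : 1 < s <= 2.
Hypothesis eta_s : 0 <= eta < s - 1.
Hypothesis mq : forall n, measurable_wrt (F n) (q n).
Hypothesis q0 : forall n w, 0 <= q n w.
Hypothesis mX1 : forall n, measurable_wrt (F n.+1) (X1 n).
Hypothesis mX2 : forall n, measurable_wrt (F n.+1) (X2 n).
Hypothesis mu : forall n, measurable_wrt (F n) (u n).
Hypothesis mk : forall n, measurable_wrt (F n) (k n).
Hypothesis X10 : forall n w, 0 <= X1 n w.
Hypothesis X20 : forall n w, 0 <= X2 n w.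
Hypothesis u0 : forall n w, 0 <= u n w.
Hypothesis k0 : forall n w, 0 <= k n w.
Hypothesis X12 : forall n, cond_le P (F n) (X1 n) (X2 n).
Hypothesis X2u : forall n, cond_le P (F n) (X2 n) (u n).
Hypothesis X12s : forall n w,
  `|X1 n w - X2 n w| `^ s <= (1 + k n w) + `|eps n.+1 w| `^ a.

(** Common form of the laws for even powers of the noise: [X1 - X2] will be [eps^2 - sigma^2], its
    opposite, or an even power minus a bound of its conditional mean. Its conditional moment of
    order [s] is at most [1 + k + cond_moment], bounded along almost every path, so only [q^s] has
    to be compared with the clock. *)
Lemma weighted_strong_law : {ae P, forall w,
  (exists K, forall n, k n w <= K) ->
  (exists K, forall n,
    q n w `^ s <= K * r n.+1 w `^ eta * (r n.+1 w - r n w)) ->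
  r n w @[n --> \oo] --> +oo ->
  forall e, 0 < e -> \forall n \near \oo,
    \sum_(0 <= k < n) q k w * (X1 k w - X2 k w) <= e * r n w}.
Proof.
have /andP[s1 s2] := s12; have s0 : 0 < s by lra.
have mqs n : measurable_wrt (F n) (fun w => q n w `^ s).
  by apply: measurable_powR_realfun; exact: mq.
have m1k n : measurable_wrt (F n) (fun w => 1 + k n w).
  by apply: measurable_funD; [exact: measurable_cst|exact: mk].
have m1ka n : measurable_wrt (F n.+1) (fun w => (1 + k n w) + `|eps n.+1 w| `^ a).
  by apply: measurable_funD; [exact: (up (m1k n))|exact: mnepsa].
have m1kc n : measurable_wrt (F n) (fun w => (1 + k n w) + cond_moment n w).
  by apply: measurable_funD; [exact: m1k|exact: measurable_cond_moment].
have k10 n w : 0 <= 1 + k n w by rewrite addr_ge0.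
have ka0 n w : 0 <= (1 + k n w) + `|eps n.+1 w| `^ a by rewrite addr_ge0 // powR_ge0.
have kc0 n w : 0 <= (1 + k n w) + cond_moment n w.
  by rewrite addr_ge0 // cond_moment_ge0.
pose D1 n w := q n w * X1 n w; pose D2 n w := q n w * X2 n w.
pose E n w := q n w `^ s * ((1 + k n w) + `|eps n.+1 w| `^ a).
pose u' n w := q n w * u n w.
pose v n w := q n w `^ s * ((1 + k n w) + cond_moment n w).
have mD1 n : measurable_wrt (F n.+1) (D1 n).
  by apply: measurable_funM; [exact: (up (@mq n))|exact: mX1].
have mD2 n : measurable_wrt (F n.+1) (D2 n).
  by apply: measurable_funM; [exact: (up (@mq n))|exact: mX2].
have mE n : measurable_wrt (F n.+1) (E n).
  by apply: measurable_funM; [exact: (up (mqs n))|exact: m1ka].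
have mu' n : measurable_wrt (F n) (u' n).
  by apply: measurable_funM; [exact: mq|exact: mu].
have mv n : measurable_wrt (F n) (v n).
  by apply: measurable_funM; [exact: mqs|exact: m1kc].
have tX1 n := top (@mX1 n); have tX2 n := top (@mX2 n); have tu n := top (@mu n).
have D10 n w : 0 <= D1 n w by rewrite mulr_ge0.
have D20 n w : 0 <= D2 n w by rewrite mulr_ge0.
have u'0 n w : 0 <= u' n w by rewrite mulr_ge0.
have v0 n w : 0 <= v n w by rewrite mulr_ge0 ?powR_ge0.
have D12 n : cond_le P (F n) (D1 n) (D2 n).
  by apply: (cond_leM (sub n)) => //; exact: mq.
have D2u n : cond_le P (F n) (D2 n) (u' n).
  by apply: (cond_leM (sub n)) => //; exact: mq.
have DE n w : `|D1 n w - D2 n w| `^ s <= E n w.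
  rewrite /D1 /D2 -mulrBr normrM powRM // ger0_norm //.
  by apply: ler_wpM2l => //; exact: powR_ge0.
have Ev n : cond_le P (F n) (E n) (v n).
  apply: (cond_leM (sub n)).
  - exact: (top (m1ka n)).
  - exact: (top (m1kc n)).
  - exact: ka0.
  - exact: kc0.
  - exact: mqs.
  - by move=> w; exact: powR_ge0.
  - have t1 := top (m1k n); have t2 := top (@mnepsa n).
    have t3 := top (@measurable_cond_moment n); have t4 := @cond_le_moment n.
    have c0 := @cond_moment_ge0 n.
    by apply: (cond_leD (sub n)) => // w; exact: powR_ge0.
have := one_sided_strong_law F_filt s12 eta_s mD1 mD2 mE mu' mv
  D10 D20 u'0 v0 D12 D2u DE Ev r_pred r0_meas r_ge1 r_nd.
apply: filterS2 cond_moment_bounded.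
move=> w [Kc cK] H [Kk kK] [K qK] roo e e0; near=> n.
under eq_bigr do rewrite mulrBr.
near: n; apply: H => //; exists (K * (1 + Kk + Kc)) => n.
apply: (@le_trans _ _ (q n w `^ s * (1 + Kk + Kc))).
  by apply: ler_wpM2l; [exact: powR_ge0|rewrite lerD // lerD2l].
have K0 : 0 <= 1 + Kk + Kc.
  by apply: le_trans (kc0 0%N w) _; rewrite lerD // lerD2l.
by have := ler_wpM2r K0 (qK n); lra.
Unshelve. all: by end_near. Qed.

End weighted_law.

Let normB_powR_le (x y s : R) : 0 <= x -> 0 <= y -> 0 < s ->
  `|x - y| `^ s <= x `^ s + y `^ s.
Proof.
move=> x0 y0 s0; have [xy|xy] := leP x y.
  apply: (@le_trans _ _ (y `^ s)); last by rewrite lerDr powR_ge0.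
  by apply: (ge0_ler_powR (ltW s0)); rewrite ?nnegrE // ler_norml; apply/andP; split; lra.
apply: (@le_trans _ _ (x `^ s)); last by rewrite lerDl powR_ge0.
by apply: (ge0_ler_powR (ltW s0)); rewrite ?nnegrE // ler_norml; apply/andP; split; lra.
Qed.

Let eps_powR_le n w (m : nat) (s : R) : 0 <= s -> (2 * m)%:R * s <= a ->
  ((eps n.+1 w ^+ 2) ^+ m) `^ s <= 1 + `|eps n.+1 w| `^ a.
Proof.
move=> s0 msa; have e0 := normr_ge0 (eps n.+1 w).
have ms0 : 0 <= (2 * m)%:R * s by rewrite mulr_ge0.
rewrite -(real_normK (num_real (eps n.+1 w))) -exprM -powR_mulrn // -powRrM.
have [e1|e1] := leP `|eps n.+1 w| 1.
  apply: (@le_trans _ _ 1); last by rewrite lerDl powR_ge0.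
  have := @ge0_ler_powR R _ ms0 `|eps n.+1 w| 1; rewrite powR1.
  by apply; rewrite ?nnegrE.
apply: (@le_trans _ _ (`|eps n.+1 w| `^ a)); last by rewrite lerDr.
by apply: ler_powR => //; exact: ltW.
Qed.

Lemma strong_law_eps2 (q : nat -> T -> R) (s eta : R) :
  1 < s <= 2 -> 2 * s <= a -> 0 <= eta < s - 1 ->
  (forall n, measurable_wrt (F n) (q n)) -> (forall n w, 0 <= q n w) ->
  {ae P, forall w,
    (exists K, forall n,
      q n w `^ s <= K * r n.+1 w `^ eta * (r n.+1 w - r n w)) ->
    r n w @[n --> \oo] --> +oo ->
    forall e, 0 < e -> \forall n \near \oo,
      `|\sum_(0 <= k < n) q k w * (eps k.+1 w ^+ 2 - sigma ^+ 2)| <= e * r n w}.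
Proof.
move=> s12 sa etas mq q0; have /andP[s1 s2] := s12; have s0 : 0 < s by lra.
have g2 : 0 <= sigma ^+ 2 by exact: sqr_ge0.
have me2 n : measurable_wrt (F n.+1) (fun w => eps n.+1 w ^+ 2).
  by apply: measurable_funX; exact: measurable_eps.
pose k (n : nat) (w : T) := (sigma ^+ 2) `^ s.
have mcst (x : R) n : measurable_wrt (F n) (fun=> x) by exact: measurable_cst.
have k0 n w : 0 <= k n w by exact: powR_ge0.
have bound n w : `|eps n.+1 w ^+ 2 - sigma ^+ 2| `^ s <= 1 + k n w + `|eps n.+1 w| `^ a.
  apply: le_trans (normB_powR_le (eps2_0 n w) g2 s0) _.
  have := @eps_powR_le n w 1 s (ltW s0); rewrite muln1 expr1 => /(_ sa).
  rewrite /k; lra.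
have bound' n w : `|sigma ^+ 2 - eps n.+1 w ^+ 2| `^ s <= 1 + k n w + `|eps n.+1 w| `^ a.
  by rewrite distrC.
have law1 := @weighted_strong_law s eta q (fun n w => eps n.+1 w ^+ 2)
  (fun _ _ => sigma ^+ 2) (fun _ _ => sigma ^+ 2) k s12 etas mq q0 me2
  (fun n => mcst _ n.+1) (mcst _) (mcst _) eps2_0 (fun _ _ => g2) (fun _ _ => g2)
  k0 (fun n => (cond_eps2 n).1) (fun n A GA => lexx _) bound.
have law2 := @weighted_strong_law s eta q (fun _ _ => sigma ^+ 2)
  (fun n w => eps n.+1 w ^+ 2) (fun _ _ => sigma ^+ 2) k s12 etas mq q0
  (fun n => mcst _ n.+1) me2 (mcst _) (mcst _) (fun _ _ => g2) eps2_0 (fun _ _ => g2)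
  k0 (fun n => (cond_eps2 n).2) (fun n => (cond_eps2 n).1) bound'.
apply: filterS2 law1 law2 => w H1 H2 qK roo e e0.
have kK : exists K, forall n, k n w <= K by exists ((sigma ^+ 2) `^ s).
near=> n; rewrite ler_norml; apply/andP; split.
- rewrite lerNl -sumrN; under eq_bigr do rewrite -mulrN opprB.
  by near: n; exact: H2.
- by near: n; exact: H1.
Unshelve. all: by end_near. Qed.

(** The conditional mean of [eps^(2m)] is not prescribed but only bounded by [1 + cond_moment]. The
    result is thus one-sided, with a constant [Kc] that depends on the path. *)
Lemma strong_law_eps_power (q : nat -> T -> R) (m : nat) (s : R) :
  1 < s <= 2 -> (2 * m)%:R * s <= a ->
  (forall n, measurable_wrt (F n) (q n)) -> (forall n w, 0 <= q n w) ->
  {ae P, forall w, exists2 Kc, 0 <= Kc &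
    (exists K, forall n, q n w `^ s <= K * (r n.+1 w - r n w)) ->
    r n w @[n --> \oo] --> +oo ->
    forall e, 0 < e -> \forall n \near \oo,
      \sum_(0 <= k < n) q k w * (eps k.+1 w ^+ 2) ^+ m <=
      Kc * \sum_(0 <= k < n) q k w + e * r n w}.
Proof.
move=> s12 sa mq q0; have /andP[s1 s2] := s12; have s0 : 0 < s by lra.
pose X1 n w := (eps n.+1 w ^+ 2) ^+ m.
pose X2 n w := 1 + cond_moment n w.
pose k n w := X2 n w `^ s.
have mX1 n : measurable_wrt (F n.+1) (X1 n).
  by apply: measurable_funX; apply: measurable_funX; exact: measurable_eps.
have mX2 n : measurable_wrt (F n) (X2 n).
  by apply: measurable_funD; [exact: measurable_cst|exact: measurable_cond_moment].
have mk n : measurable_wrt (F n) (k n) by apply: measurable_powR_realfun; exact: mX2.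
have X10 n w : 0 <= X1 n w by rewrite exprn_ge0.
have X20 n w : 0 <= X2 n w by rewrite addr_ge0 // cond_moment_ge0.
have k0 n w : 0 <= k n w by exact: powR_ge0.
have ma : (2 * m)%:R * 1 <= a.
  by apply: le_trans sa; apply: ler_wpM2l => //; exact: ltW.
have X12 n : cond_le P (F n) (X1 n) (X2 n).
  have mpa : measurable_fun setT (fun w => 1 + `|eps n.+1 w| `^ a).
    by apply: measurable_funD; [exact: measurable_cst|exact: (top (@mnepsa n))].
  apply: (cond_le_trans (Y := fun w => 1 + `|eps n.+1 w| `^ a)).
    apply: (cond_le_refl _ (sub n)) => //; first exact: (top (mX1 n)).
    move=> w; have := @eps_powR_le n w m 1 ler01 ma.
    by rewrite powRr1 // exprn_ge0.
  have t2 := top (@mnepsa n).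
  have t3 := top (@measurable_cond_moment n); have t4 := @cond_le_moment n.
  have c0 := @cond_moment_ge0 n.
  by apply: (cond_leD (sub n) (X1 := cst 1) (Y1 := cst 1)) => // w; exact: powR_ge0.
have bound n w : `|X1 n w - X2 n w| `^ s <= 1 + k n w + `|eps n.+1 w| `^ a.
  apply: le_trans (normB_powR_le (X10 n w) (X20 n w) s0) _.
  have := @eps_powR_le n w m s (ltW s0) sa; rewrite /k -/(X1 n w); lra.
have es : 0 <= (0 : R) < s - 1 by apply/andP; split => //; lra.
have law := @weighted_strong_law s 0 q X1 X2 X2 k s12 es mq q0 mX1
  (fun n => up (mX2 n)) mX2 mk X10 X20 X20 k0 X12 (fun n A GA => lexx _) bound.
apply: filterS2 cond_moment_bounded law => w [Kc cK] H.
have Kc0 : 0 <= 1 + Kc by rewrite addr_ge0 // (le_trans _ (cK 0%N)) // cond_moment_ge0.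
have X2K n : X2 n w <= 1 + Kc by rewrite lerD2l.
exists (1 + Kc) => // -[K qK] roo e e0; near=> n.
rewrite mulr_sumr.
have : \sum_(0 <= k < n) q k w * (X1 k w - X2 k w) <= e * r n w.
  near: n; apply: H => //.
    exists ((1 + Kc) `^ s) => n; apply: (ge0_ler_powR (ltW s0)); rewrite ?nnegrE //.
  by exists K => n; rewrite powRr0 mulr1.
rewrite -lerBlDl -sumrB => /(le_trans _); apply.
apply: ler_sum => j _; rewrite -[(_ ^+ 2) ^+ m]/(X1 j w).
have := ler_wpM2l (q0 j w) (X2K j); lra.
Unshelve. all: by end_near. Qed.

End laws.

End noise.

(** * Law for the powers of a quadratic form *)

(** It breaks a circle: the strong law bounds [Zp + X] through a normaliser that contains [X] and
    the running maximum of [Zp]. With coefficient 1/4, a new maximum is at most [K t + Rm / 4],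
    hence [Rm n <= 2 K t n + Rm n0] persists, and [X] follows. *)
Lemma running_max_linear {R : realType} (Zp X t Rm : nat -> R) (K : R) n0 :
  0 <= K -> (forall n, 0 <= Zp n) -> (forall n, 0 <= X n) ->
  (forall n, 1 <= t n) -> (forall n, t n <= t n.+1) ->
  (forall n, 0 <= Rm n) -> (forall n, Rm n.+1 = Num.max (Rm n) (Zp n)) ->
  (forall n, (n0 <= n)%N -> Zp n + X n <= K * t n + (X n + Rm n) / 4) ->
  exists2 K', 0 <= K' & forall n, (n0 <= n)%N -> X n + Rm n <= K' * t n.
Proof.
move=> K0 Zp0 X0 t1 tnd Rm0 RmS H.
have Rle n : (n0 <= n)%N -> Rm n <= 2 * K * t n + Rm n0.
  elim: n => [|n IH]; first by rewrite leqn0 => /eqP ->; rewrite lerDr; have := t1 0%N; nra.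
  rewrite leq_eqVlt => /orP[/eqP <-|]; first by rewrite lerDr; have := t1 n0; nra.
  rewrite ltnS => nn0; have Rn := IH nn0; have Hn := H n nn0.
  have Kt : K * t n <= K * t n.+1 by rewrite ler_wpM2l.
  have Xn := X0 n; have Zn := Zp0 n; have R0 := Rm0 n0; have Rn0 := Rm0 n.
  have Kt0 : 0 <= K * t n by rewrite mulr_ge0 // (le_trans _ (t1 n)).
  rewrite RmS ge_max; apply/andP; split; lra.
exists (4 * K + 2 * Rm n0); first by rewrite addr_ge0 ?mulr_ge0.
move=> n nn0; have := Rle n nn0; have := H n nn0; have := Zp0 n.
have R0 : Rm n0 <= Rm n0 * t n by rewrite ler_peMr.
have := Rm0 n0; have : 0 <= K * t n by rewrite mulr_ge0 // (le_trans _ (t1 n)).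
lra.
Qed.

Lemma partial_sum_small_o {R : realType} (g y : nat -> R) :
  (forall n, 0 <= g n) -> (forall n, 0 <= y n) ->
  (forall e, 0 < e -> \forall n \near \oo, y n <= e * g n) ->
  \sum_(0 <= k < n) g k @[n --> \oo] --> +oo ->
  forall e, 0 < e -> \forall n \near \oo,
    \sum_(0 <= k < n) y k <= e * \sum_(0 <= k < n) g k.
Proof.
move=> g0 y0 yg goo e e0.
have e20 : 0 < e / 2 by rewrite divr_gt0.
have [N _ HN] := yg _ e20.
pose B := \sum_(0 <= k < N) y k.
have B0 : 0 <= B by apply: sumr_ge0.
near=> n.
have nN : (N <= n)%N by near: n; exact: nbhs_infty_ge.
apply: (@le_trans _ _ (B + e / 2 * \sum_(0 <= k < n) g k)).
  rewrite (big_cat_nat _ nN) //= lerD2l.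
  apply: (@le_trans _ _ (\sum_(N <= k < n) e / 2 * g k)).
    rewrite big_nat_cond [leRHS]big_nat_cond.
    by apply: ler_sum => k /andP[/andP[Nk _] _]; exact: HN.
  rewrite -mulr_sumr; apply: ler_wpM2l; first exact: ltW.
  by rewrite [leRHS](big_cat_nat _ nN) //= lerDr sumr_ge0.
have : B / (e / 2) <= \sum_(0 <= k < n) g k.
  by near: n; move/cvgryPge : goo; exact.
rewrite ler_pdivrMr // => ?; lra.
Unshelve. all: by end_near. Qed.

(* The conclusion of the strong law for [Z ^ q] along a path: [b] is the
   coefficient of the noise, [H] the value of [Z] before the noise is added and
   [g] the increments of the clock. *)
Definition power_law {R : realType} (sigma : R) (g Z H b : nat -> R) q :=
  (exists K, forall n, \sum_(0 <= k < n) H k ^+ q.-1 * g k <=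
    K * (1 + \sum_(0 <= k < n) g k)) ->
  forall e, 0 < e -> \forall n \near \oo,
    `|Z n ^+ q + \sum_(0 <= k < n) (Z k ^+ q - H k ^+ q)
      - sigma ^+ 2 * \sum_(0 <= k < n) (q%:R * H k ^+ q.-1 * g k +
          2 * q%:R * q.-1%:R * H k ^+ q.-2 * b k ^+ 2)| <=
    e * (1 + \sum_(0 <= k < n) g k).

Section scheme.
Context {disp : measure_display} {T : measurableType disp} {R : realType}.
Variable P : probability T R.
Variable F : nat -> set (set T).
Hypothesis F_filt : filtration F.
Variables (eps : nat -> T -> R) (sigma a : R) (C : nat -> T -> \bar R).
Hypothesis eps_md : martingale_difference P F eps.
Hypothesis eps_var : forall n, is_cond_expectation P (F n)
  (fun w => (eps n.+1 w ^+ 2)%:E) (cst (sigma ^+ 2)%:E).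
Hypothesis C_cond : forall n, is_cond_expectation P (F n)
  (fun w => (`|eps n.+1 w| `^ a)%:E) (C n).
Hypothesis C_bounded : {ae P, forall w,
  (ereal_sup (range (fun n => C n w)) < +oo)%E}.
Variable p : nat.
Hypothesis p_ge1 : (1 <= p)%N.
Hypothesis a_gt2p : (2 * p)%:R < a.
Variables Z H b g : nat -> T -> R.
Hypothesis mZ : forall n, measurable_wrt (F n) (Z n).
Hypothesis mH : forall n, measurable_wrt (F n) (H n).
Hypothesis mb : forall n, measurable_wrt (F n) (b n).
Hypothesis mg : forall n, measurable_wrt (F n) (g n).
Hypothesis H0 : forall n w, 0 <= H n w.
Hypothesis HZ : forall n w, H n w <= Z n w.
Hypothesis g01 : forall n w, 0 <= g n w <= 1.
Hypothesis bB : forall n w, b n w ^+ 2 <= Z n w - H n w.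
Hypothesis bgH : forall n w, b n w ^+ 2 <= g n w * H n w.
Hypothesis ZS : forall n w,
  Z n.+1 w = H n w + 2 * eps n.+1 w * b n w + eps n.+1 w ^+ 2 * g n w.

Let g0 n w : 0 <= g n w. Proof. by case/andP: (g01 n w). Qed.
Let g1 n w : g n w <= 1. Proof. by case/andP: (g01 n w). Qed.
Let Z0 n w : 0 <= Z n w. Proof. exact: le_trans (H0 n w) (HZ n w). Qed.

Let hg n w := H n w ^+ p.-1 * g n w.
Let dx n w := Z n w ^+ p - H n w ^+ p.
Let q1 n w := 2 * p%:R * H n w ^+ p.-1 * b n w.
Let q2 n w := p%:R * H n w ^+ p.-1 * g n w +
  2 * p%:R * p.-1%:R * H n w ^+ p.-2 * b n w ^+ 2.
Let inc n w := g n w + hg n w + dx n w.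
Fixpoint running_max n w : R :=
  if n is m.+1 then Num.max (running_max m w) (Z m w ^+ p) else 0.
(** Each summand controls one noise term: the increments [dx] the coefficient [q1], [hg] the
    coefficient [q2], [g] the top power [g^p], while the running maximum keeps [H^p] below [r n.+1].
    As [running_max n] stops at [Z n.-1], the normaliser is predictable. *)
Let r n w := 1 + \sum_(0 <= k < n) inc k w + running_max n w.

Let hg0 n w : 0 <= hg n w. Proof. by rewrite mulr_ge0 // exprn_ge0. Qed.
Let HZp n w : H n w ^+ p <= Z n w ^+ p. Proof. by apply: lerXn2r; rewrite ?nnegrE. Qed.
Let dx0 n w : 0 <= dx n w. Proof. by rewrite subr_ge0. Qed.
Let inc0 n w : 0 <= inc n w. Proof. by apply: addr_ge0; [apply: addr_ge0|]. Qed.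
Let max0 n w : 0 <= running_max n w.
Proof. by elim: n => //= n IH; rewrite le_max IH. Qed.
Let maxS n w : running_max n w <= running_max n.+1 w.
Proof. by rewrite /= le_max lexx. Qed.
Let rS n w : r n w + inc n w <= r n.+1 w.
Proof.
rewrite /r big_nat_recr //= -/(running_max n.+1 w).
by have := maxS n w; rewrite /=; lra.
Qed.
Let r_ge1 n w : 1 <= r n w.
Proof. by rewrite /r -addrA lerDl addr_ge0 // sumr_ge0. Qed.
Let r_nd n w : r n w <= r n.+1 w.
Proof. by have := rS n w; have := inc0 n w; lra. Qed.
Let Hr n w : H n w ^+ p <= r n.+1 w.
Proof.
apply: le_trans (HZp n w) _; apply: (@le_trans _ _ (running_max n.+1 w)).
  by rewrite /= le_max lexx orbT.
by rewrite /r lerDr addr_ge0 // sumr_ge0.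
Qed.
Let hg_inc n w : hg n w <= r n.+1 w - r n w.
Proof. have := rS n w; have := g0 n w; have := dx0 n w; rewrite /inc; lra. Qed.
Let g_inc n w : g n w <= r n.+1 w - r n w.
Proof. have := rS n w; have := hg0 n w; have := dx0 n w; rewrite /inc; lra. Qed.
Let dx_inc n w : dx n w <= r n.+1 w - r n w.
Proof. have := rS n w; have := hg0 n w; have := g0 n w; rewrite /inc; lra. Qed.

Let mhg n : measurable_wrt (F n) (hg n).
Proof. by apply: measurable_funM; [apply: measurable_funX; exact: mH|exact: mg]. Qed.
Let mdx n : measurable_wrt (F n) (dx n).
Proof. by apply: measurable_funB; apply: measurable_funX; [exact: mZ|exact: mH]. Qed.
Let minc n : measurable_wrt (F n) (inc n).
Proof.
apply: measurable_funD; last exact: mdx.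
by apply: measurable_funD; [exact: mg|exact: mhg].
Qed.
Let r_pred n : measurable_wrt (F n) (r n.+1).
Proof.
apply: measurable_funD.
  apply: measurable_funD; first exact: measurable_cst.
  elim: n => [|n IH].
    have -> : (fun w => \sum_(0 <= k < 1) inc k w) = inc 0%N.
      by apply/funext => w; rewrite big_nat1.
    exact: minc.
  have -> : (fun w => \sum_(0 <= k < n.+2) inc k w) =
      (fun w => \sum_(0 <= k < n.+1) inc k w + inc n.+1 w).
    by apply/funext => w; rewrite big_nat_recr.
  apply: measurable_funD; last exact: minc.
  exact: (measurable_wrt_le F_filt (leqnSn n) IH).
elim: n => [|n IH].
  apply: measurable_maxr; first exact: measurable_cst.
  by apply: measurable_funX; exact: mZ.
apply: measurable_maxr; last by apply: measurable_funX; exact: mZ.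
exact: (measurable_wrt_le F_filt (leqnSn n) IH).
Qed.
Let r0_meas : measurable_wrt (F 0%N) (r 0%N).
Proof.
have -> : r 0%N = cst 1 by apply/funext => w; rewrite /r big_geq // !addr0.
exact: measurable_cst.
Qed.

Let pR1 : (1 : R) <= p%:R. Proof. by rewrite ler1n. Qed.
(** The order is capped at 2 by the expansion of the positive part, and by [a / (2 p)] so that
    [eps^(2p)] has a conditional moment of order [s]; [a > 2p] makes it exceed 1. *)
Let s := Num.min 2 (a / (2 * p)%:R).
Let s12 : 1 < s <= 2.
Proof.
rewrite /s ge_min lexx andbT lt_min; apply/andP; split; first by lra.
by rewrite ltr_pdivlMr ?mul1r // ltr0n muln_gt0.
Qed.
Let spa : (2 * p)%:R * s <= a.
Proof.
rewrite mulrC -ler_pdivlMr ?ltr0n ?muln_gt0 //.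
by rewrite /s ge_min lexx orbT.
Qed.
Let s2a : 2 * s <= a.
Proof.
apply: le_trans spa; apply: ler_wpM2r; last by rewrite ler_nat -[leqLHS]muln1 leq_mul2l.
by case/andP: s12 => /ltW s1 _; apply: le_trans s1.
Qed.

(* [H ^ (p-1)] is a power [1 - 1/p < 1] of the normaliser: this is the gain that
   makes the strong laws applicable although [Z] is not known to be bounded. *)
Let Hpr n w : H n w ^+ p.-1 <= r n.+1 w `^ (1 - p%:R^-1).
Proof.
have p0 : 0 < p%:R :> R by rewrite ltr0n.
have e0 : 0 <= 1 - p%:R^-1 :> R by rewrite subr_ge0 invf_le1.
apply: (@le_trans _ _ ((H n w ^+ p) `^ (1 - p%:R^-1))); last first.
  apply: (ge0_ler_powR e0); rewrite ?nnegrE ?exprn_ge0 //.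
  exact: le_trans (r_ge1 _ _).
rewrite -!powR_mulrn // -powRrM le_eqVlt; apply/orP; left; apply/eqP.
congr (_ `^ _); have pE : p%:R = p.-1%:R + 1 :> R by rewrite natr1 prednK.
by rewrite mulrBr mulr1 divff ?gt_eqF // pE addrK.
Qed.

Let eta1 := 1 - p%:R^-1 : R.
Let eta1_01 : 0 <= eta1 < 1.
Proof.
have p0 : 0 < p%:R :> R by rewrite ltr0n.
by rewrite /eta1 subr_ge0 invf_le1 // pR1 /= ltrBlDr ltrDl invr_gt0.
Qed.

(** One factor [H^(p-1)] goes into a power of [r]; the other combines with [b^2 <= Z - H] to give at
    most [Z^p - H^p], an increment of the clock. *)
Let q1_bound n w :
  q1 n w ^+ 2 <= (2 * p%:R) ^+ 2 * r n.+1 w `^ eta1 * (r n.+1 w - r n w).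
Proof.
have -> : q1 n w ^+ 2 =
   (2 * p%:R) ^+ 2 * (H n w ^+ p.-1 * (H n w ^+ p.-1 * b n w ^+ 2)).
  by rewrite /q1; ring.
rewrite -mulrA; apply: ler_wpM2l; first exact: sqr_ge0.
apply: ler_pM.
- exact: exprn_ge0.
- by rewrite mulr_ge0 ?sqr_ge0 // exprn_ge0.
- exact: Hpr.
apply: le_trans (dx_inc n w).
apply: (@le_trans _ _ (H n w ^+ p.-1 * (Z n w - H n w))).
  by rewrite ler_wpM2l // exprn_ge0.
have ZHp : H n w ^+ p.-1 <= Z n w ^+ p.-1 by apply: lerXn2r; rewrite ?nnegrE.
have Zp1 : Z n w ^+ p = Z n w * Z n w ^+ p.-1 by rewrite -{1}(prednK p_ge1) exprS.
have Hp1 : H n w ^+ p = H n w * H n w ^+ p.-1 by rewrite -{1}(prednK p_ge1) exprS.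
rewrite /dx Zp1 Hp1; have := ler_wpM2l (Z0 n w) ZHp; lra.
Qed.

(** In [hg^s = hg * hg^(s-1)] the first factor is at most an increment of the clock; in the second,
    [g <= 1] leaves [H^(p-1)], a power of [r] less than 1. *)
Let q_bound (q : nat -> T -> R) (K : R) n w : 0 <= K -> 0 <= q n w ->
  q n w <= K * hg n w ->
  q n w `^ s <= K `^ s * r n.+1 w `^ (eta1 * (s - 1)) * (r n.+1 w - r n w).
Proof.
move=> K0 q0 qK; have /andP[s1 s2] := s12; have s0 : 0 < s by lra.
have s10 : 0 <= s - 1 by lra.
apply: (@le_trans _ _ ((K * hg n w) `^ s)).
  by apply: (ge0_ler_powR (ltW s0)); rewrite ?nnegrE // mulr_ge0.
rewrite powRM // -mulrA; apply: ler_wpM2l; first exact: powR_ge0.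
rewrite -(@mulr_powRB1 _ (hg n w) s) // [leRHS]mulrC.
apply: ler_pM => //; first exact: powR_ge0.
rewrite powRrM; apply: (ge0_ler_powR s10); rewrite ?nnegrE ?powR_ge0 //.
apply: le_trans (Hpr n w); rewrite /hg.
by apply: ler_piMr; [exact: exprn_ge0|].
Qed.

Let q2_ge0 n w : 0 <= q2 n w.
Proof.
have h0 m : 0 <= H n w ^+ m by exact: exprn_ge0.
apply: addr_ge0; first by apply: mulr_ge0 => //; exact: mulr_ge0.
apply: mulr_ge0; last exact: sqr_ge0.
by apply: mulr_ge0 => //; apply: mulr_ge0 => //; exact: mulr_ge0.
Qed.

Let q2_le n w : q2 n w <= (p%:R + 2 * p%:R * p.-1%:R) * hg n w.
Proof.
rewrite /q2 [leRHS]mulrDl /hg; apply: lerD; first by rewrite mulrA.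
case: p p_ge1 => [//|[|m]] _ /=; first by rewrite mulr0 !mul0r.
rewrite -mulrA; apply: ler_wpM2l; first by rewrite !mulr_ge0.
rewrite [H n w ^+ m.+1]exprS [H n w * _]mulrC -mulrA [H n w * _]mulrC.
by apply: ler_wpM2l; [exact: exprn_ge0|exact: bgH].
Qed.

Let X n w := \sum_(0 <= k < n) dx k w.
Let Y n w := \sum_(0 <= k < n) hg k w.
Let G n w := \sum_(0 <= k < n) g k w.
Let rem n w := power_remainder p (H n w) (g n w) (b n w) (eps n.+1 w).

Let rE n w : r n w = 1 + G n w + Y n w + X n w + running_max n w.
Proof.
have -> : r n w = 1 + (G n w + Y n w + X n w) + running_max n w.
  by rewrite /r /G /Y /X -!big_split.
ring.
Qed.

Let Z_expansion n w : Z n w ^+ p + X n w = Z 0%N w ^+ p +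
  \sum_(0 <= k < n) q1 k w * eps k.+1 w +
  \sum_(0 <= k < n) q2 k w * eps k.+1 w ^+ 2 + \sum_(0 <= k < n) rem k w.
Proof.
elim: n => [|n IH]; first by rewrite /X !big_geq // !addr0.
rewrite /X !big_nat_recr //= -/(X n w).
have -> : Z n.+1 w ^+ p = H n w ^+ p + q1 n w * eps n.+1 w +
    q2 n w * eps n.+1 w ^+ 2 + rem n w.
  by rewrite ZS /rem /power_remainder /q1 /q2; ring.
rewrite /dx; lra.
Qed.

Let J n w := Z n w ^+ p + X n w - sigma ^+ 2 * \sum_(0 <= k < n) q2 k w.

Let JE n w : J n w = Z 0%N w ^+ p +
  \sum_(0 <= k < n) q1 k w * eps k.+1 w +
  \sum_(0 <= k < n) q2 k w * (eps k.+1 w ^+ 2 - sigma ^+ 2) +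
  \sum_(0 <= k < n) rem k w.
Proof.
rewrite /J Z_expansion.
have -> : \sum_(0 <= k < n) q2 k w * (eps k.+1 w ^+ 2 - sigma ^+ 2) =
  \sum_(0 <= k < n) q2 k w * eps k.+1 w ^+ 2 - sigma ^+ 2 * \sum_(0 <= k < n) q2 k w.
  by rewrite mulr_sumr -sumrB; apply: eq_bigr => k _; ring.
ring.
Qed.

Let mq1 n : measurable_wrt (F n) (q1 n).
Proof.
apply: measurable_funM; last exact: mb.
by apply: measurable_funM; [exact: measurable_cst|apply: measurable_funX; exact: mH].
Qed.

Let mq2 n : measurable_wrt (F n) (q2 n).
Proof.
apply: measurable_funD.
  apply: measurable_funM; last exact: mg.
  by apply: measurable_funM; [exact: measurable_cst|apply: measurable_funX; exact: mH].
apply: measurable_funM; last by apply: measurable_funX; exact: mb.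
by apply: measurable_funM; [exact: measurable_cst|apply: measurable_funX; exact: mH].
Qed.

Let mgp n : measurable_wrt (F n) (fun w => g n w ^+ p).
Proof. by apply: measurable_funX; exact: mg. Qed.

Let gp_bound n w : (g n w ^+ p) `^ s <= 1 * (r n.+1 w - r n w).
Proof.
have /andP[s1 s2] := s12; have s0 : 0 < s by lra.
rewrite mul1r; apply: le_trans (g_inc n w).
apply: (@le_trans _ _ (g n w `^ s)).
  apply: (ge0_ler_powR (ltW s0)); rewrite ?nnegrE ?exprn_ge0 //.
  by rewrite -(prednK p_ge1) exprS ler_piMr // exprn_ile1.
have [->|gn0] := eqVneq (g n w) 0; first by rewrite powR0 ?gt_eqF.
by apply: ge1r_powR; [rewrite lt_neqAle eq_sym gn0 g0 g1|exact: ltW].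
Qed.

Let goo_roo w : G n w @[n --> \oo] --> +oo -> r n w @[n --> \oo] --> +oo.
Proof.
apply: ger_cvgy; apply: nearW => n; rewrite rE.
have Y0 : 0 <= Y n w by apply: sumr_ge0.
have X0 : 0 <= X n w by apply: sumr_ge0.
have := max0 n w; lra.
Qed.

(** In the expansion of [J] the noise in [q1] and the centred noise in [q2] obey strong laws. The
    remainder costs a small multiple of the sum of [hg eps^2], plus a large one of the sum of
    [g^p eps^(2p)]. *)
Let J_small : {ae P, forall w,
  G n w @[n --> \oo] --> +oo -> g n w @[n --> \oo] --> 0 ->
  forall e, 0 < e -> \forall n \near \oo, `|J n w| <= e * r n w}.
Proof.
have /andP[s1 s2] := s12.
have etas : 0 <= eta1 * (s - 1) < s - 1.
  have /andP[e0 e1] := eta1_01; have s10 : 0 < s - 1 by lra.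
  by rewrite mulr_ge0 ?(ltW s10) //= gtr_pMl.
have L1 := strong_law_eps F_filt eps_md eps_var r_pred r0_meas r_ge1 r_nd mq1 eta1_01.
have L2 := strong_law_eps2 F_filt eps_md eps_var C_cond C_bounded
  r_pred r0_meas r_ge1 r_nd s12 s2a etas mq2 q2_ge0.
(* This third law serves only as a bound: the sum of [hg eps^2] is at most [(sigma^2 + 1) r], which
   the small coefficient [eta] then makes negligible. *)
have L3 := strong_law_eps2 F_filt eps_md eps_var C_cond C_bounded
  r_pred r0_meas r_ge1 r_nd s12 s2a etas mhg hg0.
have gp0 n w : 0 <= g n w ^+ p by exact: exprn_ge0.
have L4 := strong_law_eps_power F_filt eps_md C_cond C_bounded
  r_pred r0_meas r_ge1 r_nd s12 spa mgp gp0.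
apply: filterS2 (filterI L1 L2) (filterI L3 L4).
move=> w [H1 H2] [H3 [Kc Kc0 H4]] Goo gz e e0.
have roo := goo_roo Goo.
have r0 n : 0 < r n w by exact: lt_le_trans (r_ge1 n w).
have bq1 n := q1_bound n w.
have {}H1 := H1 (ex_intro _ _ bq1) roo.
have cc0 : 0 <= p%:R + 2 * p%:R * p.-1%:R :> R by rewrite addr_ge0 ?mulr_ge0.
have bq2 n := @q_bound q2 _ n w cc0 (q2_ge0 n w) (q2_le n w).
have {}H2 := H2 (ex_intro _ _ bq2) roo.
have hgle n : hg n w <= 1 * hg n w by rewrite mul1r.
have bq3 n := @q_bound hg _ n w ler01 (hg0 n w) (hgle n).
have {}H3 := H3 (ex_intro _ _ bq3) roo.
have bq4 n := gp_bound n w.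
have {}H4 := H4 (ex_intro _ _ bq4) roo.
have g2 : 0 <= sigma ^+ 2 by exact: sqr_ge0.
pose eta := e / (8 * (sigma ^+ 2 + 1)).
have sp1 : 0 < sigma ^+ 2 + 1 by rewrite ltr_wpDl.
have eta0 : 0 < eta by rewrite divr_gt0 // mulr_gt0.
have [K K0 remle] := @power_remainder_le R p eta p_ge1 eta0.
pose Kp := K * p.-1%:R; have Kp0 : 0 <= Kp by rewrite mulr_ge0.
pose e1 := e / (8 * (Kp + 1)).
have Kp1 : 0 < Kp + 1 by rewrite ltr_wpDl.
have e10 : 0 < e1 by rewrite divr_gt0 // mulr_gt0.
pose e2 := e / (8 * (Kp * Kc + 1)).
have Kpc1 : 0 < Kp * Kc + 1 by rewrite ltr_wpDl // mulr_ge0.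
have e20 : 0 < e2 by rewrite divr_gt0 // mulr_gt0.
have e8 : 0 < e / 8 by rewrite divr_gt0.
(* For [p >= 2], [g^p = o(g)] because [g] tends to 0; for [p = 1] the factor [p.-1%:R] in [Kp] makes
   the term vanish. *)
have gpsmall : \forall n \near \oo,
    Kp * \sum_(0 <= k < n) g k w ^+ p <= Kp * (e2 * r n w).
  have [p1|p1] := eqVneq p 1%N.
    by apply: nearW => n; rewrite /Kp p1 /= mulr0 !mul0r.
  have p2 : (1 < p)%N by rewrite ltn_neqAle eq_sym p1.
  have : \forall n \near \oo, \sum_(0 <= k < n) g k w ^+ p <= e2 * G n w.
    apply: partial_sum_small_o => // d d0.
    have : \forall n \near \oo, `|0 - g n w| <= d.
      by move/cvgrPdist_le : gz; exact.
    apply: filterS => n; rewrite sub0r normrN ger0_norm // => gd.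
    rewrite -(prednK p_ge1) exprS mulrC; apply: ler_wpM2r => //.
    apply: le_trans gd; rewrite -(prednK (n := p.-1)) ?exprS; last by case: p p2 => [|[]].
    by rewrite ler_piMr // exprn_ile1.
  apply: filterS => n Hn; apply: ler_wpM2l => //; apply: le_trans Hn _.
  apply: ler_wpM2l; first exact: ltW.
  have Y0 : 0 <= Y n w by apply: sumr_ge0.
  have X0 : 0 <= X n w by apply: sumr_ge0.
  rewrite rE; have := max0 n w; lra.
near=> n; rewrite JE.
have rn := r0 n.
have A0 : `|Z 0%N w ^+ p| <= e / 8 * r n w.
  rewrite ger0_norm ?exprn_ge0 // -ler_pdivrMl //.
  by near: n; move/cvgryPge : roo; exact.
have A1 : `|\sum_(0 <= k < n) q1 k w * eps k.+1 w| <= e / 8 * r n w.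
  by near: n; exact: H1.
have A2 : `|\sum_(0 <= k < n) q2 k w * (eps k.+1 w ^+ 2 - sigma ^+ 2)| <= e / 8 * r n w.
  by near: n; exact: H2.
have A3 : `|\sum_(0 <= k < n) hg k w * (eps k.+1 w ^+ 2 - sigma ^+ 2)| <= 1 * r n w.
  by near: n; exact: H3.
have A4 : \sum_(0 <= k < n) g k w ^+ p * (eps k.+1 w ^+ 2) ^+ p <=
    Kc * \sum_(0 <= k < n) g k w ^+ p + e1 * r n w.
  by near: n; exact: H4.
have A5 : Kp * \sum_(0 <= k < n) g k w ^+ p <= Kp * (e2 * r n w) by near: n.
have A6 : `|\sum_(0 <= k < n) rem k w| <=
    eta * \sum_(0 <= k < n) hg k w * eps k.+1 w ^+ 2 +
    Kp * \sum_(0 <= k < n) g k w ^+ p * (eps k.+1 w ^+ 2) ^+ p.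
  apply: le_trans (ler_norm_sum _ _ _) _.
  rewrite !mulr_sumr -big_split /=; apply: ler_sum => k _.
  apply: le_trans (remle _ _ _ (eps k.+1 w) (H0 k w) (g0 k w) (bgH k w)) _.
  by rewrite exprMn /hg /Kp !mulrA.
have A7 : eta * \sum_(0 <= k < n) hg k w * eps k.+1 w ^+ 2 <= e / 8 * r n w.
  have E1 : \sum_(0 <= k < n) hg k w * eps k.+1 w ^+ 2 =
    \sum_(0 <= k < n) hg k w * (eps k.+1 w ^+ 2 - sigma ^+ 2) + sigma ^+ 2 * Y n w.
    by rewrite /Y mulr_sumr -big_split /=; apply: eq_bigr => k _; ring.
  have G0 : 0 <= G n w by apply: sumr_ge0.
  have X0 : 0 <= X n w by apply: sumr_ge0.
  have Yr : Y n w <= r n w by rewrite rE; have := max0 n w; lra.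
  have Yr2 := ler_wpM2l g2 Yr.
  have A3' := le_trans (ler_norm _) A3.
  rewrite E1 (_ : e / 8 * r n w = eta * ((sigma ^+ 2 + 1) * r n w)).
    by apply: ler_wpM2l; [exact: ltW|lra].
  by rewrite /eta; field; rewrite gt_eqF.
have A8 : Kp * \sum_(0 <= k < n) g k w ^+ p * (eps k.+1 w ^+ 2) ^+ p <= e / 4 * r n w.
  apply: le_trans (ler_wpM2l Kp0 A4) _.
  have B1 : Kp * (e1 * r n w) <= e / 8 * r n w.
    rewrite mulrA; apply: ler_wpM2r; first exact: ltW.
    rewrite /e1 mulrA ler_pdivrMr ?mulr_gt0 //; nra.
  have B2 : Kc * (Kp * (e2 * r n w)) <= e / 8 * r n w.
    have key : Kp * Kc * e2 <= e / 8.
      rewrite /e2 mulrA ler_pdivrMr ?mulr_gt0 //.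
      have -> : e / 8 * (8 * (Kp * Kc + 1)) = Kp * Kc * e + e by field.
      by rewrite lerDl ltW.
    have := ler_wpM2r (ltW rn) key; lra.
  have := ler_wpM2l Kc0 A5; lra.
apply: le_trans (ler_normD _ _) _.
set n1 := Z 0%N w ^+ p in A0 *.
set n2 := \sum_(0 <= k < n) q1 k w * eps k.+1 w in A1 *.
set n3 := \sum_(0 <= k < n) q2 k w * (eps k.+1 w ^+ 2 - sigma ^+ 2) in A2 *.
have := ler_normD (n1 + n2) n3; have := ler_normD n1 n2.
have := mulr_gt0 e0 rn.
lra.
Unshelve. all: by end_near. Qed.

(** [J_small] is relative to [r], which contains the unknown [X] and running maximum. Used once with
    tolerance 1/4, it yields [r = O(1 + G)] by [running_max_linear]; used again with arbitrary
    tolerance, it gives the law in terms of the clock. *)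
Lemma scheme_law : {ae P, forall w,
  \sum_(0 <= k < n) g k w @[n --> \oo] --> +oo -> g n w @[n --> \oo] --> 0 ->
  power_law sigma (g^~ w) (Z^~ w) (H^~ w) (b^~ w) p}.
Proof.
apply: filterS J_small => w JS Goo gz [K YK] e e0.
have {}JS := JS Goo gz.
have g2 : 0 <= sigma ^+ 2 by exact: sqr_ge0.
have GE n : \sum_(0 <= k < n) g k w = G n w by [].
have G0 n : 0 <= G n w by apply: sumr_ge0.
have X0 n : 0 <= X n w by apply: sumr_ge0.
have Y0 n : 0 <= Y n w by apply: sumr_ge0.
have t1 n : 1 <= 1 + G n w by rewrite lerDl.
have K0 : 0 <= K.
  by have := YK 0%N; rewrite !big_geq // addr0 mulr1.
have q4 : 0 < 4^-1 :> R by rewrite invr_gt0.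
have [n0 _ J4] := JS _ q4.
pose c : R := p%:R + 2 * p%:R * p.-1%:R.
have c0 : 0 <= c by rewrite addr_ge0 ?mulr_ge0.
pose K3 := sigma ^+ 2 * (c * K) + (1 + K).
have Q2 n : \sum_(0 <= k < n) q2 k w <= c * (K * (1 + G n w)).
  apply: (@le_trans _ _ (c * Y n w)); last by apply: ler_wpM2l => //; exact: YK.
  by rewrite /Y mulr_sumr; apply: ler_sum => k _; exact: q2_le.
have Zb n : (n0 <= n)%N ->
    Z n w ^+ p + X n w <= K3 * (1 + G n w) + (X n w + running_max n w) / 4.
  move=> nn0; have := le_trans (ler_norm _) (J4 n nn0).
  have := ler_wpM2l g2 (Q2 n); have YKn : Y n w <= K * (1 + G n w) := YK n.
  have := mulr_ge0 K0 (le_trans ler01 (t1 n)); have := t1 n.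
  rewrite /J rE /K3; lra.
have K30 : 0 <= K3.
  apply: addr_ge0; last exact: addr_ge0.
  by apply: mulr_ge0 => //; exact: mulr_ge0.
have [K' K'0 bound] := @running_max_linear R (fun n => Z n w ^+ p) (X^~ w)
  (fun n => 1 + G n w) (running_max^~ w) K3 n0 K30 (fun n => exprn_ge0 p (Z0 n w)) X0 t1
  (fun n => ltac:(by rewrite /G big_nat_recr //= lerD2l lerDl)) (max0^~ w) (fun n => erefl) Zb.
pose M := 1 + K + K'.
have M0 : 0 < M by rewrite /M -addrA ltr_pwDl // addr_ge0.
near=> n.
have nn0 : (n0 <= n)%N by near: n; exact: nbhs_infty_ge.
have rM : r n w <= M * (1 + G n w).
  have := bound n nn0; have YKn : Y n w <= K * (1 + G n w) := YK n.
  rewrite rE /M; lra.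
apply: (@le_trans _ _ (e / M * r n w)).
  have : `|J n w| <= e / M * r n w by near: n; apply: JS; rewrite divr_gt0.
  by [].
rewrite -mulrA; apply: ler_wpM2l; first exact: ltW.
by rewrite ler_pdivrMl.
Unshelve. all: by end_near. Qed.

End scheme.

(** * Asymptotic averages *)

Section averages.
Context {R : realType}.
Variable tau : nat -> R.
Hypothesis tau_oo : tau n @[n --> \oo] --> +oo.
Implicit Types x y z : nat -> R.

(** Asymptotic equivalence written without quotients, since the sequences compared may vanish at
    arbitrarily large indices. *)
Definition sim x y :=
  forall e, 0 < e -> \forall n \near \oo, `|y n - x n| <= e * x n.

Definition avg x (l : R) :=
  (tau n)^-1 * \sum_(0 <= k < n) x k @[n --> \oo] --> l.

Lemma sim_refl x : (forall n, 0 <= x n) -> sim x x.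
Proof. by move=> x0 e e0; apply: nearW => n; rewrite subrr normr0 mulr_ge0 // ltW. Qed.

Lemma sim_sym x y : (forall n, 0 <= x n) -> sim x y -> sim y x.
Proof.
move=> x0 xy e e0.
pose d := Num.min (e / 2) (1 / 2); have d0 : 0 < d by rewrite lt_min !divr_gt0.
have de : d <= e / 2 by rewrite ge_min lexx.
have d1 : d <= 1 / 2 by rewrite ge_min lexx orbT.
near=> n; have H : `|y n - x n| <= d * x n by near: n; exact: xy.
rewrite distrC; apply: le_trans H _.
have /ler_normlP[A B] : `|y n - x n| <= d * x n by near: n; exact: xy.
have D1 := ler_wpM2r (x0 n) d1.
have xy2 : x n <= 2 * y n by lra.
have y0 : 0 <= y n by have := x0 n; lra.
have e2 : e / 2 * x n <= e / 2 * (2 * y n) by rewrite ler_wpM2l // ltW // divr_gt0.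
have := ler_wpM2r (x0 n) de; lra.
Unshelve. all: by end_near. Qed.

Lemma sim_mul x x' y y' : (forall n, 0 <= x n) -> (forall n, 0 <= x' n) ->
  sim x y -> sim x' y' -> sim (fun n => x n * x' n) (fun n => y n * y' n).
Proof.
move=> x0 x'0 xy xy' e e0.
pose d := Num.min (e / 3) 1; have d0 : 0 < d by rewrite lt_min divr_gt0 //=.
have de : d <= e / 3 by rewrite ge_min lexx.
have d1 : d <= 1 by rewrite ge_min lexx orbT.
near=> n.
have H : `|y n - x n| <= d * x n by near: n; exact: xy.
have H' : `|y' n - x' n| <= d * x' n by near: n; exact: xy'.
have -> : y n * y' n - x n * x' n =
  (y n - x n) * (y' n - x' n) + (y n - x n) * x' n + x n * (y' n - x' n) by ring.
have xx0 : 0 <= x n * x' n by rewrite mulr_ge0.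
have A1 : `|(y n - x n) * (y' n - x' n)| <= d * (x n * x' n).
  rewrite normrM; apply: le_trans (ler_pM _ _ H H') _ => //.
  have -> : d * x n * (d * x' n) = d * (d * (x n * x' n)) by ring.
  rewrite ler_wpM2l //; first exact: ltW.
  by rewrite ler_piMl.
have A2 : `|(y n - x n) * x' n| <= d * (x n * x' n).
  by rewrite normrM (ger0_norm (x'0 n)) mulrA ler_wpM2r.
have A3 : `|x n * (y' n - x' n)| <= d * (x n * x' n).
  by rewrite normrM (ger0_norm (x0 n)) mulrCA ler_wpM2l.
have := ler_normD ((y n - x n) * (y' n - x' n) + (y n - x n) * x' n) (x n * (y' n - x' n)).
have := ler_normD ((y n - x n) * (y' n - x' n)) ((y n - x n) * x' n).
have := ler_wpM2r xx0 de; lra.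
Unshelve. all: by end_near. Qed.

Lemma sim_exp x y m : (forall n, 0 <= x n) -> sim x y ->
  sim (fun n => x n ^+ m) (fun n => y n ^+ m).
Proof.
move=> x0 xy; elim: m => [|m IH]; first by apply: sim_refl => n; rewrite expr0.
have -> : (fun n => x n ^+ m.+1) = (fun n => x n * x n ^+ m).
  by apply/funext => n; rewrite exprS.
have -> : (fun n => y n ^+ m.+1) = (fun n => y n * y n ^+ m).
  by apply/funext => n; rewrite exprS.
by apply: sim_mul => // n; exact: exprn_ge0.
Qed.

Lemma sim_trans x y z : (forall n, 0 <= x n) -> sim x y -> sim y z -> sim x z.
Proof.
move=> x0 xy yz e e0.
pose d := Num.min (e / 3) 1; have d0 : 0 < d by rewrite lt_min divr_gt0 //=.
have de : d <= e / 3 by rewrite ge_min lexx.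
have d1 : d <= 1 by rewrite ge_min lexx orbT.
near=> n.
have H : `|y n - x n| <= d * x n by near: n; exact: xy.
have H' : `|z n - y n| <= d * y n by near: n; exact: yz.
have /ler_normlP[A B] := H.
have := ler_normD (z n - y n) (y n - x n); rewrite addrA subrK => D.
have E1 : d * y n <= d * (2 * x n).
  by apply: ler_wpM2l; [exact: ltW|have := ler_wpM2r (x0 n) d1; lra].
have := ler_wpM2r (x0 n) de; lra.
Unshelve. all: by end_near. Qed.

Let tau_gt0 : \forall n \near \oo, 0 < tau n.
Proof. by move/cvgryPgt : tau_oo; exact. Qed.

Lemma avg_add x y l m : avg x l -> avg y m -> avg (fun n => x n + y n) (l + m).
Proof.
move=> xl ym; rewrite /avg.
under eq_fun do rewrite big_split /= mulrDr.
exact: cvgD.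
Qed.

Lemma avg_scale x l c : avg x l -> avg (fun n => c * x n) (c * l).
Proof.
move=> xl; rewrite /avg; under eq_fun do rewrite -mulr_sumr mulrCA.
by apply: cvgMr.
Qed.

Lemma avg_bounded x l : avg x l -> exists2 K, 0 < K & \forall n \near \oo,
  \sum_(0 <= k < n) x k <= K * tau n.
Proof.
move=> xl; exists (`|l| + 1); first by rewrite ltr_wpDl.
have : \forall n \near \oo, `|l - (tau n)^-1 * \sum_(0 <= k < n) x k| <= 1.
  by move/cvgrPdist_le : xl; exact.
apply: filterS2 tau_gt0 => n t0 /ler_normlP[A B].
rewrite -ler_pdivrMr // mulrC; have := ler_norm l; lra.
Qed.

(** The error is measured by a third sequence with bounded averages. This is needed for the squared
    cross terms: their discrepancy is small compared with [de W], but not necessarily compared with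
    the terms themselves. *)
Lemma avg_perturb x y z l : avg x l -> (forall n, 0 <= z n) ->
  (exists2 K, 0 < K & \forall n \near \oo, \sum_(0 <= k < n) z k <= K * tau n) ->
  (forall e, 0 < e -> \forall n \near \oo, `|y n - x n| <= e * z n) -> avg y l.
Proof.
move=> xl z0 [K K0 zK] H.
suff D : avg (fun n => y n - x n) 0.
  have := avg_add D xl; rewrite add0r; congr (avg _ _).
  by apply/funext => n; rewrite subrK.
apply/cvgrPdist_le => e e0; rewrite /=.
have e2K : 0 < e / (2 * K) by rewrite divr_gt0 // mulr_gt0.
have [N _ HN] := H _ e2K.
pose B := \sum_(0 <= k < N) `|y k - x k|.
near=> n.
have t0 : 0 < tau n by near: n; exact: tau_gt0.
have nN : (N <= n)%N by near: n; exact: nbhs_infty_ge.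
rewrite sub0r normrN normrM gtr0_norm ?invr_gt0 // mulrC ler_pdivrMr //.
apply: le_trans (ler_norm_sum _ _ _) _.
rewrite (big_cat_nat _ nN) //= -/B.
have Bt : B <= e / 2 * tau n.
  have e2 : 0 < e / 2 by rewrite divr_gt0.
  by rewrite -ler_pdivrMl //; near: n; move/cvgryPge : tau_oo; exact.
have T : \sum_(N <= k < n) `|y k - x k| <= e / 2 * tau n.
  apply: (@le_trans _ _ (\sum_(N <= k < n) e / (2 * K) * z k)).
    rewrite big_nat_cond [leRHS]big_nat_cond.
    by apply: ler_sum => k /andP[/andP[Nk _] _]; exact: HN.
  rewrite -mulr_sumr.
  apply: (@le_trans _ _ (e / (2 * K) * (K * tau n))).
    apply: ler_wpM2l; first exact: ltW.
    apply: (@le_trans _ _ (\sum_(0 <= k < n) z k)).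
      by rewrite [leRHS](big_cat_nat _ nN) //= lerDr sumr_ge0.
    by near: n.
  rewrite le_eqVlt; apply/orP; left; apply/eqP; field; rewrite gt_eqF //.
lra.
Unshelve. all: by end_near. Qed.

Lemma avg_sim x y l : (forall n, 0 <= x n) -> sim x y -> avg x l -> avg y l.
Proof. by move=> x0 xy xl; apply: (avg_perturb xl x0 (avg_bounded xl)). Qed.

Lemma avg_ext x y l : x =1 y -> avg x l -> avg y l.
Proof. by move=> /funext ->. Qed.

Lemma sim_cvg0 x y : (forall n, 0 <= x n) -> sim x y ->
  y n @[n --> \oo] --> 0 -> x n @[n --> \oo] --> 0.
Proof.
move=> x0 xy y0; have yx := sim_sym x0 xy.
apply/cvgrPdist_le => e e0.
have e2 : 0 < e / 2 by rewrite divr_gt0.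
have h2 : 0 < 1 / 2 :> R by rewrite divr_gt0.
have y2 : \forall n \near \oo, `|0 - y n| <= e / 2.
  by move/cvgrPdist_le : y0; exact.
apply: filterS2 y2 (xy _ h2) => n; rewrite !sub0r !normrN (ger0_norm (x0 n)).
move=> /ler_normlP[A B] /ler_normlP[C D]; lra.
Qed.

End averages.

Arguments avg_scale {R tau x l} c _.
Arguments avg_ext {R tau x y l} _ _.

Lemma exp_diff_bounds {R : realType} (V H : R) q : 0 <= H -> H <= V ->
  q%:R * H ^+ q.-1 * (V - H) <= V ^+ q - H ^+ q <= q%:R * V ^+ q.-1 * (V - H).
Proof.
move=> H0 HV; have V0 := le_trans H0 HV.
case: q => [|q]; first by rewrite !mul0r !expr0 subrr lexx.
have HVq i : H ^+ i <= V ^+ i by apply: lerXn2r; rewrite ?nnegrE.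
elim: q => [|q /andP[A B]]; first by rewrite /= !expr0 !expr1 !mul1r lexx.
rewrite /= in A B *.
have HVB : 0 <= V - H by rewrite subr_ge0.
have E : V ^+ q.+2 - H ^+ q.+2 = V * (V ^+ q.+1 - H ^+ q.+1) + H ^+ q.+1 * (V - H).
  by rewrite ![_ ^+ q.+2]exprS; ring.
have E' : V ^+ q.+2 - H ^+ q.+2 = H * (V ^+ q.+1 - H ^+ q.+1) + V ^+ q.+1 * (V - H).
  by rewrite ![_ ^+ q.+2]exprS; ring.
rewrite -[q.+2%:R]natr1; apply/andP; split.
  rewrite E'; have := ler_wpM2l H0 A; have := ler_wpM2r HVB (HVq q.+1).
  by rewrite [H ^+ q.+1]exprS; lra.
rewrite E; have := ler_wpM2l V0 B; have := ler_wpM2r HVB (HVq q.+1).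
by rewrite [V ^+ q.+1]exprS; lra.
Qed.

(** The mean value bounds [q H^(q-1) (V - H)] and [q V^(q-1) (V - H)] enclose the difference of
    powers, and [H] is equivalent to [V] because the relative decrement is at most [f]. *)
Lemma sim_exp_diff {R : realType} (V H f : nat -> R) q :
  (forall n, 0 <= H n) -> (forall n, H n <= V n) ->
  (forall n, V n - H n <= f n * V n) -> f n @[n --> \oo] --> 0 ->
  sim (fun n => q%:R * V n ^+ q.-1 * (V n - H n)) (fun n => V n ^+ q - H n ^+ q).
Proof.
move=> H0 HV Hf fz.
have V0 n : 0 <= V n by exact: le_trans (HV n).
have VH : sim V H.
  move=> e e0.
  have : \forall n \near \oo, `|0 - f n| <= e by move/cvgrPdist_le : fz; exact.
  apply: filterS => n; rewrite sub0r normrN => /(le_trans (ler_norm _)) fe.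
  rewrite distrC ger0_norm ?subr_ge0 //; apply: le_trans (Hf n) _.
  by rewrite ler_wpM2r.
move=> e e0; have := sim_exp q.-1 V0 VH e0.
apply: filterS => n Hn; have /andP[A B] := exp_diff_bounds q (H0 n) (HV n).
have B0 : 0 <= V n - H n by rewrite subr_ge0.
have D : 0 <= q%:R * (V n - H n) by rewrite mulr_ge0.
rewrite distrC ger0_norm ?subr_ge0 //.
move: Hn; rewrite distrC => /(le_trans (ler_norm _)) /(ler_wpM2l D).
lra.
Qed.

(* Discrete version of: [A' + A = c tau + o(tau)] implies [A = c tau + o(tau)]. *)
Lemma tauberian {R : realType} (c C0 : R) (A de dp tau Y : nat -> R) :
  (forall n, 0 <= dp n <= 1) -> (forall n, 0 <= de n) ->
  (forall n, de n <= C0 * dp n) -> 0 <= C0 ->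
  (forall n, tau n.+1 = tau n + de n) -> (forall n, 0 <= tau n) ->
  tau n @[n --> \oo] --> +oo ->
  (forall n, A n.+1 = A n + dp n * (Y n - A n)) ->
  (forall e, 0 < e -> \forall n \near \oo, `|Y n - c * tau n| <= e * tau n) ->
  (tau n)^-1 * A n @[n --> \oo] --> c.
Proof.
move=> dp01 de0 dedp C00 tauS tau0 tauoo AS Yc.
apply/cvgrPdist_le => e e0.
have e2 : 0 < e / 2 by rewrite divr_gt0.
have e4 : 0 < e / 4 by rewrite divr_gt0.
have : \forall n \near \oo, `|Y n - c * tau n| + `|c| * C0 <= e / 2 * tau n.
  near=> n; have : `|Y n - c * tau n| <= e / 4 * tau n by near: n; exact: Yc.
  have : `|c| * C0 <= e / 4 * tau n.
    by rewrite -ler_pdivrMl //; near: n; move/cvgryPge : tauoo; exact.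
  lra.
move=> [N _ HN].
pose K := `|A N - c * tau N|.
have D n : (N <= n)%N -> `|A n - c * tau n| <= e / 2 * tau n + K.
  elim: n => [|n IH].
    by rewrite leqn0 => /eqP N0; rewrite /K N0 lerDr mulr_ge0 // ltW.
  rewrite leq_eqVlt => /orP[/eqP <-|]; first by rewrite lerDr mulr_ge0 // ltW.
  rewrite ltnS => Nn; have {}IH := IH Nn; have Yn := HN n Nn.
  have /andP[d0 d1] := dp01 n.
  (* [A n.+1] is a convex combination of [A n] and [Y n], so the bound [e / 2 * tau + K] propagates;
     the drift [c * de n] is paid by the reserve [|c| * C0] put aside in [HN], since
     [de <= C0 * dp]. *)
  have -> : A n.+1 - c * tau n.+1 = (1 - dp n) * (A n - c * tau n) +
     (dp n * (Y n - c * tau n) - c * de n) by rewrite AS tauS; ring.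
  have T1 : `|(1 - dp n) * (A n - c * tau n)| <= (1 - dp n) * (e / 2 * tau n + K).
    by rewrite normrM ger0_norm ?subr_ge0 // ler_wpM2l // subr_ge0.
  have T2 : `|dp n * (Y n - c * tau n) - c * de n| <= dp n * (e / 2 * tau n).
    apply: le_trans (ler_normB _ _) _.
    rewrite !normrM (ger0_norm d0) (ger0_norm (de0 n)).
    have := ler_wpM2l (normr_ge0 c) (dedp n); have := ler_wpM2l d0 Yn; lra.
  have tS : e / 2 * tau n <= e / 2 * tau n.+1.
    by rewrite ler_wpM2l ?(ltW e2) // tauS lerDl.
  have K0 : 0 <= K by exact: normr_ge0.
  have dK := mulr_ge0 d0 K0.
  apply: le_trans (ler_normD _ _) _; lra.
near=> n.
have tp : 0 < tau n by near: n; move/cvgryPgt : tauoo; exact.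
have Nn : (N <= n)%N by near: n; exact: nbhs_infty_ge.
have Kt : K <= e / 2 * tau n.
  by rewrite -ler_pdivrMl //; near: n; move/cvgryPge : tauoo; exact.
have -> : c - (tau n)^-1 * A n = - ((A n - c * tau n) / tau n).
  by field; rewrite gt_eqF.
rewrite normrN normrM [`|_^-1|]gtr0_norm ?invr_gt0 // ler_pdivrMr //.
have := D n Nn; lra.
Unshelve. all: by end_near. Qed.

(** * Recursion for the moments *)

Lemma near_le_all {R : realType} (x t : nat -> R) (K : R) :
  (forall n, x n <= x n.+1) -> (forall n, 0 <= x n) -> (forall n, 1 <= t n) -> 0 <= K ->
  (\forall n \near \oo, x n <= K * t n) -> exists K', forall n, x n <= K' * t n.
Proof.
move=> xnd x0 t1 K0 [N _ HN]; exists (K + x N) => n.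
have tn := t1 n; have xN0 := x0 N; have tp : 0 <= t n by lra.
have T1 : 0 <= K * t n by exact: mulr_ge0.
have T2 : x N <= x N * t n by rewrite ler_peMr.
have [nN|nN] := leqP N n.
  have := HN n nN; rewrite mulrDl; lra.
have : x n <= x N.
  have xmono : {homo x : m n / (m <= n)%N >-> m <= n} by exact/nondecreasing_seqP.
  by apply: xmono; exact: ltnW.
rewrite mulrDl; lra.
Qed.

Section moment_recursion.
Context {R : realType}.
Variables (d p : nat) (sigma : R).
Variables de W H2 b2 f V H1 b1 kap : nat -> R.
Hypothesis d_ge1 : (1 <= d)%N.
Let tau n := \sum_(0 <= k < n) de k.
Hypothesis de01 : forall n, 0 <= de n <= 1.
Hypothesis tau_oo : tau n @[n --> \oo] --> +oo.
Hypothesis kap0 : kap n @[n --> \oo] --> 0.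
Hypothesis W0 : forall n, 0 <= W n.
Hypothesis H2E : forall n, H2 n = (1 - de n) * W n.
Hypothesis f01 : forall n, 0 <= f n <= 1.
Hypothesis f0 : f n @[n --> \oo] --> 0.
Hypothesis H10 : forall n, 0 <= H1 n.
Hypothesis H1V : forall n, H1 n <= V n.
Hypothesis VH1 : forall n, V n - H1 n <= f n * V n.
Hypothesis b1E : forall n, b1 n ^+ 2 = (1 - f n) * (V n - H1 n).
Hypothesis f_de : forall n, `|f n - d%:R * de n| <= kap n * de n.
Hypothesis V_W : forall n, `|V n - d%:R * W n| <= kap n * W n.
Hypothesis b1_b2 : forall n,
  `|b1 n ^+ 2 - d%:R ^+ 2 * b2 n ^+ 2| <= kap n * (de n * W n).
Hypothesis law2 : forall q, (0 < q)%N -> (q <= p)%N -> power_law sigma de W H2 b2 q.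
Hypothesis law1 : forall q, (0 < q)%N -> (q <= p)%N -> power_law sigma f V H1 b1 q.

(** These are the moments of [sigma^2 / d] times a chi-square variable with [d] degrees of freedom,
    and will be the limits of the averages of [de W^q]. *)
Fixpoint moment q : R :=
  if q is q'.+1 then sigma ^+ 2 * (d + 2 * q')%:R / d%:R * moment q' else 1.

Let dR : 0 < d%:R :> R. Proof. by rewrite ltr0n. Qed.
Let de0 n : 0 <= de n. Proof. by case/andP: (de01 n). Qed.
Let fge0 n : 0 <= f n. Proof. by case/andP: (f01 n). Qed.
Let V0 n : 0 <= V n. Proof. exact: le_trans (H1V n). Qed.
Let H20 n : 0 <= H2 n.
Proof. by rewrite H2E mulr_ge0 // subr_ge0; case/andP: (de01 n). Qed.
Let H2W n : H2 n <= W n.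
Proof. by rewrite H2E mulrBl mul1r gerBl mulr_ge0. Qed.
Let tau0 n : 0 <= tau n. Proof. by apply: sumr_ge0. Qed.
Let tauS n : tau n.+1 = tau n + de n. Proof. by rewrite /tau big_nat_recr. Qed.
Let dde0 n : 0 <= d%:R * de n. Proof. by rewrite mulr_ge0. Qed.
Let dW0 n : 0 <= d%:R * W n. Proof. by rewrite mulr_ge0. Qed.

Let kap_small e : 0 < e -> \forall n \near \oo, kap n <= e.
Proof.
move=> e0; have : \forall n \near \oo, `|0 - kap n| <= e.
  by move/cvgrPdist_le : kap0; exact.
by apply: filterS => n; rewrite sub0r normrN; exact/le_trans/ler_norm.
Qed.

Let kap_sim (x y : nat -> R) : (forall n, 0 <= x n) ->
  (forall n, `|y n - d%:R * x n| <= kap n * x n) -> sim (fun n => d%:R * x n) y.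
Proof.
move=> x0 H e e0; apply: filterS (kap_small e0) => n ke.
apply: le_trans (H n) _; rewrite mulrA; apply: ler_wpM2r => //.
by apply: le_trans ke _; rewrite ler_peMr ?ler1n // ltW.
Qed.

Let f_sim : sim (fun n => d%:R * de n) f. Proof. exact: kap_sim. Qed.
Let V_sim : sim (fun n => d%:R * W n) V. Proof. exact: kap_sim. Qed.

Let small_sim (x y z : nat -> R) : (forall n, 0 <= x n) ->
  (forall n, `|y n - x n| <= z n * x n) -> z n @[n --> \oo] --> 0 -> sim x y.
Proof.
move=> x0 H z0 e e0.
have : \forall n \near \oo, `|0 - z n| <= e by move/cvgrPdist_le : z0; exact.
apply: filterS => n; rewrite sub0r normrN => /(le_trans (ler_norm _)) ze.
by apply: le_trans (H n) _; exact: ler_wpM2r.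
Qed.

Let VH1_sim : sim V H1.
Proof.
apply: (small_sim V0 _ f0) => n.
by rewrite distrC ger0_norm ?subr_ge0.
Qed.

Let de_cvg0 : de n @[n --> \oo] --> 0.
Proof.
have H := sim_cvg0 dde0 f_sim f0.
have -> : de = (fun n => d%:R^-1 * (d%:R * de n)).
  by apply/funext => n; rewrite mulrA mulVf ?gt_eqF // mul1r.
by rewrite -[X in _ --> X](mulr0 (d%:R^-1)); apply: cvgMr.
Qed.

Let WH2_sim : sim W H2.
Proof.
apply: (small_sim W0 _ de_cvg0) => n.
by rewrite distrC ger0_norm ?subr_ge0 // H2E mulrBl mul1r opprB addrC subrK.
Qed.

Let b1_sim : sim (fun n => V n - H1 n) (fun n => b1 n ^+ 2).
Proof.
have VH0 n : 0 <= V n - H1 n by rewrite subr_ge0.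
apply: (small_sim VH0 _ f0) => n.
rewrite b1E distrC -{1}[V n - H1 n]mul1r -mulrBl opprB addrC subrK.
by rewrite ger0_norm // mulr_ge0.
Qed.

Let av := avg tau.

(** The induction hypothesis couples both kinds of averages occurring on the right-hand side of the
    law of exponent [q + 1]. The factor [1 / d] states that, on average, a squared cross term is a
    share [1 / d] of its Cauchy-Schwarz bound. *)
Let moments q := av (fun n => de n * W n ^+ q) (moment q) /\
  ((0 < q)%N -> av (fun n => W n ^+ q.-1 * b2 n ^+ 2) (moment q / d%:R)).

Let avg_zero : av (fun=> 0) 0.
Proof.
have -> : (0 : R) = 0 * 0 by rewrite mul0r.
rewrite /av /avg; under eq_fun do rewrite big1_seq ?mulr0 //; rewrite mul0r.
exact: cvg_cst.
Qed.

Let avg_eq x l l' : l = l' -> av x l -> av x l'. Proof. by move=> ->. Qed.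

Let moments0 : moments 0.
Proof.
split=> //; rewrite /av /avg; apply: cvg_near_cst; near=> n.
have t0 : 0 < tau n by near: n; move/cvgryPgt : tau_oo; exact.
under eq_bigr do rewrite expr0 mulr1.
by rewrite -/(tau n) mulVf // gt_eqF.
Unshelve. all: by end_near. Qed.

Let law_cvg g Z H b q l : power_law sigma g Z H b q -> (forall n, 0 <= g n) ->
  (forall n, 0 <= H n) ->
  (exists2 K, 0 < K & \forall n \near \oo, 1 + \sum_(0 <= k < n) g k <= K * tau n) ->
  (exists2 K, 0 < K & \forall n \near \oo, tau n <= K * (1 + \sum_(0 <= k < n) g k)) ->
  (exists l0, av (fun n => H n ^+ q.-1 * g n) l0) ->
  av (fun n => q%:R * H n ^+ q.-1 * g n +
          2 * q%:R * q.-1%:R * H n ^+ q.-2 * b n ^+ 2) l ->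
  forall e, 0 < e -> \forall n \near \oo,
   `|Z n ^+ q + \sum_(0 <= k < n) (Z k ^+ q - H k ^+ q) - sigma ^+ 2 * l * tau n|
     <= e * tau n.
Proof.
move=> L g0 H0 [K K0 gK] [K2 K20 tK] [l0 Hl0] Ql e e0.
have [K3 K30 HK3] := avg_bounded tau_oo Hl0.
have {}L : forall e, 0 < e -> \forall n \near \oo,
    `|Z n ^+ q + \sum_(0 <= k < n) (Z k ^+ q - H k ^+ q)
      - sigma ^+ 2 * \sum_(0 <= k < n) (q%:R * H k ^+ q.-1 * g k +
          2 * q%:R * q.-1%:R * H k ^+ q.-2 * b k ^+ 2)| <=
    e * (1 + \sum_(0 <= k < n) g k).
  apply: L; apply: (@near_le_all _ _ _ (K3 * K2)).
  - by move=> n; rewrite big_nat_recr //= lerDl mulr_ge0 // exprn_ge0.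
  - by move=> n; apply: sumr_ge0 => k _; rewrite mulr_ge0 // exprn_ge0.
  - by move=> n; rewrite lerDl sumr_ge0.
  - by rewrite mulr_ge0 // ltW.
  - apply: filterS2 HK3 tK => n A B; apply: le_trans A _.
    by rewrite -mulrA; apply: ler_wpM2l => //; exact: ltW.
have eK : 0 < e / (2 * K) by rewrite divr_gt0 // mulr_gt0.
have s1 : 0 < sigma ^+ 2 + 1 by rewrite ltr_wpDl // sqr_ge0.
have es : 0 < e / (2 * (sigma ^+ 2 + 1)) by rewrite divr_gt0 // mulr_gt0.
pose Q n := \sum_(0 <= k < n) (q%:R * H k ^+ q.-1 * g k +
          2 * q%:R * q.-1%:R * H k ^+ q.-2 * b k ^+ 2).
pose Y n := Z n ^+ q + \sum_(0 <= k < n) (Z k ^+ q - H k ^+ q).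
near=> n.
have t0 : 0 < tau n by near: n; move/cvgryPgt : tau_oo; exact.
have A1 : `|Y n - sigma ^+ 2 * Q n| <= e / (2 * K) * (1 + \sum_(0 <= k < n) g k).
  by near: n; exact: L.
have A2 : `|l - (tau n)^-1 * Q n| <= e / (2 * (sigma ^+ 2 + 1)).
  by near: n; move/cvgrPdist_le : Ql; exact.
have A3 : 1 + \sum_(0 <= k < n) g k <= K * tau n by near: n.
have B1 : e / (2 * K) * (1 + \sum_(0 <= k < n) g k) <= e / 2 * tau n.
  apply: le_trans (ler_wpM2l (ltW eK) A3) _.
  by rewrite le_eqVlt; apply/orP; left; apply/eqP; field; rewrite gt_eqF.
have B2 : `|sigma ^+ 2 * Q n - sigma ^+ 2 * l * tau n| <= e / 2 * tau n.
  have -> : sigma ^+ 2 * Q n - sigma ^+ 2 * l * tau n =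
    - (sigma ^+ 2 * tau n * (l - (tau n)^-1 * Q n)) by field; rewrite gt_eqF.
  have s20 := sqr_ge0 sigma.
  rewrite normrN normrM (ger0_norm (mulr_ge0 s20 (ltW t0))).
  apply: le_trans (ler_wpM2l (mulr_ge0 s20 (ltW t0)) A2) _.
  have -> : sigma ^+ 2 * tau n * (e / (2 * (sigma ^+ 2 + 1))) =
    (sigma ^+ 2 / (sigma ^+ 2 + 1)) * (e / 2 * tau n) by field; rewrite gt_eqF.
  apply: ler_piMl; first by rewrite mulr_ge0 // ?divr_ge0 // ltW.
  by rewrite ler_pdivrMr // mul1r lerDl.
rewrite -/(Y n).
have := ler_normD (Y n - sigma ^+ 2 * Q n) (sigma ^+ 2 * Q n - sigma ^+ 2 * l * tau n).
rewrite addrA subrK; lra.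
Unshelve. all: by end_near. Qed.

Let tau_ge1 : \forall n \near \oo, 1 <= tau n.
Proof. by move/cvgryPge : tau_oo; exact. Qed.

Let clock2 :
  (exists2 K, 0 < K & \forall n \near \oo, 1 + \sum_(0 <= k < n) de k <= K * tau n) /\
  (exists2 K, 0 < K & \forall n \near \oo, tau n <= K * (1 + \sum_(0 <= k < n) de k)).
Proof.
split; [exists 2 => // | exists 1 => //]; apply: filterS tau_ge1 => n;
  rewrite -/(tau n); lra.
Qed.

Lemma avg_f : av f d%:R.
Proof.
have [m0 _] := moments0.
apply: (avg_sim tau_oo dde0 f_sim); rewrite -[X in avg _ _ X]mulr1.
apply: avg_scale; apply: (avg_ext _ m0) => n; by rewrite expr0 mulr1.
Qed.

Let clock1 :
  (exists2 K, 0 < K & \forall n \near \oo, 1 + \sum_(0 <= k < n) f k <= K * tau n) /\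
  (exists2 K, 0 < K & \forall n \near \oo, tau n <= K * (1 + \sum_(0 <= k < n) f k)).
Proof.
split.
  have [K K0 HK] := avg_bounded tau_oo avg_f.
  exists (1 + K); first by rewrite addr_gt0.
  by apply: filterS2 tau_ge1 HK => n; rewrite mulrDl mul1r; exact: lerD.
exists 2 => //.
have h2 : 0 < 1 / 2 :> R by rewrite divr_gt0.
have : \forall n \near \oo, `|d%:R - (tau n)^-1 * \sum_(0 <= k < n) f k| <= 1 / 2.
  by move/cvgrPdist_le : avg_f; exact.
apply: filterS2 tau_ge1 => n t1 /ler_normlP[A B].
have t0 : 0 < tau n by lra.
have d1 : 1 <= d%:R :> R by rewrite ler1n.
have : 1 / 2 <= (tau n)^-1 * \sum_(0 <= k < n) f k by lra.
rewrite [_^-1 * _]mulrC ler_pdivlMr //; lra.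
Qed.

Let avg_law_rhs H g b l1 l2 q : av (fun n => H n ^+ q * g n) l1 ->
  ((0 < q)%N -> av (fun n => H n ^+ q.-1 * b n ^+ 2) l2) ->
  av (fun n => q.+1%:R * H n ^+ q * g n +
     2 * q.+1%:R * q%:R * H n ^+ q.-1 * b n ^+ 2)
     (q.+1%:R * l1 + 2 * q.+1%:R * q%:R * l2).
Proof.
move=> A1 A2; apply: avg_add.
  by apply: (avg_ext _ (avg_scale q.+1%:R A1)) => n; rewrite mulrA.
case: q A1 A2 => [|q] A1 A2.
  rewrite mulr0 mul0r; apply: (avg_ext _ avg_zero) => n.
  by rewrite !mul0r.
by apply: (avg_ext _ (avg_scale (2 * q.+2%:R * q.+1%:R) (A2 isT))) => n; rewrite mulrA.
Qed.

Let d0 : d%:R != 0 :> R. Proof. by rewrite gt_eqF. Qed.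
Let WX0 m n : 0 <= W n ^+ m. Proof. exact: exprn_ge0. Qed.
Let VX0 m n : 0 <= V n ^+ m. Proof. exact: exprn_ge0. Qed.
Let dWX0 m n : 0 <= (d%:R * W n) ^+ m. Proof. exact: exprn_ge0. Qed.

(** Since [H2] is an exact multiple of [W], the sum [A] of decrements satisfies a closed recursion
    driven by [W^(q+1) + A], whose growth the law provides. The Tauberian lemma gives the limit of
    [A / tau]; by subtraction [W^(q+1) = o(tau)]. *)
Let step2 q : (q < p)%N -> moments q ->
  av (fun n => de n * W n ^+ q.+1) (moment q.+1) /\
  (tau n)^-1 * W n ^+ q.+1 @[n --> \oo] --> 0.
Proof.
move=> qp [m1 m2].
have A1 : av (fun n => H2 n ^+ q * de n) (moment q).
  apply: (avg_sim tau_oo (x := fun n => W n ^+ q * de n)).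
  - by move=> n; rewrite mulr_ge0.
  - by apply: sim_mul => //; [exact: sim_exp|exact: sim_refl].
  - by apply: (avg_ext _ m1) => n; rewrite mulrC.
have A2 : (0 < q)%N -> av (fun n => H2 n ^+ q.-1 * b2 n ^+ 2) (moment q / d%:R).
  move=> q0; apply: (avg_sim tau_oo _ _ (m2 q0)).
  - by move=> n; rewrite mulr_ge0 // sqr_ge0.
  - apply: sim_mul => //; [by move=> n; exact: sqr_ge0|exact: sim_exp|].
    by apply: sim_refl => n; exact: sqr_ge0.
have Q := avg_law_rhs A1 A2.
set l := (X in av _ X) in Q.
have sl : sigma ^+ 2 * l = q.+1%:R * moment q.+1.
  rewrite /l /= natrD natrM; field; exact: d0.
have L := law_cvg (law2 (ltn0Sn q) qp) de0 H20 clock2.1 clock2.2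
  (ex_intro _ _ A1) Q.
rewrite sl in L.
pose A n := \sum_(0 <= k < n) (W k ^+ q.+1 - H2 k ^+ q.+1).
(* Chosen so that [W^(q+1) - H2^(q+1) = dp W^(q+1)]; it dominates [de], whence the constant 1 given
   to [tauberian]. *)
pose dp n := 1 - (1 - de n) ^+ q.+1.
have omde n : 0 <= 1 - de n <= 1.
  by case/andP: (de01 n) => a b; apply/andP; split; lra.
have dpde n : de n <= dp n <= 1.
  case/andP: (omde n) => a b; rewrite /dp.
  have e1 : (1 - de n) ^+ q.+1 <= 1 - de n.
    by rewrite exprS ler_piMr // exprn_ile1.
  by have := exprn_ge0 q.+1 a => e2; apply/andP; split; lra.
have Acvg : (tau n)^-1 * A n @[n --> \oo] --> q.+1%:R * moment q.+1.
  apply: (@tauberian R _ 1 A de dp tau (fun n => W n ^+ q.+1 + A n)) => //.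
  - by move=> n; case/andP: (dpde n) => a ->; rewrite andbT; exact: le_trans a.
  - by move=> n; rewrite mul1r; case/andP: (dpde n).
  - move=> n; rewrite /A big_nat_recr //= addrK /dp H2E exprMn; ring.
have WA : av (fun n => W n ^+ q.+1 - H2 n ^+ q.+1) (q.+1%:R * moment q.+1) by exact: Acvg.
split; last first.
  have : (tau n)^-1 * (W n ^+ q.+1 + A n) - (tau n)^-1 * A n @[n --> \oo] --> 0.
    rewrite -[X in _ --> X](subrr (q.+1%:R * moment q.+1)); apply: cvgB => //.
    apply/cvgrPdist_le => e e0.
    have := L e e0; apply: filterS2 tau_ge1 => n t1; rewrite -/(A n) => H.
    have t0 : 0 < tau n by lra.
    have -> : q.+1%:R * moment q.+1 - (tau n)^-1 * (W n ^+ q.+1 + A n) =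
       - ((tau n)^-1 * (W n ^+ q.+1 + A n - q.+1%:R * moment q.+1 * tau n)).
      by field; rewrite gt_eqF.
    by rewrite normrN normrM gtr0_norm ?invr_gt0 // mulrC ler_pdivrMr.
  by under eq_fun do rewrite -mulrBr addrK.
have S := sim_exp_diff q.+1 H20 H2W (f := de)
  (fun n => ltac:(by rewrite H2E mulrBl mul1r opprB addrC subrK)) de_cvg0.
have x0 n : 0 <= q.+1%:R * W n ^+ q.+1.-1 * (W n - H2 n).
  by rewrite mulr_ge0 ?subr_ge0 // mulr_ge0.
have y0 n : 0 <= W n ^+ q.+1 - H2 n ^+ q.+1.
  by rewrite subr_ge0; apply: lerXn2r; rewrite ?nnegrE.
have B := avg_sim tau_oo y0 (sim_sym x0 S) WA.
have := avg_scale (q.+1%:R^-1) B; rewrite mulrA mulVf ?mul1r ?pnatr_eq0 //.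
apply: avg_ext => n /=.
have -> : W n - H2 n = de n * W n by rewrite H2E; ring.
by rewrite exprS -!mulrA mulKf ?pnatr_eq0 //; ring.
Qed.

(** No Tauberian argument is available for [V], whose decrement is not a multiple of it. But
    [V^(q+1) = o(tau)] is inherited from [W], so the first law gives the averages of the decrements
    directly; these are equivalent to [(q + 1) V^q b1^2], which leads to the averages of
    [W^q b2^2]. *)
Let step1 q : (q < p)%N -> moments q ->
  [/\ av (fun n => f n * V n ^+ q) (d%:R ^+ q.+1 * moment q),
     av (fun n => V n ^+ q.+1 - H1 n ^+ q.+1)
        (q.+1%:R * d%:R ^+ q.+1 * moment q.+1) & moments q.+1].
Proof.
move=> qp mq; have [m1 m2] := mq; have [n1 Wz] := step2 qp mq.
have F1 : av (fun n => f n * V n ^+ q) (d%:R ^+ q.+1 * moment q).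
  apply: (avg_sim tau_oo (x := fun n => (d%:R * de n) * (d%:R * W n) ^+ q)).
  - by move=> n; rewrite mulr_ge0.
  - by apply: sim_mul => //; exact: sim_exp.
  - by apply: (avg_ext _ (avg_scale (d%:R ^+ q.+1) m1)) => n; rewrite exprMn exprS; ring.
have A1 : av (fun n => H1 n ^+ q * f n) (d%:R ^+ q.+1 * moment q).
  apply: (avg_sim tau_oo (x := fun n => V n ^+ q * f n)).
  - by move=> n; rewrite mulr_ge0.
  - by apply: sim_mul => //; [exact: sim_exp|exact: sim_refl].
  - by apply: (avg_ext _ F1) => n; rewrite mulrC.
have b20 n : 0 <= b1 n ^+ 2 by exact: sqr_ge0.
have A2 : (0 < q)%N -> av (fun n => H1 n ^+ q.-1 * b1 n ^+ 2) (d%:R ^+ q * moment q).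
  move=> q0.
  have E1 : av (fun n => W n ^+ q.-1 * b1 n ^+ 2) (d%:R * moment q).
    have := avg_scale (d%:R ^+ 2) (m2 q0).
    have -> : d%:R ^+ 2 * (moment q / d%:R) = d%:R * moment q by field; exact: d0.
    (* The squares [b1^2] and [d^2 b2^2] need not be equivalent; after the weight [W^(q-1)] their
       difference is small relative to [de W^q], which has bounded averages by [m1]. *)
    move=> E0; apply: (avg_perturb tau_oo E0 (z := fun n => de n * W n ^+ q)).
    - by move=> n; rewrite mulr_ge0.
    - exact: (avg_bounded tau_oo m1).
    - move=> e e0; apply: filterS (kap_small e0) => n ke.
      have -> : W n ^+ q.-1 * b1 n ^+ 2 - d%:R ^+ 2 * (W n ^+ q.-1 * b2 n ^+ 2) =
         W n ^+ q.-1 * (b1 n ^+ 2 - d%:R ^+ 2 * b2 n ^+ 2) by ring.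
      rewrite normrM ger0_norm //.
      apply: le_trans (ler_wpM2l (WX0 q.-1 n) (b1_b2 n)) _.
      have -> : W n ^+ q.-1 * (kap n * (de n * W n)) = kap n * (de n * W n ^+ q).
        by rewrite -{2}(prednK q0) exprS; ring.
      by apply: ler_wpM2r => //; rewrite mulr_ge0.
  apply: (avg_sim tau_oo (x := fun n => (d%:R * W n) ^+ q.-1 * b1 n ^+ 2)).
  - by move=> n; rewrite mulr_ge0.
  - apply: sim_mul => //; last exact: sim_refl.
    apply: (sim_trans (y := fun n => V n ^+ q.-1)) => //; exact: sim_exp.
  - apply: (avg_eq _ (avg_ext _ (avg_scale (d%:R ^+ q.-1) E1))).
      by rewrite mulrA -exprSr prednK.
    by move=> n; rewrite exprMn mulrA.
have Q := avg_law_rhs A1 A2.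
set l := (X in av _ X) in Q.
have sl : sigma ^+ 2 * l = q.+1%:R * d%:R ^+ q.+1 * moment q.+1.
  by rewrite /l /= natrD natrM [d%:R ^+ q.+1]exprS; field; exact: d0.
have L := law_cvg (law1 (ltn0Sn q) qp) fge0 H10 clock1.1 clock1.2
  (ex_intro _ _ A1) Q.
rewrite sl in L.
have Vz : (tau n)^-1 * V n ^+ q.+1 @[n --> \oo] --> 0.
  apply/cvgrPdist_le => e e0.
  (* Eventually [V <= 2 d W], so [V^(q+1) <= M W^(q+1)]. *)
  pose M := (2 * d%:R) ^+ q.+1 : R.
  have M0 : 0 < M by rewrite exprn_gt0 // mulr_gt0.
  have eM : 0 < e / M by rewrite divr_gt0.
  near=> n.
  have t0 : 0 < tau n by apply: (@lt_le_trans _ _ 1) => //; near: n.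
  have ti : 0 < (tau n)^-1 by rewrite invr_gt0.
  have A : `|0 - (tau n)^-1 * W n ^+ q.+1| <= e / M.
    by near: n; move/cvgrPdist_le : Wz; exact.
  have B : `|V n - d%:R * W n| <= 1 * (d%:R * W n) by near: n; exact: V_sim.
  have {}B : V n <= 2 * d%:R * W n by move/ler_normlP : B => [B1 B2]; lra.
  rewrite sub0r normrN ger0_norm ?mulr_ge0 ?(ltW ti) //.
  rewrite sub0r normrN ger0_norm ?mulr_ge0 ?(ltW ti) // in A.
  have C : V n ^+ q.+1 <= M * W n ^+ q.+1.
    by rewrite /M -exprMn; apply: lerXn2r; rewrite ?nnegrE // !mulr_ge0.
  have := ler_wpM2l (ltW M0) A; rewrite mulrCA [M * (e / M)]mulrC divfK ?gt_eqF //.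
  by apply: le_trans; apply: ler_wpM2l => //; exact: ltW.
have VA : av (fun n => V n ^+ q.+1 - H1 n ^+ q.+1)
    (q.+1%:R * d%:R ^+ q.+1 * moment q.+1).
  pose A n := \sum_(0 <= k < n) (V k ^+ q.+1 - H1 k ^+ q.+1).
  have : (tau n)^-1 * (V n ^+ q.+1 + A n) - (tau n)^-1 * V n ^+ q.+1 @[n --> \oo] -->
     q.+1%:R * d%:R ^+ q.+1 * moment q.+1.
    rewrite -[X in _ --> X]subr0; apply: cvgB => //.
    apply/cvgrPdist_le => e e0.
    have := L e e0; apply: filterS2 tau_ge1 => n t1; rewrite -/(A n) => H.
    have t0 : 0 < tau n by lra.
    set c := q.+1%:R * _ * _ in H *.
    have -> : c - (tau n)^-1 * (V n ^+ q.+1 + A n) =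
       - ((tau n)^-1 * (V n ^+ q.+1 + A n - c * tau n)).
      by field; rewrite gt_eqF.
    by rewrite normrN normrM gtr0_norm ?invr_gt0 // mulrC ler_pdivrMr.
  by under eq_fun do rewrite -mulrBr addrC addKr.
split=> //; split=> // _; rewrite [q.+1.-1]/=.
have VHB n : 0 <= V n - H1 n by rewrite subr_ge0.
have S := sim_exp_diff q.+1 H10 H1V VH1 f0; rewrite [q.+1.-1]/= in S.
have x0 n : 0 <= q.+1%:R * V n ^+ q * (V n - H1 n) by rewrite mulr_ge0 // mulr_ge0.
have y0 n : 0 <= V n ^+ q.+1 - H1 n ^+ q.+1.
  by rewrite subr_ge0; apply: lerXn2r; rewrite ?nnegrE.
have B := avg_sim tau_oo y0 (sim_sym x0 S) VA.
have B1 : av (fun n => V n ^+ q * (V n - H1 n)) (d%:R ^+ q.+1 * moment q.+1).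
  have := avg_scale (q.+1%:R^-1) B; rewrite !mulrA mulVf ?mul1r ?pnatr_eq0 //.
  by apply: avg_ext => n /=; rewrite !mulrA mulVf ?mul1r ?pnatr_eq0.
have B2 : av (fun n => V n ^+ q * b1 n ^+ 2) (d%:R ^+ q.+1 * moment q.+1).
  apply: (avg_sim tau_oo _ _ B1); first by move=> n; rewrite mulr_ge0.
  by apply: sim_mul => //; exact: sim_refl.
have B3 : av (fun n => (d%:R * W n) ^+ q * b1 n ^+ 2) (d%:R ^+ q.+1 * moment q.+1).
  apply: (avg_sim tau_oo _ _ B2); first by move=> n; rewrite mulr_ge0.
  apply: sim_mul => //; last exact: sim_refl.
  by apply: sim_sym => //; exact: sim_exp.
have B4 : av (fun n => W n ^+ q * b1 n ^+ 2) (d%:R * moment q.+1).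
  apply: (avg_eq _ (avg_ext _ (avg_scale (d%:R ^- q) B3))).
    by rewrite exprSr; field; rewrite expf_neq0 // d0.
  by move=> n /=; rewrite exprMn !mulrA mulVf ?mul1r // expf_neq0.
have B5 : av (fun n => d%:R ^+ 2 * (W n ^+ q * b2 n ^+ 2)) (d%:R * moment q.+1).
  apply: (avg_perturb tau_oo B4 (z := fun n => de n * W n ^+ q.+1)).
  - by move=> n; rewrite mulr_ge0.
  - exact: (avg_bounded tau_oo n1).
  - move=> e e0; apply: filterS (kap_small e0) => n ke.
    have -> : d%:R ^+ 2 * (W n ^+ q * b2 n ^+ 2) - W n ^+ q * b1 n ^+ 2 =
       - (W n ^+ q * (b1 n ^+ 2 - d%:R ^+ 2 * b2 n ^+ 2)) by ring.
    rewrite normrN normrM ger0_norm //.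
    apply: le_trans (ler_wpM2l (WX0 q n) (b1_b2 n)) _.
    have -> : W n ^+ q * (kap n * (de n * W n)) = kap n * (de n * W n ^+ q.+1).
      by rewrite exprS; ring.
    by apply: ler_wpM2r => //; rewrite mulr_ge0.
apply: (avg_eq _ (avg_ext _ (avg_scale (d%:R ^- 2) B5))).
  by field; exact: d0.
by move=> n /=; rewrite mulKf // expf_neq0.
Unshelve. all: by end_near. Qed.

Lemma moment_limits q : (0 < q)%N -> (q <= p)%N ->
  avg tau (fun n => f n * V n ^+ q) (d%:R ^+ q.+1 * moment q) /\
  avg tau (fun n => V n ^+ q - H1 n ^+ q) (q%:R * d%:R ^+ q * moment q).
Proof.
have M : forall m, (m <= p)%N -> moments m.
  elim=> [_|m IH mp]; first exact: moments0.
  by have [_ _] := step1 mp (IH (ltnW mp)).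
case: q => [//|q] _ qp; have [_ B m1] := step1 qp (M q (ltnW qp)); split => //.
have [m2 _] := m1.
(* [step1] yields the average of [f V^q] only for exponents below [p]; the last one is read off from
   [moments]. *)
apply: (avg_sim tau_oo (x := fun n => (d%:R * de n) * (d%:R * W n) ^+ q.+1)).
- by move=> n; rewrite mulr_ge0.
- by apply: sim_mul => //; exact: sim_exp.
- by apply: (avg_ext _ (avg_scale (d%:R ^+ q.+2) m2)) => n; rewrite exprMn [d%:R ^+ q.+2]exprS; ring.
Qed.

End moment_recursion.

(** * Quadratic forms and rank-one updates *)

Section quadratic_forms.
Context {R : realType} {d : nat}.
Implicit Types (A B S Q : 'M[R]_d) (u v x : 'cV[R]_d).

Definition bilin A u v : R := (u^T *m A *m v) 0 0.

Lemma bilinE A u v : bilin A u v = \sum_i \sum_j u i 0 * A i j * v j 0.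
Proof.
rewrite /bilin mxE exchange_big /=; apply: eq_bigr => j _.
by rewrite mxE mulr_suml; apply: eq_bigr => i _; rewrite mxE.
Qed.

Lemma quad_formE A v : quad_form A v = bilin A v v. Proof. by []. Qed.

Lemma bilinDl A u v x : bilin A (u + v) x = bilin A u x + bilin A v x.
Proof. by rewrite /bilin linearD /= !mulmxDl mxE. Qed.

Lemma bilinDr A u v x : bilin A x (u + v) = bilin A x u + bilin A x v.
Proof. by rewrite /bilin mulmxDr mxE. Qed.

Lemma bilinZl A (c : R) u v : bilin A (c *: u) v = c * bilin A u v.
Proof. by rewrite /bilin linearZ /= -!scalemxAl mxE. Qed.

Lemma bilinZr A (c : R) u v : bilin A u (c *: v) = c * bilin A u v.
Proof. by rewrite /bilin -scalemxAr mxE. Qed.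

Lemma bilinZ (c : R) A u v : bilin (c *: A) u v = c * bilin A u v.
Proof. by rewrite /bilin -scalemxAr -scalemxAl mxE. Qed.

Lemma bilinD A B u v : bilin (A + B) u v = bilin A u v + bilin B u v.
Proof. by rewrite /bilin mulmxDr mulmxDl mxE. Qed.

Lemma bilinB A B u v : bilin (A - B) u v = bilin A u v - bilin B u v.
Proof. by rewrite /bilin mulmxBr mulmxBl !mxE. Qed.

Lemma bilinC A u v : A^T = A -> bilin A u v = bilin A v u.
Proof.
move=> AT; rewrite !bilinE exchange_big /=; apply: eq_bigr => i _.
by apply: eq_bigr => j _; rewrite -{1}AT mxE; ring.
Qed.

Lemma quad_formDZ A u v (c : R) : A^T = A ->
  quad_form A (u + c *: v) =
  quad_form A u + 2 * c * bilin A v u + c ^+ 2 * quad_form A v.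
Proof.
move=> AT; rewrite !quad_formE bilinDl !bilinDr !bilinZl !bilinZr.
by rewrite (bilinC u v AT); ring.
Qed.

Lemma cauchy_schwarz A u v : A^T = A -> (forall x, 0 <= quad_form A x) ->
  bilin A u v ^+ 2 <= quad_form A u * quad_form A v.
Proof.
move=> AT A0; set b := bilin A u v.
have E c : 0 <= quad_form A u + 2 * c * b + c ^+ 2 * quad_form A v.
  by rewrite /b (bilinC _ _ AT) -quad_formDZ.
have u0 := A0 u; have v0 := A0 v.
have [qv|qv] := eqVneq (quad_form A v) 0.
  have [->|bn] := eqVneq b 0; first by rewrite expr0n /= mulr_ge0.
  (* When [v] is isotropic the quadratic polynomial in [c] is affine; this [c] gives it the value -1
     unless [b = 0]. *)
  have := E (- (quad_form A u + 1) / (2 * b)); rewrite qv mulr0 addr0.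
  have -> : quad_form A u + 2 * (- (quad_form A u + 1) / (2 * b)) * b = -1.
    by field.
  by rewrite oppr_ge0 ler10.
have vp : 0 < quad_form A v by rewrite lt_neqAle eq_sym qv.
have := E (- b / quad_form A v).
have -> : quad_form A u + 2 * (- b / quad_form A v) * b +
   (- b / quad_form A v) ^+ 2 * quad_form A v =
   quad_form A u - b ^+ 2 / quad_form A v by field.
by rewrite subr_ge0 ler_pdivrMr.
Qed.

Lemma posdef_ge0 A v : sym_posdef A -> 0 <= quad_form A v.
Proof.
move=> [_ A0]; have [->|/A0 /ltW //] := eqVneq v 0.
by rewrite quad_formE /bilin mulmx0 mxE.
Qed.

Lemma posdef_unit A : sym_posdef A -> A \in unitmx.
Proof.
move=> [AT A0]; rewrite unitmxE unitfE; apply/negP => /det0P[v v0 vA].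
have vT0 : v^T != 0 by rewrite -(inj_eq trmx_inj) trmxK trmx0.
by have := A0 _ vT0; rewrite quad_formE /bilin trmxK vA mul0mx mxE ltxx.
Qed.

Lemma posdef_inv A : sym_posdef A -> sym_posdef (invmx A).
Proof.
move=> Apd; have Au := posdef_unit Apd; have [AT A0] := Apd.
split=> [|v v0]; first by rewrite trmx_inv AT.
have w0 : invmx A *m v != 0.
  by apply: contra_neq v0 => /(congr1 (mulmx A)); rewrite mulmxA mulmxV // mul1mx mulmx0.
have := A0 _ w0; rewrite !quad_formE /bilin trmx_mul trmx_inv AT.
by rewrite -!mulmxA [A *m (_ *m _)]mulmxA mulmxV // mul1mx mulmxA.
Qed.

Lemma posdef_rank1 A v : sym_posdef A -> sym_posdef (A + v *m v^T).
Proof.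
move=> [AT A0]; split=> [|x x0]; first by rewrite linearD /= trmx_mul trmxK AT.
rewrite quad_formE bilinD ltr_wpDr //; last exact: A0.
have -> : bilin (v *m v^T) x x = ((x^T *m v) 0 0) ^+ 2.
  rewrite /bilin -!mulmxA mulmxA [LHS]mxE big_ord1 expr2; congr (_ * _).
  by rewrite -[v^T *m x]trmxK trmx_mul trmxK mxE.
exact: sqr_ge0.
Qed.

(** By Cauchy-Schwarz against the basis vectors, a vector isotropic for a positive semidefinite
    matrix lies in its kernel, which invertibility makes trivial. *)
Lemma psd_unit_posdef A : A^T = A -> A \in unitmx ->
  (forall x, 0 <= quad_form A x) -> sym_posdef A.
Proof.
move=> AT Au A0; split=> // v v0; rewrite lt_neqAle A0 andbT eq_sym.
apply/eqP => qv.
have Av : A *m v = 0.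
  apply/matrixP => i j; rewrite (ord1 j) [RHS]mxE.
  have := cauchy_schwarz (delta_mx i 0) v AT A0; rewrite qv mulr0 => b0.
  have : bilin A (delta_mx i 0) v = 0.
    by apply/eqP; rewrite -sqrf_eq0 eq_le b0 sqr_ge0.
  by rewrite /bilin trmx_delta -mulmxA -rowE mxE.
by move/negP: v0; apply; rewrite -[v]mul1mx -(mulVmx Au) -mulmxA Av mulmx0.
Qed.

(** A coordinate is the inner product, for the inverse of [S], of [v] with the [i]-th column of [S],
    whose squared norm is [S i i]. *)
Lemma coord_sqr_le S v i : sym_posdef S ->
  v i 0 ^+ 2 <= S i i * quad_form (invmx S) v.
Proof.
move=> Spd; have Su := posdef_unit Spd; have [ST _] := Spd.
have Ipd := posdef_inv Spd.
have -> : v i 0 = bilin (invmx S) (S *m delta_mx i 0) v.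
  rewrite /bilin trmx_mul ST trmx_delta -!mulmxA mulKVmx //.
  by rewrite -rowE mxE.
apply: le_trans (cauchy_schwarz _ _ (proj1 Ipd) (fun x => posdef_ge0 x Ipd)) _.
apply: ler_wpM2r; first exact: posdef_ge0.
rewrite quad_formE /bilin trmx_mul ST trmx_delta -!mulmxA mulKmx //.
by rewrite -rowE -colE !mxE.
Qed.

(** It converts entrywise smallness of [E] into smallness relative to the form of [S^-1], uniformly
    in [u] and [v]: each coordinate is bounded by [coord_sqr_le], with [S i i] at most the trace. *)
Lemma bilin_entry_bound E S u v : sym_posdef S ->
  bilin E u v ^+ 2 <= (\tr S * \sum_i \sum_j `|E i j|) ^+ 2 *
    (quad_form (invmx S) u * quad_form (invmx S) v).
Proof.
move=> Spd; have Ipd := posdef_inv Spd.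
have [ST S0] := Spd.
have Sii i : 0 <= S i i.
  have := posdef_ge0 (delta_mx i 0) Spd.
  by rewrite quad_formE /bilin trmx_delta -mulmxA -rowE -colE !mxE.
have Str i : S i i <= \tr S.
  by rewrite /mxtrace (bigD1 i) //= lerDl sumr_ge0.
have qu := posdef_ge0 u Ipd; have qv := posdef_ge0 v Ipd.
have tr0 : 0 <= \tr S by rewrite /mxtrace sumr_ge0.
have nE : `|bilin E u v| <= \tr S * (\sum_i \sum_j `|E i j|) *
   Num.sqrt (quad_form (invmx S) u * quad_form (invmx S) v).
  rewrite bilinE; apply: le_trans (ler_norm_sum _ _ _) _.
  rewrite mulr_sumr mulr_suml; apply: ler_sum => i _.
  apply: le_trans (ler_norm_sum _ _ _) _.
  rewrite mulr_sumr mulr_suml; apply: ler_sum => j _.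
  have coord (y : 'cV[R]_d) k : `|y k 0| <= Num.sqrt (\tr S * quad_form (invmx S) y).
    rewrite -sqrtr_sqr; apply: ler_wsqrtr; apply: le_trans (coord_sqr_le y k Spd) _.
    by apply: ler_wpM2r => //; exact: posdef_ge0.
  rewrite !normrM mulrAC.
  have -> : \tr S * `|E i j| * Num.sqrt (quad_form (invmx S) u * quad_form (invmx S) v)
    = Num.sqrt (\tr S * quad_form (invmx S) u) * Num.sqrt (\tr S * quad_form (invmx S) v)
      * `|E i j|.
    rewrite !sqrtrM // -[in LHS](sqr_sqrtr tr0); ring.
  apply: ler_wpM2r => //; apply: ler_pM => //; exact: coord.
rewrite -[leLHS]real_normK ?num_real //.
have := @lerXn2r _ 2 `|bilin E u v| _ _ _ nE; rewrite !nnegrE => /(_ _ _) H.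
apply: le_trans (H _ _) _ => //.
  rewrite mulr_ge0 ?sqrtr_ge0 // mulr_ge0 // sumr_ge0 // => i _; exact: sumr_ge0.
by rewrite exprMn sqr_sqrtr // mulr_ge0.
Qed.

(* The rank-one update of the inverse, in the form of the identities
   [b' = b (1 + h)] and [V - H = b b'], which avoid the explicit inverse. *)
Lemma rank1_update A v x : sym_posdef A ->
  let A' := A + v *m v^T in
  let f := quad_form (invmx A') v in
  let b := bilin (invmx A') v x in
  [/\ 0 <= f < 1, b ^+ 2 = (1 - f) * (quad_form (invmx A) x - quad_form (invmx A') x),
      quad_form (invmx A') x <= quad_form (invmx A) x,
      quad_form (invmx A) x - quad_form (invmx A') x <= f * quad_form (invmx A) x &
      b ^+ 2 <= f * quad_form (invmx A') x].
Proof.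
move=> Apd A' f b.
have A'pd : sym_posdef A' by exact: posdef_rank1.
have Au := posdef_unit Apd; have A'u := posdef_unit A'pd.
have Ipd := posdef_inv Apd; have I'pd := posdef_inv A'pd.
have IT := proj1 Ipd; have I'T := proj1 I'pd.
have diff (y : 'cV[R]_d) : invmx A *m y - invmx A' *m y =
    bilin (invmx A') v y *: (invmx A *m v).
  apply: (can_inj (mulKmx Au)); rewrite mulmxBr mulKVmx // -scalemxAr mulKVmx //.
  have -> : A *m (invmx A' *m y) = y - v *m (v^T *m (invmx A' *m y)).
    have -> : A = A' - v *m v^T by rewrite /A' addrK.
    by rewrite mulmxBl mulKVmx // -!mulmxA.
  rewrite opprB addrC subrK.
  apply/matrixP => i j; rewrite (ord1 j) !mxE big_ord1 mulrC; congr (_ * _).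
  by rewrite /bilin mulmxA.
pose h := quad_form (invmx A) v.
have h0 : 0 <= h by exact: posdef_ge0.
have bE (y z : 'cV[R]_d) : bilin (invmx A) z y - bilin (invmx A') z y =
    bilin (invmx A') v y * bilin (invmx A) z v.
  rewrite -bilinB /bilin -mulmxA mulmxBl diff -scalemxAr mxE.
  by rewrite mulmxA.
have fh : h = f * (1 + h) by have := bE v v; rewrite -!quad_formE -/h -/f; lra.
have bh : bilin (invmx A) v x = b * (1 + h).
  by have := bE x v; rewrite -quad_formE -/h -/b; lra.
have Bh : quad_form (invmx A) x - quad_form (invmx A') x = b ^+ 2 * (1 + h).
  by rewrite !quad_formE bE -/b (bilinC x v IT) bh; ring.
have h1 : 0 < 1 + h by rewrite ltr_pwDl.
have fE : f = h / (1 + h) by rewrite {1}fh mulfK // gt_eqF.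
have f1 : 1 - f = (1 + h)^-1 by rewrite fE; field; rewrite gt_eqF.
split.
- apply/andP; split; first by rewrite fE divr_ge0 // ltW.
  by rewrite -subr_gt0 f1 invr_gt0.
- by rewrite f1 Bh mulrC mulfK // gt_eqF.
- by rewrite -subr_ge0 Bh mulr_ge0 ?sqr_ge0 // ltW.
- have := cauchy_schwarz v x IT (fun y => posdef_ge0 y Ipd).
  rewrite bh -/h => H.
  have -> : quad_form (invmx A) x - quad_form (invmx A') x = (b * (1 + h)) ^+ 2 / (1 + h).
    by rewrite Bh; field; rewrite gt_eqF.
  by rewrite ler_pdivrMr // fE mulrAC divfK ?gt_eqF.
- exact: cauchy_schwarz v x I'T (fun y => posdef_ge0 y I'pd).
Qed.

End quadratic_forms.

(** * Continuity of determinants and inverses *)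

Section matrix_limits.
Context {R : realType}.

Lemma cvg_sum_realfun {I J : Type} (F : set_system I) {FF : Filter F} (s : seq J)
    (f : J -> I -> R) (l : J -> R) :
  (forall j, f j x @[x --> F] --> l j) ->
  \sum_(j <- s) f j x @[x --> F] --> \sum_(j <- s) l j.
Proof.
move=> fl; elim: s => [|j s IH].
  by rewrite big_nil; under eq_fun do rewrite big_nil; exact: cvg_cst.
by rewrite big_cons; under eq_fun do rewrite big_cons; exact: cvgD.
Qed.

Lemma cvg_prod_realfun {I J : Type} (F : set_system I) {FF : Filter F} (s : seq J)
    (f : J -> I -> R) (l : J -> R) :
  (forall j, f j x @[x --> F] --> l j) ->
  \prod_(j <- s) f j x @[x --> F] --> \prod_(j <- s) l j.
Proof.
move=> fl; elim: s => [|j s IH].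
  by rewrite big_nil; under eq_fun do rewrite big_nil; exact: cvg_cst.
by rewrite big_cons; under eq_fun do rewrite big_cons; exact: cvgM.
Qed.

Lemma det_cvg {I : Type} (F : set_system I) {FF : Filter F} n
    (A : I -> 'M[R]_n) (B : 'M[R]_n) :
  (forall i j, A x i j @[x --> F] --> B i j) ->
  \det (A x) @[x --> F] --> \det B.
Proof.
move=> AB; apply: cvg_sum_realfun => s.
by apply: cvgMr; exact: cvg_prod_realfun.
Qed.

Lemma invmx_entry n (A : 'M[R]_n) i j : A \in unitmx ->
  invmx A i j = (\det A)^-1 * ((-1) ^+ (j + i) * \det (row' j (col' i A))).
Proof. by move=> Au; rewrite /invmx Au !mxE. Qed.

Lemma invmx_cvg {I : Type} (F : set_system I) {FF : Filter F} n
    (A : I -> 'M[R]_n) (B : 'M[R]_n) :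
  (forall x, A x \in unitmx) -> B \in unitmx ->
  (forall i j, A x i j @[x --> F] --> B i j) ->
  forall i j, invmx (A x) i j @[x --> F] --> invmx B i j.
Proof.
move=> Au Bu AB i j; rewrite (invmx_entry _ _ Bu).
under eq_fun do rewrite invmx_entry //.
apply: cvgM.
  by apply: cvgV; [rewrite -unitfE -unitmxE|exact: det_cvg].
apply: cvgMr; apply: det_cvg => k l; rewrite !mxE.
by under eq_fun do rewrite !mxE; exact: AB.
Qed.

(** The segment from the identity to [A] stays among positive definite matrices, where the
    determinant does not vanish; it equals 1 at the start, so by the intermediate value theorem it
    stays positive. *)
Lemma posdef_det_gt0 n (A : 'M[R]_n) : sym_posdef A -> 0 < \det A.
Proof.
move=> Apd; have [AT A0] := Apd.
pose h (t : R) : 'M[R]_n := t *: A + (1 - t) *: 1%:M.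
have hpd t : 0 <= t <= 1 -> sym_posdef (h t).
  move=> /andP[t0 t1]; split=> [|v v0].
    by rewrite /h linearD !linearZ /= AT trmx1.
  rewrite quad_formE bilinD !bilinZ.
  have v1 : 0 < bilin 1%:M v v.
    have [i vi] : exists i, v i 0 != 0.
      apply/not_existsP => H; move/negP: v0; apply; apply/eqP/matrixP => i j.
      by rewrite (ord1 j) [RHS]mxE; apply/eqP; apply: contrapT => /negP; exact: H.
    rewrite /bilin mulmx1 mxE (bigD1 i) //= mxE.
    apply: ltr_pwDl; first by rewrite -expr2 exprn_even_gt0.
    by apply: sumr_ge0 => j _; rewrite mxE -expr2 sqr_ge0.
  have v2 : 0 < bilin A v v by exact: A0.
  have [->|tn] := eqVneq t 0; first by rewrite mul0r add0r subr0 mul1r.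
  apply: ltr_pwDl; first by rewrite mulr_gt0 // lt_neqAle eq_sym tn.
  by rewrite mulr_ge0 ?subr_ge0 // ltW.
have dh t : 0 <= t <= 1 -> \det (h t) != 0.
  by move=> /hpd /posdef_unit; rewrite unitmxE unitfE.
have h0 : \det (h 0) = 1 by rewrite /h scale0r add0r subr0 scale1r det1.
have h1 : \det (h 1) = \det A by rewrite /h subrr scale0r addr0 scale1r.
have hc : {within `[0, 1], continuous (fun t => \det (h t))}.
  apply: continuous_subspaceT => t; apply: det_cvg => i j.
  rewrite !mxE; under eq_fun do rewrite !mxE.
  apply: cvgD; apply: cvgM; try exact: cvg_cst; first exact: cvg_id.
  by apply: cvgB; [exact: cvg_cst|exact: cvg_id].
rewrite ltNge; apply/negP => dA.
have [|c] := IVT (v := 0) (ler01 : 0 <= 1 :> R) hc.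
  by rewrite h0 h1 ge_min dA orbT le_max ler01.
by rewrite in_itv /= => /dh; move=> + /eqP dc; rewrite dc.
Qed.

End matrix_limits.

Arguments invmx_cvg {R I F FF n A B} _ _ _ i j.

Section matrix_measurability.
Context {disp : measure_display} {T : measurableType disp} {R : realType}.
Variable G : set (set T).

Definition mx_measurable_wrt m n (A : T -> 'M[R]_(m, n)) :=
  forall i j, measurable_wrt G (fun w => A w i j).

Lemma mx_measurable_cst m n (A : 'M[R]_(m, n)) : mx_measurable_wrt (fun=> A).
Proof. by move=> i j; exact: measurable_cst. Qed.

Lemma mx_measurableD m n (A B : T -> 'M[R]_(m, n)) :
  mx_measurable_wrt A -> mx_measurable_wrt B ->
  mx_measurable_wrt (fun w => A w + B w).
Proof.
move=> mA mB i j; rewrite (_ : (fun w => _) = (fun w => A w i j + B w i j)).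
  by apply: measurable_funD; [exact: mA|exact: mB].
by apply/funext => w; rewrite mxE.
Qed.

Lemma mx_measurableM m n p (A : T -> 'M[R]_(m, n)) (B : T -> 'M[R]_(n, p)) :
  mx_measurable_wrt A -> mx_measurable_wrt B ->
  mx_measurable_wrt (fun w => A w *m B w).
Proof.
move=> mA mB i j; rewrite (_ : (fun w => _) = (fun w => \sum_k A w i k * B w k j)).
  by apply: measurable_sum => k; apply: measurable_funM; [exact: mA|exact: mB].
by apply/funext => w; rewrite mxE.
Qed.

Lemma mx_measurableZ m n (c : T -> R) (A : T -> 'M[R]_(m, n)) :
  measurable_wrt G c -> mx_measurable_wrt A ->
  mx_measurable_wrt (fun w => c w *: A w).
Proof.
move=> mc mA i j; rewrite (_ : (fun w => _) = (fun w => c w * A w i j)).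
  by apply: measurable_funM; [exact: mc|exact: mA].
by apply/funext => w; rewrite mxE.
Qed.

Lemma mx_measurable_tr m n (A : T -> 'M[R]_(m, n)) :
  mx_measurable_wrt A -> mx_measurable_wrt (fun w => (A w)^T).
Proof.
move=> mA i j; rewrite (_ : (fun w => _) = (fun w => A w j i)); first exact: mA.
by apply/funext => w; rewrite mxE.
Qed.

Lemma measurable_det n (A : T -> 'M[R]_n) :
  mx_measurable_wrt A -> measurable_wrt G (fun w => \det (A w)).
Proof.
move=> mA; apply: measurable_sum => s.
apply: measurable_funM; first exact: measurable_cst.
by apply: measurable_prod => i _; exact: mA.
Qed.

Lemma mx_measurable_inv n (A : T -> 'M[R]_n) :
  (forall w, A w \in unitmx) -> mx_measurable_wrt A ->
  mx_measurable_wrt (fun w => invmx (A w)).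
Proof.
move=> Au mA i j.
rewrite (_ : (fun w => _) = (fun w => (\det (A w))^-1 *
    ((-1) ^+ (j + i) * \det (row' j (col' i (A w)))))); last first.
  by apply/funext => w; rewrite invmx_entry.
apply: measurable_funM.
  by apply: measurable_inv_realfun; exact: measurable_det.
apply: measurable_funM; first exact: measurable_cst.
apply: measurable_det => k l.
by rewrite (_ : (fun w => _) = (fun w => A w (lift j k) (lift i l))) //;
  apply/funext => w; rewrite !mxE.
Qed.

Lemma measurable_bilin n (A : T -> 'M[R]_n) (u v : T -> 'cV[R]_n) :
  mx_measurable_wrt A -> mx_measurable_wrt u -> mx_measurable_wrt v ->
  measurable_wrt G (fun w => bilin (A w) (u w) (v w)).
Proof.
move=> mA mu mv; apply: mx_measurableM => //; apply: mx_measurableM => //.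
exact: mx_measurable_tr.
Qed.

End matrix_measurability.

(** * Comparison of the two normalisations *)

Section normalised_path.
Context {R : realType} {d : nat}.
Variables (S L : 'M[R]_d) (phi m : nat -> 'cV[R]_d).
Hypothesis Spd : sym_posdef S.
Hypothesis Lpd : sym_posdef L.
Hypothesis d_ge1 : (1 <= d)%N.

(* [gram n] is [S_(n-1)], with [gram 0 = S]: it is the matrix known when [m n] is. *)
Definition gram n : 'M[R]_d := \sum_(0 <= k < n) (phi k *m (phi k)^T) + S.
Definition scale n : R := 1 + \sum_(0 <= k < n) quad_form (invmx L) (phi k).

Definition gramV n := quad_form (invmx (gram n)) (m n).
Definition gramH n := quad_form (invmx (gram n.+1)) (m n).
Definition gramb n := bilin (invmx (gram n.+1)) (phi n) (m n).
Definition gramf n := quad_form (invmx (gram n.+1)) (phi n).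

Definition scaleV n := quad_form (invmx L) (m n) / scale n.
Definition scaleH n := quad_form (invmx L) (m n) / scale n.+1.
Definition scaleb n := bilin (invmx L) (phi n) (m n) / scale n.+1.
Definition scalef n := quad_form (invmx L) (phi n) / scale n.+1.

Let Qpd : sym_posdef (invmx L). Proof. exact: posdef_inv. Qed.
Let q0 v : 0 <= quad_form (invmx L) v. Proof. exact: posdef_ge0. Qed.

Lemma gramS n : gram n.+1 = gram n + phi n *m (phi n)^T.
Proof. by rewrite /gram big_nat_recr //= addrAC. Qed.

Lemma gram_posdef n : sym_posdef (gram n).
Proof.
elim: n => [|n IH]; first by rewrite /gram big_geq // add0r.
by rewrite gramS; exact: posdef_rank1.
Qed.

Lemma scaleS n : scale n.+1 = scale n + quad_form (invmx L) (phi n).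
Proof. by rewrite /scale big_nat_recr //= addrA. Qed.

Lemma scale_ge1 n : 1 <= scale n.
Proof. by rewrite /scale lerDl sumr_ge0. Qed.

Lemma scale_gt0 n : 0 < scale n. Proof. exact: lt_le_trans (scale_ge1 n). Qed.

Lemma gram_scheme n :
  [/\ 0 <= gramf n < 1, gramb n ^+ 2 = (1 - gramf n) * (gramV n - gramH n),
      gramH n <= gramV n, gramV n - gramH n <= gramf n * gramV n &
      gramb n ^+ 2 <= gramf n * gramH n].
Proof.
rewrite /gramf /gramb /gramV /gramH gramS.
exact: (rank1_update (phi n) (m n) (gram_posdef n)).
Qed.

Lemma gramH_ge0 n : 0 <= gramH n.
Proof. exact: posdef_ge0 (posdef_inv (gram_posdef n.+1)). Qed.

Lemma scaleV_ge0 n : 0 <= scaleV n.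
Proof. by apply: divr_ge0 => //; exact: ltW (scale_gt0 n). Qed.

Lemma scalefE n : scalef n = (scale n.+1 - scale n) / scale n.+1.
Proof. by rewrite scaleS addrC addKr /scalef scaleS. Qed.

Lemma scale_scheme n :
  [/\ 0 <= scalef n < 1, scaleH n = (1 - scalef n) * scaleV n,
      0 <= scaleH n & scaleb n ^+ 2 <= scalef n * scaleH n].
Proof.
have s0 := scale_gt0 n; have s1 := scale_gt0 n.+1.
split.
- rewrite /scalef divr_ge0 ?(ltW s1) //= ltr_pdivrMr // mul1r scaleS.
  by rewrite ltrDr.
- by rewrite scalefE /scaleH /scaleV; field; rewrite !gt_eqF.
- by rewrite /scaleH divr_ge0 // ltW.
- have H := cauchy_schwarz (phi n) (m n) (proj1 Qpd) q0.
  rewrite /scaleb /scalef /scaleH exprMn -[X in _ <= X]mulrACA -expr2.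
  apply: ler_wpM2r => //; exact: sqr_ge0.
Qed.

Variable alpha : nat -> R.
Hypothesis alpha_gt0 : forall n, 0 < alpha n.
Hypothesis alpha_oo : alpha n @[n --> \oo] --> +oo.
Hypothesis gram_cvg : forall i j,
  ((alpha n)^-1 *: gram n.+1) i j @[n --> \oo] --> L i j.
Hypothesis f_cvg0 : gramf n @[n --> \oo] --> 0.

Let Lu := posdef_unit Lpd.

Let alphaV_cvg0 : (alpha n)^-1 @[n --> \oo] --> 0.
Proof. by apply/(gtr0_cvgV0 _) => //; apply: nearW. Qed.

Let tr_quad (Q : 'M[R]_d) (v : 'cV[R]_d) : quad_form Q v = \tr (Q *m (v *m v^T)).
Proof. by rewrite mulmxA mxtrace_mulC mulmxA /quad_form /mxtrace big_ord1. Qed.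

(** Up to a constant, [scale] is the trace of [L^-1 gram]. Divided by [alpha] it tends to the trace
    of the identity, which is where the factor [d] between the two normalisations arises. *)
Let scale_tr n : scale n = 1 - \tr (invmx L *m S) + \tr (invmx L *m gram n).
Proof.
rewrite /scale /gram mulmxDr [\tr (_ + _)]linearD /= mulmx_sumr.
rewrite [\tr (\sum_(_ <= _ < _) _)]linear_sum /=.
under eq_bigr do rewrite tr_quad.
ring.
Qed.

Let scale_alpha : (alpha n)^-1 * scale n.+1 @[n --> \oo] --> (d%:R : R).
Proof.
have trE : \tr (invmx L *m L) = d%:R by rewrite mulVmx // mxtrace1.
have : (alpha n)^-1 * (1 - \tr (invmx L *m S)) +
    \tr (invmx L *m ((alpha n)^-1 *: gram n.+1)) @[n --> \oo] --> 
    0 * (1 - \tr (invmx L *m S)) + \tr (invmx L *m L).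
  apply: cvgD; first by apply: cvgM => //; exact: cvg_cst.
  apply: cvg_sum_realfun => i; rewrite mxE; under eq_fun do rewrite mxE.
  by apply: cvg_sum_realfun => j; apply: cvgMr; exact: gram_cvg.
rewrite mul0r add0r trE; apply: cvg_trans; apply: near_eq_cvg.
apply: nearW => n /=; rewrite scale_tr -scalemxAr [\tr (_ *: _)]linearZ /=; ring.
Qed.

Let dR : 0 < d%:R :> R. Proof. by rewrite ltr0n. Qed.

(** The convergence is freed from [alpha]: its normaliser is now [scale], which depends only on the
    vectors [phi]. *)
Let gram_scale i j : ((scale n.+1)^-1 *: gram n.+1) i j @[n --> \oo] -->
  (d%:R^-1 *: L) i j.
Proof.
have -> : (fun n => ((scale n.+1)^-1 *: gram n.+1) i j) =
    (fun n => ((alpha n)^-1 * scale n.+1)^-1 * ((alpha n)^-1 *: gram n.+1) i j).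
  apply/funext => n; rewrite !mxE; field.
  by rewrite !gt_eqF // scale_gt0.
rewrite mxE; apply: cvgM => //; apply: cvgV => //; exact: lt0r_neq0.
Qed.

Definition inverse_error n : 'M[R]_d :=
  scale n *: invmx (gram n) - d%:R *: invmx L.

Let dLu : d%:R^-1 *: L \in unitmx.
Proof. by rewrite unitmxZ // unitfE invr_eq0 gt_eqF. Qed.

Let inverse_error_cvg i j : inverse_error n i j @[n --> \oo] --> 0.
Proof.
have iu n : (scale n.+1)^-1 *: gram n.+1 \in unitmx.
  rewrite unitmxZ ?unitfE ?invr_eq0 ?gt_eqF ?scale_gt0 //.
  exact: posdef_unit (gram_posdef _).
have H := invmx_cvg iu dLu gram_scale i j.
suff Hlim : inverse_error n.+1 i j @[n --> \oo] --> (0 : R).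
  by rewrite -(cvg_shiftS (fun n => inverse_error n i j)).
have -> : (fun n => inverse_error n.+1 i j) =
   (fun n => invmx ((scale n.+1)^-1 *: gram n.+1) i j - invmx (d%:R^-1 *: L) i j).
  apply/funext => n; rewrite /inverse_error !mxE.
  rewrite invmxZ; last by exact: iu.
  by rewrite invmxZ // !mxE !invrK.
rewrite -[X in _ --> X](subrr (invmx (d%:R^-1 *: L) i j)).
by apply: cvgB; [exact: H|exact: cvg_cst].
Qed.

Let kap1 n := \tr L * \sum_i \sum_j `|inverse_error n i j|.

Let kap1_cvg : kap1 n @[n --> \oo] --> 0.
Proof.
have -> : 0 = \tr L * \sum_(i : 'I_d) \sum_(j : 'I_d) `|(0 : R)|.
  by rewrite normr0 big1 ?mulr0 // => i _; rewrite big1.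
apply: cvgMr; apply: cvg_sum_realfun => i; apply: cvg_sum_realfun => j.
by apply: cvg_norm; exact: inverse_error_cvg.
Qed.

Let kap1_ge0 n : 0 <= kap1 n.
Proof.
apply: mulr_ge0; last by apply: sumr_ge0 => i _; exact: sumr_ge0.
apply: sumr_ge0 => i _.
have := posdef_ge0 (delta_mx i 0) Lpd.
by rewrite quad_formE /bilin trmx_delta -mulmxA -rowE -colE !mxE.
Qed.

Let bilin_error n u v : bilin (invmx (gram n)) u v - d%:R * (bilin (invmx L) u v / scale n)
  = bilin (inverse_error n) u v / scale n.
Proof.
rewrite /inverse_error bilinB !bilinZ; field; exact: lt0r_neq0 (scale_gt0 n).
Qed.

Let error_bound n u v :
  (bilin (inverse_error n) u v / scale n) ^+ 2 <=
  kap1 n ^+ 2 * ((quad_form (invmx L) u / scale n) * (quad_form (invmx L) v / scale n)).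
Proof.
have s0 := scale_gt0 n.
have -> : quad_form (invmx L) u / scale n * (quad_form (invmx L) v / scale n) =
    quad_form (invmx L) u * quad_form (invmx L) v * (scale n)^-1 ^+ 2 by ring.
rewrite exprMn mulrA; apply: ler_wpM2r; first exact: sqr_ge0.
exact: bilin_entry_bound.
Qed.

Let quad_error n v : `|quad_form (invmx (gram n)) v - d%:R * (quad_form (invmx L) v / scale n)|
  <= kap1 n * (quad_form (invmx L) v / scale n).
Proof.
have s0 := scale_gt0 n.
have v0 : 0 <= quad_form (invmx L) v / scale n by rewrite divr_ge0 // ltW.
have kv := mulr_ge0 (kap1_ge0 n) v0.
rewrite [quad_form (invmx (gram n)) v]quad_formE [in X in _ - X]quad_formE bilin_error.
rewrite -(@ler_pXn2r _ 2) ?nnegrE //.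
rewrite real_normK ?num_real //; apply: le_trans (error_bound n v v) _.
by rewrite !quad_formE -expr2 -exprMn.
Qed.

(** One sequence for three errors: [kap1 n] serves [V], [kap1 n.+1] serves [f], and the last group
    serves [b^2], through [b^2 - (d b')^2 = x^2 + 2 d x b'] with [x = b - d b'], where [b'] is
    [scaleb]. *)
Let kap n := kap1 n + kap1 n.+1 + (kap1 n.+1 ^+ 2 + 2 * d%:R * kap1 n.+1).

(** The discrepancy of the bilinear forms is controlled by the product of the two quadratic forms;
    hence the third bound is relative to [scalef * scaleV] rather than to [scaleb^2]. *)
Lemma path_error : exists kap : nat -> R,
  [/\ kap n @[n --> \oo] --> 0,
   forall n, `|gramf n - d%:R * scalef n| <= kap n * scalef n,
   forall n, `|gramV n - d%:R * scaleV n| <= kap n * scaleV n &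
   forall n, `|gramb n ^+ 2 - d%:R ^+ 2 * scaleb n ^+ 2| <= kap n * (scalef n * scaleV n)].
Proof.
exists kap.
have k1 : kap1 n.+1 @[n --> \oo] --> 0 by rewrite cvg_shiftS.
have sf0 n : 0 <= scalef n by case: (scale_scheme n) => /andP[].
have sV0 := scaleV_ge0.
have kge n : [/\ kap1 n <= kap n, kap1 n.+1 <= kap n &
    kap1 n.+1 ^+ 2 + 2 * d%:R * kap1 n.+1 <= kap n].
  have a := kap1_ge0 n; have b := kap1_ge0 n.+1; have c := sqr_ge0 (kap1 n.+1).
  have e : 0 <= 2 * d%:R * kap1 n.+1 by rewrite mulr_ge0 // mulr_ge0.
  by split; rewrite /kap; lra.
split.
- have -> : (0 : R) = 0 + 0 + (0 * 0 + 2 * d%:R * 0) by ring.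
  rewrite /kap; apply: cvgD; first exact: cvgD.
  apply: cvgD; last exact: cvgMr.
  by under eq_fun do rewrite expr2; exact: cvgM.
- move=> n; apply: le_trans (quad_error n.+1 (phi n)) _.
  by apply: ler_wpM2r; [exact: sf0|case: (kge n)].
- move=> n; apply: le_trans (quad_error n (m n)) _.
  by apply: ler_wpM2r; [exact: sV0|case: (kge n)].
- move=> n; have [_ _ k3] := kge n.
  have [_ HE H0 bH] := scale_scheme n.
  have HV : scaleH n <= scaleV n.
    by rewrite HE ler_piMl // lerBlDr lerDl.
  pose D := scalef n * scaleV n.
  have D0 : 0 <= D by rewrite mulr_ge0.
  have DH : scalef n * scaleH n <= D by apply: ler_wpM2l.
  pose x := gramb n - d%:R * scaleb n.
  have xD : x ^+ 2 <= kap1 n.+1 ^+ 2 * D.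
    rewrite /x /gramb /scaleb bilin_error; apply: le_trans (error_bound _ _ _) _.
    by apply: ler_wpM2l => //; exact: sqr_ge0.
  have bD : scaleb n ^+ 2 <= D by apply: le_trans bH _.
  have xb : `|x * scaleb n| <= kap1 n.+1 * D.
    have kD := mulr_ge0 (kap1_ge0 n.+1) D0.
    rewrite -(@ler_pXn2r _ 2) ?nnegrE //.
    rewrite real_normK ?num_real // [(x * _) ^+ 2]exprMn.
    rewrite [(kap1 _ * _) ^+ 2]exprMn [D ^+ 2]expr2 [leRHS]mulrA.
    exact: (ler_pM (sqr_ge0 x) (sqr_ge0 _) xD bD).
  have -> : gramb n ^+ 2 - d%:R ^+ 2 * scaleb n ^+ 2 =
      x ^+ 2 + 2 * d%:R * (x * scaleb n) by rewrite /x; ring.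
  apply: (@le_trans _ _ ((kap1 n.+1 ^+ 2 + 2 * d%:R * kap1 n.+1) * D)); last first.
    exact: ler_wpM2r.
  apply: le_trans (ler_normD _ _) _; rewrite [leRHS]mulrDl.
  apply: lerD; first by rewrite ger0_norm ?sqr_ge0.
  have d2 : 0 <= 2 * d%:R :> R by rewrite mulr_ge0.
  by rewrite normrM (ger0_norm d2) -[leRHS]mulrA ler_wpM2l.
Qed.

Let tau n := \sum_(0 <= k < n) scalef k.

Let sf0 n : 0 <= scalef n.
Proof. by case: (scale_scheme n) => /andP[]. Qed.

Let gramf_sim : sim (fun n => d%:R * scalef n) gramf.
Proof.
have [k [k0 H _ _]] := path_error.
move=> e e0.
have : \forall n \near \oo, `|0 - k n| <= e by move/cvgrPdist_le : k0; exact.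
apply: filterS => n; rewrite sub0r normrN => /(le_trans (ler_norm _)) ke.
apply: le_trans (H n) _; rewrite [leRHS]mulrA; apply: ler_wpM2r => //.
by apply: le_trans ke _; rewrite ler_peMr ?ler1n // ltW.
Qed.

Lemma scalef_cvg0 : scalef n @[n --> \oo] --> 0.
Proof.
have ds0 n : 0 <= d%:R * scalef n by rewrite mulr_ge0.
have D := sim_cvg0 ds0 gramf_sim f_cvg0.
have -> : scalef = (fun n => d%:R^-1 * (d%:R * scalef n)).
  by apply/funext => n; rewrite mulrA mulVf ?gt_eqF // mul1r.
by rewrite -[X in _ --> X](mulr0 (d%:R^-1)); apply: cvgMr.
Qed.

Let lnstep n := ln (scale n.+1) - ln (scale n).

Let ln_scale n : ln (scale n) = \sum_(0 <= k < n) lnstep k.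
Proof.
by rewrite telescope_sumr // [scale 0%N]/scale big_geq // addr0 ln1 subr0.
Qed.

(* [x <= - ln (1 - x) <= x / (1 - x)] with [x = scalef n]. *)
Let lnstep_bounds n : scalef n <= lnstep n /\ (1 - scalef n) * lnstep n <= scalef n.
Proof.
have s0 := scale_gt0 n; have s1 := scale_gt0 n.+1.
have ln_le (z : R) : 0 < z -> ln z <= z - 1.
  by move=> z0; rewrite -{2}(lnK z0) lerBrDr addrC expR_ge1Dx.
split.
  have := ln_le (scale n / scale n.+1) (divr_gt0 s0 s1).
  rewrite ln_div ?posrE // /lnstep scalefE.
  have -> : (scale n.+1 - scale n) / scale n.+1 = 1 - scale n / scale n.+1.
    by field; exact: lt0r_neq0.
  lra.
have := ln_le (scale n.+1 / scale n) (divr_gt0 s1 s0).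
rewrite ln_div ?posrE // => H.
have p0 : 0 <= scale n / scale n.+1 by rewrite divr_ge0 // ltW.
have := ler_wpM2l p0 H.
have -> : scale n / scale n.+1 * (scale n.+1 / scale n - 1) = scalef n.
  by rewrite scalefE; field; rewrite !gt_eqF.
have -> : 1 - scalef n = scale n / scale n.+1.
  by rewrite scalefE; field; exact: lt0r_neq0.
by [].
Qed.

Let lnstep_sim : sim scalef lnstep.
Proof.
move=> e e0; pose c := Num.min (1 / 2) (e / 2).
have c0 : 0 < c by rewrite lt_min !divr_gt0.
have c1 : c <= 1 / 2 by rewrite ge_min lexx.
have ce : c <= e / 2 by rewrite ge_min lexx orbT.
have : \forall n \near \oo, `|0 - scalef n| <= c by move/cvgrPdist_le : scalef_cvg0; exact.
apply: filterS => n; rewrite sub0r normrN ger0_norm // => sc.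
have [a b] := lnstep_bounds n; have x0 := sf0 n.
rewrite ger0_norm ?subr_ge0 //.
have l0 : 0 <= lnstep n by exact: le_trans a.
have l2 : lnstep n <= 2 * scalef n.
  have : (1 / 2) * lnstep n <= (1 - scalef n) * lnstep n by rewrite ler_wpM2r //; lra.
  lra.
have : scalef n * lnstep n <= e / 2 * (2 * scalef n).
  by apply: ler_pM => //; exact: le_trans ce.
lra.
Qed.

Let scale_oo : scale n.+1 @[n --> \oo] --> +oo.
Proof.
apply/cvgryPge => A.
have h2 : 0 < d%:R / 2 :> R by rewrite divr_gt0.
have H1 : \forall n \near \oo, `|d%:R - (alpha n)^-1 * scale n.+1| <= d%:R / 2.
  by move/cvgrPdist_le : scale_alpha; exact.
have H2 : \forall n \near \oo, A / (d%:R / 2) <= alpha n by move/cvgryPge : alpha_oo; exact.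
apply: filterS2 H1 H2 => n /ler_normlP[B C].
rewrite ler_pdivrMr // => /le_trans; apply.
have : d%:R / 2 <= (alpha n)^-1 * scale n.+1 by lra.
by rewrite [(alpha n)^-1 * _]mulrC ler_pdivlMr // [_ * alpha n]mulrC.
Qed.

(** From some rank on, an increment of [ln scale] is at most twice that of [tau], and [scale]
    diverges with [alpha], their ratio having the positive limit [d]. *)
Lemma tau_cvgy : tau n @[n --> \oo] --> +oo.
Proof.
have [N _ HN] := lnstep_sim ltr01.
rewrite -(cvg_shiftS tau); apply/cvgryPge => A.
have B : \forall n \near \oo, expR (2 * A + ln (scale N)) <= scale n.+1.
  by move/cvgryPge : scale_oo; exact.
near=> n.
have Nn : (N <= n.+1)%N by near: n; exists N => // n /= /leqW.
have : expR (2 * A + ln (scale N)) <= scale n.+1 by near: n.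
rewrite -{1}(lnK (scale_gt0 n.+1)) ler_expR !ln_scale.
rewrite [X in _ <= X](big_cat_nat _ Nn) //=.
have : \sum_(N <= k < n.+1) lnstep k <= 2 * tau n.+1.
  apply: (@le_trans _ _ (\sum_(N <= k < n.+1) 2 * scalef k)).
    rewrite big_nat_cond [leRHS]big_nat_cond.
    apply: ler_sum => k /andP[/andP[Nk _] _].
    have := HN k Nk; rewrite mul1r => /ler_normlP[C D]; lra.
  rewrite -mulr_sumr; apply: ler_wpM2l => //.
  by rewrite /tau [leRHS](big_cat_nat _ Nn) //= lerDr sumr_ge0.
lra.
Unshelve. all: by end_near. Qed.

Lemma gramf_sum_cvgy : \sum_(0 <= k < n) gramf k @[n --> \oo] --> +oo.
Proof.
have h2 : 0 < 1 / 2 :> R by rewrite divr_gt0.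
have [N _ HN] := gramf_sim h2.
have d1 : 1 <= d%:R :> R by rewrite ler1n.
have gf0 n : 0 <= gramf n by case: (gram_scheme n) => /andP[].
apply/cvgryPge => A; near=> n.
have Nn : (N <= n)%N by near: n; exact: nbhs_infty_ge.
have At : 2 * A + tau N <= tau n by near: n; move/cvgryPge : tau_cvgy; exact.
rewrite [leRHS](big_cat_nat _ Nn) //=.
apply: (@le_trans _ _ (\sum_(N <= k < n) (1 / 2) * scalef k)).
  rewrite -mulr_sumr; move: At; rewrite /tau (big_cat_nat _ Nn) //=; lra.
apply: (@le_trans _ _ (\sum_(N <= k < n) gramf k)); last by rewrite lerDr sumr_ge0.
rewrite big_nat_cond [leRHS]big_nat_cond.
apply: ler_sum => k /andP[/andP[Nk _] _].
have /ler_normlP[B _] := HN k Nk.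
have := ler_wpM2r (sf0 k) d1; lra.
Unshelve. all: by end_near. Qed.

Let ln_scale_tau : (tau n)^-1 * ln (scale n) @[n --> \oo] --> (1 : R).
Proof.
have H : avg tau scalef 1.
  apply: cvg_near_cst; near=> n.
  have t0 : 0 < tau n by near: n; move/cvgryPgt : tau_cvgy; exact.
  by rewrite -/(tau n) mulVf // gt_eqF.
have := avg_sim tau_cvgy sf0 lnstep_sim H; rewrite /avg.
by under eq_fun do rewrite -ln_scale.
Unshelve. all: by end_near. Qed.

(** The determinant of [gram] is [scale^d] times that of [gram / scale], which converges to a
    positive number; so its logarithm behaves as [d * ln scale], and [ln scale] as [tau]. *)
Lemma ln_det_tau :
  (tau n.+1)^-1 * ln (\det (gram n.+1)) @[n --> \oo] --> (d%:R : R).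
Proof.
have detL : 0 < \det (d%:R^-1 *: L) by rewrite detZ mulr_gt0 ?exprn_gt0 ?invr_gt0 // posdef_det_gt0.
have H1 : ln (\det ((scale n.+1)^-1 *: gram n.+1)) @[n --> \oo] --> ln (\det (d%:R^-1 *: L)).
  have := det_cvg gram_scale.
  by move=> D; apply: continuous_cvg; [exact: continuous_ln|exact: D].
have ti : (tau n.+1)^-1 @[n --> \oo] --> 0.
  rewrite (cvg_shiftS (fun n => (tau n)^-1)); apply/(gtr0_cvgV0 _); last exact: tau_cvgy.
  by move/cvgryPgt : tau_cvgy; exact.
have H2 := ln_scale_tau; rewrite -(cvg_shiftS (fun n => (tau n)^-1 * ln (scale n))) in H2.
have : (tau n.+1)^-1 * ln (\det ((scale n.+1)^-1 *: gram n.+1)) +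
    d%:R * ((tau n.+1)^-1 * ln (scale n.+1)) @[n --> \oo] -->
    0 * ln (\det (d%:R^-1 *: L)) + d%:R * 1.
  by apply: cvgD; [exact: cvgM|apply: cvgMr; exact: H2].
rewrite mul0r add0r mulr1; apply: cvg_trans; apply: near_eq_cvg; apply: nearW => n /=.
have s0 := scale_gt0 n.+1.
have g0 := posdef_det_gt0 (gram_posdef n.+1).
rewrite detZ lnM ?posrE ?exprn_gt0 ?invr_gt0 // lnXn ?invr_gt0 // lnV ?posrE //.
by rewrite -[_ *+ d]mulr_natl; ring.
Qed.


End normalised_path.

(** * Conclusion *)

Lemma moment_ell {R : realType} d (sigma : R) p : (1 <= d)%N -> (1 <= p)%N ->
  d%:R ^+ p * moment d sigma p = ell d sigma p.
Proof.
move=> d1 p1; have dR : 0 < d%:R :> R by rewrite ltr0n.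
have -> : d%:R ^+ p * moment d sigma p =
    sigma ^+ (2 * p) * \prod_(0 <= j < p) (d + 2 * j)%:R.
  elim: p {p1} => [|p IH]; first by rewrite muln0 !expr0 big_geq.
  transitivity (sigma ^+ 2 * (d + 2 * p)%:R * (d%:R ^+ p * moment d sigma p)).
    by rewrite [moment d sigma p.+1]/= [d%:R ^+ p.+1]exprS; field; rewrite gt_eqF.
  by rewrite IH mulnS [sigma ^+ (2 + _)]exprD big_nat_recr //=; ring.
by rewrite /ell (big_ltn p1) muln0 addn0; ring.
Qed.

Section path_limits.
Context {R : realType} {d : nat}.
Variables (S L : 'M[R]_d) (phi m : nat -> 'cV[R]_d) (alpha : nat -> R).
Variables (sigma : R) (p : nat).
Hypothesis Spd : sym_posdef S.
Hypothesis Lpd : sym_posdef L.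
Hypothesis d_ge1 : (1 <= d)%N.
Hypothesis p_ge1 : (1 <= p)%N.
Hypothesis alpha_gt0 : forall n, 0 < alpha n.
Hypothesis alpha_oo : alpha n @[n --> \oo] --> +oo.
Hypothesis gram_cvg : forall i j,
  ((alpha n)^-1 *: gram S phi n.+1) i j @[n --> \oo] --> L i j.
Hypothesis f_cvg0 : gramf S phi n @[n --> \oo] --> 0.
Hypothesis scale_law : forall q, (0 < q)%N -> (q <= p)%N ->
  power_law sigma (scalef L phi) (scaleV L phi m) (scaleH L phi m) (scaleb L phi m) q.
Hypothesis gram_law : forall q, (0 < q)%N -> (q <= p)%N ->
  power_law sigma (gramf S phi) (gramV S phi m) (gramH S phi m) (gramb S phi m) q.

Let tau n := \sum_(0 <= k < n) scalef L phi k.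

(** Changes clock from [tau] to [ln det], which divides limits by [d]. The averages start at 0 and
    the target sums at 1: the missing term is killed by [1 / tau]. *)
Let avg_ln_det (x : nat -> R) l : avg tau x (d%:R * l) ->
  (ln (\det (gram S phi n.+1)))^-1 * \sum_(1 <= k < n.+1) x k @[n --> \oo] --> l.
Proof.
move=> xl.
have dR : d%:R != 0 :> R by rewrite pnatr_eq0 -lt0n.
have tauoo : tau n @[n --> \oo] --> +oo.
  exact: (tau_cvgy m Spd Lpd d_ge1 alpha_gt0 alpha_oo gram_cvg f_cvg0).
have ld := ln_det_tau m Spd Lpd d_ge1 alpha_gt0 alpha_oo gram_cvg f_cvg0.
have tS : tau n.+1 @[n --> \oo] --> +oo by rewrite (cvg_shiftS tau).
have t0 : \forall n \near \oo, 0 < tau n.+1 by move/cvgryPgt : tS; exact.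
have ti : (tau n.+1)^-1 @[n --> \oo] --> 0 by apply/(gtr0_cvgV0 t0).
have xS : (tau n.+1)^-1 * \sum_(0 <= k < n.+1) x k @[n --> \oo] --> d%:R * l.
  by rewrite (cvg_shiftS (fun n => (tau n)^-1 * \sum_(0 <= k < n) x k)).
have : ((tau n.+1)^-1 * ln (\det (gram S phi n.+1)))^-1 *
    ((tau n.+1)^-1 * \sum_(0 <= k < n.+1) x k - (tau n.+1)^-1 * x 0%N) @[n --> \oo] -->
    d%:R^-1 * (d%:R * l - 0 * x 0%N).
  apply: cvgM; first exact: cvgV.
  by apply: cvgB => //; apply: cvgM => //; exact: cvg_cst.
rewrite mul0r subr0 mulKf //; apply: cvg_trans; apply: near_eq_cvg.
apply: filterS t0 => n tn.
rewrite [\sum_(0 <= k < n.+1) x k]big_ltn // -mulrBr addrC addKr.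
by rewrite invfM invrK mulrACA divff ?mul1r // gt_eqF.
Qed.

Lemma path_limits :
  (ln (\det (gram S phi n.+1)))^-1 *
    (\sum_(1 <= k < n.+1) gramf S phi k * gramV S phi m k ^+ p)
    @[n --> \oo] --> ell d sigma p /\
  (ln (\det (gram S phi n.+1)))^-1 *
    (\sum_(1 <= k < n.+1) (gramV S phi m k ^+ p - gramH S phi m k ^+ p))
    @[n --> \oo] --> lambda d sigma p.
Proof.
have dR : d%:R != 0 :> R by rewrite pnatr_eq0 -lt0n.
have [kap [kap0 e1 e2 e3]] := path_error m Spd Lpd d_ge1 alpha_gt0 alpha_oo gram_cvg.
have tauoo := tau_cvgy m Spd Lpd d_ge1 alpha_gt0 alpha_oo gram_cvg f_cvg0.
have GS n := gram_scheme phi m Spd n.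
have LS n := scale_scheme phi m Lpd n.
have de01 n : 0 <= scalef L phi n <= 1.
  by have [/andP[a b] _ _ _] := LS n; rewrite a ltW.
have f01 n : 0 <= gramf S phi n <= 1.
  by have [/andP[a b] _ _ _ _] := GS n; rewrite a ltW.
have H2E n : scaleH L phi m n = (1 - scalef L phi n) * scaleV L phi m n.
  by have [] := LS n.
have b1E n : gramb S phi m n ^+ 2 =
    (1 - gramf S phi n) * (gramV S phi m n - gramH S phi m n).
  by have [] := GS n.
have H1V n : gramH S phi m n <= gramV S phi m n by have [] := GS n.
have VH1 n : gramV S phi m n - gramH S phi m n <= gramf S phi n * gramV S phi m n.
  by have [] := GS n.
have [A B] := moment_limits d_ge1 de01 tauoo kap0 (scaleV_ge0 phi m Lpd) H2E f01 f_cvg0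
  (gramH_ge0 phi m Spd) H1V VH1 b1E e1 e2 e3 scale_law gram_law p_ge1 (leqnn p).
have mE := moment_ell sigma d_ge1 p_ge1.
split; apply: avg_ln_det; rewrite -/(avg tau _ _).
  by rewrite -mE mulrA -exprS.
rewrite /lambda -mE.
have -> : d%:R * (p%:R / d%:R * (d%:R ^+ p * moment d sigma p)) =
  p%:R * d%:R ^+ p * moment d sigma p by field.
exact: B.
Qed.

End path_limits.

Lemma ae_exists {disp} {T : measurableType disp} {R : realType} (P : probability T R)
    (Q : T -> Prop) : {ae P, forall w, Q w} -> exists w, Q w.
Proof.
move=> [N [mN PN QN]]; apply/not_existsP => nQ.
have NT : N = setT by apply/seteqP; split => // w _; apply: QN => /=; exact: nQ.
by move: PN; rewrite NT probability_setT => /eqP; rewrite onee_eq0.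
Qed.

Lemma ae_forall_imply {disp} {T : measurableType disp} {R : realType}
    (P : probability T R) (A : Prop) (Q : T -> Prop) :
  (A -> {ae P, forall w, Q w}) -> {ae P, forall w, A -> Q w}.
Proof.
move=> H; have [a|na] := pselect A; first by apply: filterS (H a).
by apply: aeW => w /na.
Qed.

(** A limit of positive definite matrices is only semidefinite; invertibility of [L] restores strict
    positivity. *)
Lemma limit_posdef {R : realType} d (S L : 'M[R]_d) (phi : nat -> 'cV[R]_d)
    (alpha : nat -> R) : sym_posdef S -> L^T = L -> L \in unitmx ->
  (forall n, 0 < alpha n) ->
  (forall i j, ((alpha n)^-1 *: gram S phi n.+1) i j @[n --> \oo] --> L i j) ->
  sym_posdef L.
Proof.
move=> Spd LT Lu a0 SL; apply: psd_unit_posdef => // x.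
have C : bilin ((alpha n)^-1 *: gram S phi n.+1) x x @[n --> \oo] --> quad_form L x.
  rewrite quad_formE bilinE; under eq_fun do rewrite bilinE.
  apply: cvg_sum_realfun => i; apply: cvg_sum_realfun => j.
  by apply: cvgM; [apply: cvgMr; exact: SL|exact: cvg_cst].
rewrite -(cvg_lim _ C) //; apply: limr_ge; first exact: cvgP C.
apply: nearW => n; rewrite bilinZ mulr_ge0 ?invr_ge0 ?(ltW (a0 n)) //.
exact: posdef_ge0 (gram_posdef phi Spd n.+1).
Qed.

(** * Measurability of both normalisations, and the power law for each *)

Section random_gram.
Context {disp : measure_display} {T : measurableType disp} {R : realType}.
Variable P : probability T R.
Variable F : nat -> set (set T).
Hypothesis F_filt : filtration F.
Variables (eps : nat -> T -> R) (sigma a : R) (C : nat -> T -> \bar R).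
Hypothesis eps_md : martingale_difference P F eps.
Hypothesis eps_var : forall n, is_cond_expectation P (F n)
  (fun w => (eps n.+1 w ^+ 2)%:E) (cst (sigma ^+ 2)%:E).
Hypothesis C_cond : forall n, is_cond_expectation P (F n)
  (fun w => (`|eps n.+1 w| `^ a)%:E) (C n).
Hypothesis C_bounded : {ae P, forall w,
  (ereal_sup (range (fun n => C n w)) < +oo)%E}.
Variables (d : nat) (Phi : nat -> T -> 'cV[R]_d) (M0 : T -> 'cV[R]_d).
Variables (S L : 'M[R]_d).
Hypothesis Phi_adapted : forall n, vector_measurable_wrt (F n) (Phi n).
Hypothesis M0_meas : vector_measurable_wrt (F 0%N) M0.
Hypothesis Spd : sym_posdef S.
Hypothesis Lpd : sym_posdef L.

Let M n w := mart_transform M0 Phi eps n w.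

Lemma mart_transformS n w : M n.+1 w = M n w + eps n.+1 w *: Phi n w.
Proof. by rewrite /M /mart_transform big_nat_recr //= addrA. Qed.

Let mPhi n : mx_measurable_wrt (F n) (Phi n).
Proof. by move=> i j; rewrite (ord1 j); exact: Phi_adapted. Qed.

Let up n m' p' (A : T -> 'M[R]_(m', p')) :
  mx_measurable_wrt (F n) A -> mx_measurable_wrt (F n.+1) A.
Proof. by move=> mA i j; exact: (measurable_wrt_le F_filt (leqnSn n) (mA i j)). Qed.

Lemma mx_measurable_transform n : mx_measurable_wrt (F n) (M n).
Proof.
elim: n => [|n IH].
  have -> : M 0%N = M0.
    by apply/funext => w; rewrite /M /mart_transform big_geq // addr0.
  by move=> i j; rewrite (ord1 j); exact: M0_meas.
have -> : M n.+1 = fun w => M n w + eps n.+1 w *: Phi n w.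
  by apply/funext => w; rewrite mart_transformS.
apply: mx_measurableD; first exact: up IH.
apply: mx_measurableZ; first exact: (measurable_eps eps_md).
exact: up (@mPhi n).
Qed.

Let Gm n w := gram S (Phi^~ w) n.

Let mgramS n : mx_measurable_wrt (F n) (Gm n.+1).
Proof.
have GS k : Gm k.+1 = fun w => Gm k w + Phi k w *m (Phi k w)^T.
  by apply/funext => w; rewrite /Gm gramS.
have mPP k : mx_measurable_wrt (F k) (fun w => Phi k w *m (Phi k w)^T).
  by apply: mx_measurableM; [exact: mPhi|apply: mx_measurable_tr; exact: mPhi].
elim: n => [|n IH]; rewrite GS; apply: mx_measurableD; try exact: mPP.
  have -> : Gm 0%N = fun=> S by apply/funext => w; rewrite /Gm /gram big_geq // add0r.
  exact: mx_measurable_cst.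
exact: up IH.
Qed.

Let mgram n : mx_measurable_wrt (F n) (Gm n).
Proof.
case: n => [|n]; last exact: up (@mgramS n).
have -> : Gm 0%N = fun=> S by apply/funext => w; rewrite /Gm /gram big_geq // add0r.
exact: mx_measurable_cst.
Qed.

Let Gpd n w : sym_posdef (Gm n w). Proof. exact: gram_posdef. Qed.
Let Gu n w : Gm n w \in unitmx. Proof. exact: posdef_unit. Qed.

Let miGS n : mx_measurable_wrt (F n) (fun w => invmx (Gm n.+1 w)).
Proof. by apply: mx_measurable_inv; [exact: Gu|exact: mgramS]. Qed.

Let miG n : mx_measurable_wrt (F n) (fun w => invmx (Gm n w)).
Proof. by apply: mx_measurable_inv; [exact: Gu|exact: mgram]. Qed.

Let miL n : mx_measurable_wrt (F n) (fun=> invmx L).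
Proof. exact: mx_measurable_cst. Qed.

Let mM := mx_measurable_transform.

Let mscaleS n : measurable_wrt (F n) (fun w => (scale L (Phi^~ w) n.+1)^-1).
Proof.
apply: measurable_inv_realfun.
have sS k : (fun w => scale L (Phi^~ w) k.+1) =
    fun w => scale L (Phi^~ w) k + quad_form (invmx L) (Phi k w).
  by apply/funext => w; rewrite scaleS.
have mq k : measurable_wrt (F k) (fun w => quad_form (invmx L) (Phi k w)).
  by apply: measurable_bilin; [exact: miL|exact: mPhi|exact: mPhi].
elim: n => [|n IH]; rewrite sS; apply: measurable_funD; try exact: mq.
  have -> : (fun w => scale L (Phi^~ w) 0) = cst 1.
    by apply/funext => w; rewrite /scale big_geq // addr0.
  exact: measurable_cst.
exact: (measurable_wrt_le F_filt (leqnSn n) IH).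
Qed.

Let mscale n : measurable_wrt (F n) (fun w => (scale L (Phi^~ w) n)^-1).
Proof.
case: n => [|n]; last exact: (measurable_wrt_le F_filt (leqnSn n) (@mscaleS n)).
have -> : (fun w => (scale L (Phi^~ w) 0)^-1) = cst 1.
  by apply/funext => w; rewrite /scale big_geq // addr0 invr1.
exact: measurable_cst.
Qed.

Lemma gram_power_law q : (0 < q)%N -> (2 * q)%:R < a -> {ae P, forall w,
  \sum_(0 <= k < n) gramf S (Phi^~ w) k @[n --> \oo] --> +oo ->
  gramf S (Phi^~ w) n @[n --> \oo] --> 0 ->
  power_law sigma (gramf S (Phi^~ w)) (gramV S (Phi^~ w) (M^~ w))
    (gramH S (Phi^~ w) (M^~ w)) (gramb S (Phi^~ w) (M^~ w)) q}.
Proof.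
move=> q0 qa.
have GS n w := gram_scheme (Phi^~ w) (M^~ w) Spd n.
apply: (scheme_law F_filt eps_md eps_var C_cond C_bounded q0 qa
  (Z := fun n w => gramV S (Phi^~ w) (M^~ w) n)
  (H := fun n w => gramH S (Phi^~ w) (M^~ w) n)
  (b := fun n w => gramb S (Phi^~ w) (M^~ w) n)
  (g := fun n w => gramf S (Phi^~ w) n)).
- by move=> n; apply: measurable_bilin; [exact: miG|exact: mM|exact: mM].
- by move=> n; apply: measurable_bilin; [exact: miGS|exact: mM|exact: mM].
- by move=> n; apply: measurable_bilin; [exact: miGS|exact: mPhi|exact: mM].
- by move=> n; apply: measurable_bilin; [exact: miGS|exact: mPhi|exact: mPhi].
- by move=> n w; exact: gramH_ge0.
- by move=> n w; have [] := GS n w.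
- by move=> n w; have [/andP[f0 f1] _ _ _ _] := GS n w; rewrite f0 ltW.
- move=> n w; have [/andP[f0 f1] -> HV _ _] := GS n w.
  by rewrite ler_piMl ?subr_ge0 // lerBlDr lerDl.
- by move=> n w; have [] := GS n w.
- move=> n w; rewrite /gramV mart_transformS quad_formDZ //.
  exact: (proj1 (posdef_inv (Gpd n.+1 w))).
Qed.

Lemma scale_power_law q : (0 < q)%N -> (2 * q)%:R < a -> {ae P, forall w,
  \sum_(0 <= k < n) scalef L (Phi^~ w) k @[n --> \oo] --> +oo ->
  scalef L (Phi^~ w) n @[n --> \oo] --> 0 ->
  power_law sigma (scalef L (Phi^~ w)) (scaleV L (Phi^~ w) (M^~ w))
    (scaleH L (Phi^~ w) (M^~ w)) (scaleb L (Phi^~ w) (M^~ w)) q}.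
Proof.
move=> q0 qa.
have LS n w := scale_scheme (Phi^~ w) (M^~ w) Lpd n.
have V0 n w := scaleV_ge0 (Phi^~ w) (M^~ w) Lpd n.
have HV n w : scaleH L (Phi^~ w) (M^~ w) n <= scaleV L (Phi^~ w) (M^~ w) n.
  have [/andP[f0 _] -> _ _] := LS n w.
  by rewrite ler_piMl // lerBlDr lerDl.
apply: (scheme_law F_filt eps_md eps_var C_cond C_bounded q0 qa
  (Z := fun n w => scaleV L (Phi^~ w) (M^~ w) n)
  (H := fun n w => scaleH L (Phi^~ w) (M^~ w) n)
  (b := fun n w => scaleb L (Phi^~ w) (M^~ w) n)
  (g := fun n w => scalef L (Phi^~ w) n)).
- move=> n; apply: measurable_funM; last exact: mscale.
  by apply: measurable_bilin; [exact: miL|exact: mM|exact: mM].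
- move=> n; apply: measurable_funM; last exact: mscaleS.
  by apply: measurable_bilin; [exact: miL|exact: mM|exact: mM].
- move=> n; apply: measurable_funM; last exact: mscaleS.
  by apply: measurable_bilin; [exact: miL|exact: mPhi|exact: mM].
- move=> n; apply: measurable_funM; last exact: mscaleS.
  by apply: measurable_bilin; [exact: miL|exact: mPhi|exact: mPhi].
- by move=> n w; have [] := LS n w.
- exact: HV.
- by move=> n w; have [/andP[f0 f1] _ _ _] := LS n w; rewrite f0 ltW.
(* Here [b^2 <= f H <= f V], and [f V] is exactly the decrement. *)
- move=> n w; have [/andP[f0 f1] HE _ bH] := LS n w; apply: le_trans bH _.
  have -> : scaleV L (Phi^~ w) (M^~ w) n - scaleH L (Phi^~ w) (M^~ w) n =
    scalef L (Phi^~ w) n * scaleV L (Phi^~ w) (M^~ w) n by rewrite HE; ring.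
  by apply: ler_wpM2l => //; exact: HV.
- by move=> n w; have [] := LS n w.
- move=> n w; rewrite /scaleV mart_transformS quad_formDZ; last first.
    exact: (proj1 (posdef_inv Lpd)).
  by rewrite /scaleH /scaleb /scalef; ring.
Qed.

End random_gram.

Theorem theorem2p1 (disp : measure_display) (T : measurableType disp)
  (R : realType) (P : probability T R)
  (d : nat) (d_ge1 : (1 <= d)%N)
  (F : nat -> set (set T)) (F_filt : filtration F)
  (eps : nat -> T -> R) (eps_md : martingale_difference P F eps)
  (sigma : R)
  (eps_var : forall n, is_cond_expectation P (F n)
     (fun w => (eps n.+1 w ^+ 2)%:E) (cst (sigma ^+ 2)%:E))
  (p : nat) (p_ge1 : (1 <= p)%N) (a : R) (a_gt2p : (2 * p)%:R < a)
  (C : nat -> T -> \bar R)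
  (C_cond : forall n, is_cond_expectation P (F n)
     (fun w => (`|eps n.+1 w| `^ a)%:E) (C n))
  (C_bounded : {ae P, forall w,
     (ereal_sup (range (fun n => C n w)) < +oo)%E})
  (Phi : nat -> T -> 'cV[R]_d)
  (Phi_adapted : forall n, vector_measurable_wrt (F n) (Phi n))
  (M0 : T -> 'cV[R]_d) (M0_meas : vector_measurable_wrt (F 0%N) M0)
  (S : 'M[R]_d) (S_pd : sym_posdef S)
  (f_cvg0 : {ae P, forall w, explosion S Phi n w @[n --> \oo] --> (0 : R)})
  (alpha : nat -> {RV P >-> R})
  (alpha_incr : {ae P, forall w,
     [/\ forall n, 0 < alpha n w,
         nondecreasing_seq (fun n => alpha n w) &
         alpha n w @[n --> \oo] --> +oo]})
  (L : 'M[R]_d) (L_sym : L^T = L) (L_inv : L \in unitmx)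
  (S_cvg : {ae P, forall w,
     (alpha n w)^-1 *: Smx S Phi n w @[n --> \oo] --> L}) :
  {ae P, forall w,
     (ln (detS S Phi n w))^-1 *
       (\sum_(1 <= k < n.+1) explosion S Phi k w *
          quad_form (invmx (Smx S Phi k.-1 w))
            (mart_transform M0 Phi eps k w) ^+ p)
       @[n --> \oo] --> ell d sigma p
  /\ (ln (detS S Phi n w))^-1 *
       (\sum_(1 <= k < n.+1)
          (quad_form (invmx (Smx S Phi k.-1 w))
             (mart_transform M0 Phi eps k w) ^+ p
         - quad_form (invmx (Smx S Phi k w))
             (mart_transform M0 Phi eps k w) ^+ p))
       @[n --> \oo] --> lambda d sigma p}.
Proof.
have entry_cvg w : (alpha n w)^-1 *: Smx S Phi n w @[n --> \oo] --> L ->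
    forall i j, ((alpha n w)^-1 *: gram S (Phi^~ w) n.+1) i j @[n --> \oo] --> L i j.
  move=> H i j; apply: (cvg_comp _ (fun A : 'M[R]_d => A i j) H).
  exact: coord_continuous.
(* As [L] is deterministic, one path satisfying both almost sure assumptions is enough. *)
have Lpd : sym_posdef L.
  have [w [[a0 _ _] SL]] := ae_exists (filterI alpha_incr S_cvg).
  exact: (limit_posdef S_pd L_sym L_inv a0 (entry_cvg w SL)).
have q2a q : (q <= p)%N -> (2 * q)%:R < a.
  by move=> qp; apply: le_lt_trans a_gt2p; rewrite ler_nat leq_mul2l qp orbT.
have law_gram : {ae P, forall w q, (0 < q)%N -> (q <= p)%N ->
    \sum_(0 <= k < n) gramf S (Phi^~ w) k @[n --> \oo] --> +oo ->
    gramf S (Phi^~ w) n @[n --> \oo] --> 0 ->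
    power_law sigma (gramf S (Phi^~ w))
      (gramV S (Phi^~ w) (fun n => mart_transform M0 Phi eps n w))
      (gramH S (Phi^~ w) (fun n => mart_transform M0 Phi eps n w))
      (gramb S (Phi^~ w) (fun n => mart_transform M0 Phi eps n w)) q}.
  apply/ae_foralln => q; apply: ae_forall_imply => q0; apply: ae_forall_imply => qp.
  exact: (gram_power_law F_filt eps_md eps_var C_cond C_bounded Phi_adapted M0_meas
    S_pd q0 (q2a q qp)).
have law_scale : {ae P, forall w q, (0 < q)%N -> (q <= p)%N ->
    \sum_(0 <= k < n) scalef L (Phi^~ w) k @[n --> \oo] --> +oo ->
    scalef L (Phi^~ w) n @[n --> \oo] --> 0 ->
    power_law sigma (scalef L (Phi^~ w))
      (scaleV L (Phi^~ w) (fun n => mart_transform M0 Phi eps n w))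
      (scaleH L (Phi^~ w) (fun n => mart_transform M0 Phi eps n w))
      (scaleb L (Phi^~ w) (fun n => mart_transform M0 Phi eps n w)) q}.
  apply/ae_foralln => q; apply: ae_forall_imply => q0; apply: ae_forall_imply => qp.
  exact: (scale_power_law F_filt eps_md eps_var C_cond C_bounded Phi_adapted M0_meas
    Lpd q0 (q2a q qp)).
apply: filterS2 (filterI alpha_incr S_cvg) (filterI f_cvg0 (filterI law_gram law_scale)).
move=> w [[a0 _ aoo] SL] [f0 [lawG lawS]].
have {}SL := entry_cvg w SL.
pose m n := mart_transform M0 Phi eps n w.
have fz : gramf S (Phi^~ w) n @[n --> \oo] --> 0 by exact: f0.
have tauoo := tau_cvgy m S_pd Lpd d_ge1 a0 aoo SL fz.
have sz := scalef_cvg0 m S_pd Lpd d_ge1 a0 aoo SL fz.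
have foo := gramf_sum_cvgy m S_pd Lpd d_ge1 a0 aoo SL fz.
have [A B] := path_limits S_pd Lpd d_ge1 p_ge1 a0 aoo SL fz
  (fun q q0 qp => lawS q q0 qp tauoo sz) (fun q q0 qp => lawG q q0 qp foo fz).
split.
  (* [Smx] at [n] is [gram] at [n.+1] by conversion. Only the index [k.-1] has to be rewritten:
     [Smx] at [k.-1] is [gram] at [k] because the sums start at [k = 1]. *)
  apply: cvg_trans A; apply: near_eq_cvg; apply: nearW => n; congr (_ * _).
  by apply: eq_big_nat => k /andP[k1 _]; rewrite /gramV -{2}(prednK k1).
apply: cvg_trans B; apply: near_eq_cvg; apply: nearW => n; congr (_ * _).
by apply: eq_big_nat => k /andP[k1 _]; rewrite /gramV -{1}(prednK k1).
Qed.
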